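(* Let $m,n\in\mathbb{N}$ be positive integers and let $T_m$ be an $m$-th Calderón-Zygmund type singular integral on $\mathbb{R}^n$. Let $x_0\in\mathbb{R}^n$ and let $1<p,p_1,p_2,\dots,p_m<\infty$ be such that $1/p=1/p_1+1/p_2+\dots+1/p_m$. Suppose that the positive measurable functions $\psi,\varphi_1,\dots,\varphi_m:\mathbb{R}^n\times(0,\infty)\to(0,\infty)$ satisfy, for all $r>0$, $$\int_r^\infty \frac{\operatorname*{ess\,inf}_{t<s<\infty}\left[\left(\prod_{i=1}^m\varphi_i(x_0,s)\right)s^{n/p}\right]}{t^{n/p+1}}\,dt\le C\,\psi(x_0,r),$$ where the constant $C>0$ does not depend on $r$. Then the operator $T_m$ is bounded from the product space $LM^{\{x_0\}}_{p_1,\varphi_1}\times LM^{\{x_0\}}_{p_2,\varphi_2}\times\dots\times LM^{\{x_0\}}_{p_m,\varphi_m}$ to $LM^{\{x_0\}}_{p,\psi}$. Moreover, there is a constant $C'>0$, independent of $f_1,\dots,f_m$, such that $$\|T_m(f_1,\dots,f_m)\|_{LM^{\{x_0\}}_{p,\psi}}\le C'\prod_{i=1}^m\|f_i\|_{LM^{\{x_0\}}_{p_i,\varphi_i}}$$ for all $f_i\in LM^{\{x_0\}}_{p_i,\varphi_i}$, $i=1,\dots,m$.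
   Context: $B(x_0,r)$ is the ball in $\mathbb{R}^n$ with center $x_0$ and radius $r$. **Generalized local Morrey space.** For a positive measurable function $\varphi(x,r)$ on $\mathbb{R}^n\times(0,\infty)$, $1\le p\le\infty$ and fixed $x_0\in\mathbb{R}^n$, $LM^{\{x_0\}}_{p,\varphi}$ is the space of all $f\in L^p_{loc}(\mathbb{R}^n)$ with $$\|f\|_{LM^{\{x_0\}}_{p,\varphi}}=\sup_{r>0}\varphi(x_0,r)^{-1}|B(x_0,r)|^{-1/p}\|f\|_{L^p(B(x_0,r))}<\infty.$$ **$m$-th Calderón-Zygmund type singular integral.** Let $K(y_0,y_1,\dots,y_m)$ be a function defined away from the diagonal $y_0=y_1=\dots=y_m$ in $(\mathbb{R}^n)^{m+1}$ such that, for some $C>0$ and $\epsilon>0$, $$|K(y_0,y_1,\dots,y_m)|\le \frac{C}{\left(\sum_{k,l=0}^m|y_k-y_l|\right)^{mn}}$$ for all $(y_0,\dots,y_m)$ away from the diagonal, and $$|K(y_0,\dots,y_i,\dots,y_m)-K(y_0,\dots,y_i',\dots,y_m)|\le \frac{C|y_i-y_i'|^{\epsilon}}{\left(\sum_{k,l=0}^m|y_k-y_l|\right)^{mn+\epsilon}}$$ whenever $0\le i\le m$ and $|y_i-y_i'|\le \frac12\max_{0\le k\le m}|y_i-y_k|$. An $m$-th Calderón-Zygmund type singular integral is an $m$-linear operator $T_m$, initially defined on the $m$-fold product of the Schwartz space $\mathcal{S}(\mathbb{R}^n)$ with values in the tempered distributions $\mathcal{S}'(\mathbb{R}^n)$,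 such that $$T_m(f_1,\dots,f_m)(x)=\int_{(\mathbb{R}^n)^m}K(x,y_1,\dots,y_m)f_1(y_1)\cdots f_m(y_m)\,dy_1\cdots dy_m$$ whenever $f_1,\dots,f_m$ are smooth with compact support and $x\notin\bigcap_{i=1}^m \mathrm{supp} f_i$. Standing fact about such operators: for all $1<s_1,\dots,s_m<\infty$ and $1/s=1/s_1+\dots+1/s_m$, $T_m$ extends to a bounded operator $L^{s_1}\times\dots\times L^{s_m}\to L^s$, i.e. $\|T_m(f_1,\dots,f_m)\|_{L^s}\le C\prod_i\|f_i\|_{L^{s_i}}$. **Convention for locally integrable arguments.** For $f_i\in L^{p_i}_{loc}$ and any $r>0$, put $B=B(x_0,r)$, $2B=B(x_0,2r)$, $f_i^0=f_i\chi_{2B}$, $f_i^\infty=f_i\chi_{(2B)^c}$. On $B$, $T_m(f_1,\dots,f_m)$ means $T_m(f_1^0,\dots,f_m^0)$ (given by the bounded extension) plus the sum, over all other choices $(\alpha_1,\dots,\alpha_m)\in\{0,\infty\}^m$, of the integrals $\int K(x,y_1,\dots,y_m)\prod_i f_i^{\alpha_i}(y_i)\,dy_1\cdots dy_m$, which converge absolutely under the hypotheses of the claim. *)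

(* Defs.v *)
From HB Require Import structures.
From mathcomp Require Import all_boot all_order all_algebra.
From mathcomp Require Import complex.
From mathcomp Require Import all_classical all_reals all_analysis.
From mathcomp Require Import ess_sup_inf.

Set Implicit Arguments.
Unset Strict Implicit.
Unset Printing Implicit Defensive.

Import Order.TTheory GRing.Theory Num.Theory.
Import numFieldNormedType.Exports.

Local Open Scope classical_set_scope.
Local Open Scope ring_scope.
Local Open Scope complex_scope.

Definition rowvec_display : measure_display -> measure_display.
Proof. exact. Qed.

(* Row vectors carry the product sigma-algebra.  With entries in R this is the
   Borel sigma-algebra of R^n; the same construction applied to 'rV[R]_n gives
   the one of (R^n)^m, whose points are row vectors of row vectors. *)
Section rowvec_measurable.
Context d (T : measurableType d) (n : nat).

Definition rowvec_cylinders : set (set 'rV[T]_n) :=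
  [set A | exists (i : 'I_n) (B : set T),
     measurable B /\ A = (fun v : 'rV[T]_n => v ord0 i) @^-1` B].

Definition rowvec_measurable : set (set 'rV[T]_n) := <<s rowvec_cylinders >>.

Let rowvec0 : rowvec_measurable set0.
Proof. exact: sigma_algebra0. Qed.

Let rowvecC A : rowvec_measurable A -> rowvec_measurable (~` A).
Proof. exact: sigma_algebraC. Qed.

Let rowvec_bigcup (F : (set 'rV[T]_n)^nat) :
  (forall i, rowvec_measurable (F i)) -> rowvec_measurable (\bigcup_i (F i)).
Proof. exact: sigma_algebra_bigcup. Qed.

HB.instance Definition _ := @isMeasurable.Build (rowvec_display d)
  'rV[T]_n rowvec_measurable rowvec0 rowvecC rowvec_bigcup.

Lemma measurable_rowvec_coord (i : 'I_n) :
  measurable_fun [set: 'rV[T]_n] (fun v : 'rV[T]_n => v ord0 i).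
Proof.
move=> _ B mB; rewrite setTI; apply: sub_sigma_algebra.
by exists i, B.
Qed.

Lemma measurable_rowvecP d' (S : measurableType d') (f : S -> 'rV[T]_n) :
  (forall i, measurable_fun [set: S] (fun s => f s ord0 i)) ->
  measurable_fun [set: S] f.
Proof.
move=> mf; apply: (@measurability _ _ _ _ _ f rowvec_cylinders) => //.
move=> _ [_ [i [B [mB ->]]] <-].
by have := mf i measurableT B mB; rewrite setTI.
Qed.

End rowvec_measurable.

(* (x, (v_1, .., v_n)) |-> (x, v_1, .., v_n) *)
Definition consv (T : Type) (n : nat) (x : T) (v : 'rV[T]_n) : 'rV[T]_n.+1 :=
  \row_(i < n.+1) if unlift ord0 i is Some j then v ord0 j else x.

Definition tailv (T : Type) (n : nat) (v : 'rV[T]_n.+1) : 'rV[T]_n :=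
  \row_(j < n) v ord0 (lift ord0 j).

Section product_measure.
Context d (T : measurableType d) (R : realType).

Lemma measurable_consv n :
  measurable_fun [set: T * 'rV[T]_n] (fun z => consv z.1 z.2).
Proof.
apply: measurable_rowvecP => i.
under eq_fun do rewrite mxE.
case: (unlift ord0 i) => [j|]; last exact: measurable_fst.
exact: (measurableT_comp (@measurable_rowvec_coord _ _ _ j) measurable_snd).
Qed.

Lemma measurable_uncons n :
  measurable_fun [set: 'rV[T]_n.+1] (fun v => (v ord0 ord0, tailv v)).
Proof.
apply: measurable_fun_pair => /=; first exact: measurable_rowvec_coord.
apply: measurable_rowvecP => i.
under eq_fun do rewrite mxE.
exact: measurable_rowvec_coord.
Qed.

Lemma consvK n (x : T) (v : 'rV[T]_n) :
  (consv x v ord0 ord0, tailv (consv x v)) = (x, v).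
Proof.
congr pair; first by rewrite mxE unlift_none.
by apply/rowP => j; rewrite !mxE liftK.
Qed.

Lemma unconsK n (v : 'rV[T]_n.+1) : consv (v ord0 ord0) (tailv v) = v.
Proof.
apply/rowP => i; rewrite mxE.
by case: unliftP => [j ->|->]; rewrite ?mxE.
Qed.

Section step.
Variables (mu : {sigma_finite_measure set T -> \bar R}) (n : nat).
Variable nu : {sigma_finite_measure set 'rV[T]_n -> \bar R}.

Definition consv_measure : set 'rV[T]_n.+1 -> \bar R :=
  pushforward (mu \x nu)%E (fun z => consv z.1 z.2).

Let cm0 : consv_measure set0 = 0%E.
Proof. by rewrite /consv_measure /pushforward preimage_set0 measure0. Qed.

Let cm_ge0 A : (0 <= consv_measure A)%E.
Proof. by rewrite /consv_measure /pushforward measure_ge0. Qed.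

Let cm_additive : semi_sigma_additive consv_measure.
Proof.
have mc := @measurable_consv n.
move=> F mF tF mUF; rewrite /consv_measure /pushforward preimage_bigcup.
apply: measure_semi_sigma_additive.
- by move=> k; rewrite -[X in measurable X]setTI; exact: mc.
- apply/trivIsetP => /= i j _ _ ij; rewrite -preimage_setI.
  by move/trivIsetP : tF => /(_ _ _ _ _ ij) ->//; rewrite preimage_set0.
- by rewrite -preimage_bigcup -[X in measurable X]setTI; exact: mc.
Qed.

HB.instance Definition _ := isMeasure.Build _ _ _ consv_measure
  cm0 cm_ge0 cm_additive.

Let cm_sigma_finite : sigma_finite setT consv_measure.
Proof.
have /sigma_finiteP[F [TF ndF Foo]] := sigma_finiteT mu.
have /sigma_finiteP[G [TG ndG Goo]] := sigma_finiteT nu.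
pose uncons (v : 'rV[T]_n.+1) := (v ord0 ord0, tailv v).
exists (fun k => uncons @^-1` (F k `*` G k)).
  rewrite -preimage_bigcup (_ : \bigcup_k _ = setT) ?preimage_setT//.
  rewrite -subTset => -[x y] _.
  have : [set: T] x by []. rewrite TF => -[i _ Fix].
  have : [set: 'rV[T]_n] y by []. rewrite TG => -[j _ Gjy].
  exists (maxn i j) => //; split => /=.
  - by move: x Fix; exact/subsetPset/ndF/leq_maxl.
  - by move: y Gjy; exact/subsetPset/ndG/leq_maxr.
move=> k; have [mFk Fkoo] := Foo k; have [mGk Gkoo] := Goo k; split.
  rewrite -[X in measurable X]setTI.
  by apply: measurable_uncons => //; exact: measurableX.
rewrite /consv_measure /pushforward -comp_preimage.
rewrite (_ : _ \o _ = id) ?preimage_id; last first.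
  by apply/funext => -[x v]; exact: consvK.
by rewrite product_measure1E// lte_mul_pinfty// ge0_fin_numE.
Qed.

HB.instance Definition _ := Measure_isSigmaFinite.Build _ _ _ consv_measure
  cm_sigma_finite.

End step.


Definition emptyv : 'rV[T]_0 :=
  \row_(i < 0) let: Ordinal _ i0 := i in False_rect T (notF i0).

Fixpoint power_measure (mu : {sigma_finite_measure set T -> \bar R}) (n : nat) :
    {sigma_finite_measure set 'rV[T]_n -> \bar R} :=
  if n is n'.+1 then consv_measure mu (power_measure mu n')
  else dirac emptyv.

End product_measure.

(* lebesgue_measure is declared on measurableTypeR R; this is the same set
   function, over the canonical (convertible) sigma-algebra of R. *)
Section lebesgue_line.
Context (R : realType).

Definition leb1 : set R -> \bar R := lebesgue_measure.

HB.instance Definition _ := isMeasure.Build _ R R leb1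
  (measure0 (@lebesgue_measure R)) (measure_ge0 (@lebesgue_measure R))
  (@measure_semi_sigma_additive _ _ _ (@lebesgue_measure R)).

HB.instance Definition _ := Measure_isSigmaFinite.Build _ R R leb1
  (sigma_finiteT (@lebesgue_measure R)).

End lebesgue_line.

Section euclidean_space.
Context (R : realType) (n : nat).

(* Lebesgue measure on R^n *)
Definition leb : {sigma_finite_measure set 'rV[R]_n -> \bar R} :=
  power_measure (@leb1 R) n.

(* The norm of the library on 'rV[R]_n is the sup norm. *)
Definition enorm (x : 'rV[R]_n) : R := Num.sqrt (\sum_(i < n) x ord0 i ^+ 2).

Definition eball (x : 'rV[R]_n) (r : R) : set 'rV[R]_n :=
  [set y | enorm (y - x) < r].

End euclidean_space.

(* Lebesgue measure on (R^n)^m *)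
Definition lebm (R : realType) (n m : nat) :
    {sigma_finite_measure set 'rV['rV[R]_n]_m -> \bar R} :=
  power_measure (leb R n) m.

Section complex_valued.
Context (R : realType).

Definition cabs (z : R[i]) : R := ComplexField.Normc.normc z.

Section integration.
Context d (T : measurableType d).
Implicit Type f : T -> R[i].

Definition cmeasurable f : Prop :=
  measurable_fun [set: T] (fun x => complex.Re (f x)) /\
  measurable_fun [set: T] (fun x => complex.Im (f x)).

Definition cintegrable (mu : {measure set T -> \bar R}) f : Prop :=
  mu.-integrable [set: T] (fun x => (complex.Re (f x))%:E) /\
  mu.-integrable [set: T] (fun x => (complex.Im (f x))%:E).

Definition cintegral (mu : {measure set T -> \bar R}) f : R[i] :=
  (\int[mu]_x complex.Re (f x)) +i* (\int[mu]_x complex.Im (f x)).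

(* f \chi_A *)
Definition cut (A : set T) f : T -> R[i] := fun x => if x \in A then f x else 0.

(* || f ||_{L^p}, only a quasi-norm for 0 < p < 1 *)
Definition Lpnorm (mu : {measure set T -> \bar R}) (p : R) f : \bar R :=
  Lnorm mu p%:E (fun x => (cabs (f x))%:E).

Definition Lp (mu : {measure set T -> \bar R}) (p : R) f : Prop :=
  cmeasurable f /\ (Lpnorm mu p f < +oo)%E.

End integration.

End complex_valued.

Section distributions.
Context (R : realType) (n : nat).
Local Notation Rn := 'rV[R]_n.

(* [:: j1; ..; jk] |-> D_j1 .. D_jk g: lists of directions instead of
   multi-indices *)
Fixpoint partials (s : seq 'I_n) (g : Rn -> R) : Rn -> R :=
  if s is j :: s' then fun x => 'D_(delta_mx ord0 j) (partials s' g) x else g.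

Definition smooth (g : Rn -> R) : Prop :=
  forall s : seq 'I_n,
    continuous (partials s g) /\
    forall (j : 'I_n) (x : Rn), derivable (partials s g) x (delta_mx ord0 j).

Definition csmooth (f : Rn -> R[i]) : Prop :=
  smooth (fun x => complex.Re (f x)) /\ smooth (fun x => complex.Im (f x)).

Definition cpartials (s : seq 'I_n) (f : Rn -> R[i]) : Rn -> R[i] := fun x =>
  partials s (fun y => complex.Re (f y)) x +i*
  partials s (fun y => complex.Im (f y)) x.

(* sup_x |x^a D^s f(x)| *)
Definition schwartz_seminorm (k : {ffun 'I_n -> nat} * seq 'I_n)
    (f : Rn -> R[i]) : \bar R :=
  ereal_sup [set (`|\prod_(i < n) x ord0 i ^+ k.1 i| *
                  cabs (cpartials k.2 f x))%:E | x in [set: Rn]].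

Definition schwartz (f : Rn -> R[i]) : Prop :=
  csmooth f /\ forall k, (schwartz_seminorm k f < +oo)%E.

(* Distributions are total on functions; only their values on Schwartz
   functions matter. *)
Definition tempered (u : (Rn -> R[i]) -> R[i]) : Prop :=
  (forall (a : R[i]) (f g : Rn -> R[i]), schwartz f -> schwartz g ->
     u (fun x => a * f x + g x) = a * u f + u g) /\
  (forall f : Rn -> R[i], schwartz f -> forall e : R, 0 < e ->
     exists (J : seq ({ffun 'I_n -> nat} * seq 'I_n)) (del : R), 0 < del /\
       forall g : Rn -> R[i], schwartz g ->
         (forall k, k \in J ->
            (schwartz_seminorm k (fun x => (g x - f x)%R) < del%:E)%E) ->
         cabs (u g - u f) < e).

Definition csupp (f : Rn -> R[i]) : set Rn := closure [set x | f x != 0].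

Definition test_function (f : Rn -> R[i]) : Prop :=
  csmooth f /\ compact (csupp f).

(* the distribution u is given by the function h *)
Definition represented_by (u : (Rn -> R[i]) -> R[i]) (h : Rn -> R[i]) : Prop :=
  forall f : Rn -> R[i], schwartz f ->
    cintegrable (leb R n) (fun x => h x * f x) /\
    u f = cintegral (leb R n) (fun x => h x * f x).

End distributions.

Section calderon_zygmund.
Context (R : realType) (n m : nat).
Local Notation Rn := 'rV[R]_n.
Local Notation fam := ('I_m -> Rn -> R[i]).

Definition upd (F : fam) (i : 'I_m) (f : Rn -> R[i]) : fam :=
  fun k => if k == i then f else F k.

Section kernel.
Variable K : 'rV[Rn]_m.+1 -> R[i].

Definition on_diagonal (y : 'rV[Rn]_m.+1) : Prop :=
  forall k l : 'I_m.+1, y ord0 k = y ord0 l.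

Definition spread (y : 'rV[Rn]_m.+1) : R :=
  \sum_(k < m.+1) \sum_(l < m.+1) enorm (y ord0 k - y ord0 l).

(* y with y_i replaced by z *)
Definition updv (y : 'rV[Rn]_m.+1) (i : 'I_m.+1) (z : Rn) : 'rV[Rn]_m.+1 :=
  \row_k if k == i then z else y ord0 k.

(* K is total; its values on the diagonal are unconstrained. *)
Definition cz_kernel : Prop :=
  exists C eps : R, [/\ 0 < C, 0 < eps,
    forall y, ~ on_diagonal y ->
      cabs (K y) <= C / spread y ^+ (m * n)%N &
    forall y (i : 'I_m.+1) (z : Rn), ~ on_diagonal y ->
      enorm (y ord0 i - z) <=
        2^-1 * \big[Num.max/0]_(k < m.+1) enorm (y ord0 i - y ord0 k) ->
      cabs (K y - K (updv y i z)) <=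
        C * enorm (y ord0 i - z) `^ eps / spread y `^ ((m * n)%N%:R + eps)].

(* y |-> K(x, y_1, .., y_m) f_1(y_1) .. f_m(y_m) *)
Definition kernel_integrand (F : fam) (x : Rn) : 'rV[Rn]_m -> R[i] :=
  fun y => K (consv x y) * \prod_(i < m) F i (y ord0 i).

End kernel.

(* T F is a distribution, T F g its value at g. *)
Definition multilinear_on_schwartz (T : fam -> (Rn -> R[i]) -> R[i]) : Prop :=
  forall (F : fam) (i : 'I_m) (a : R[i]) (f h g : Rn -> R[i]),
    (forall k, schwartz (F k)) -> schwartz f -> schwartz h -> schwartz g ->
    T (upd F i (fun x => a * f x + h x)) g = a * T (upd F i f) g + T (upd F i h) g.

(* T F is the function x |-> \int K(x, y) f_1(y_1) .. f_m(y_m) dy on the open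
   complement of the intersection of the supports. *)
Definition has_kernel (K : 'rV[Rn]_m.+1 -> R[i])
    (T : fam -> (Rn -> R[i]) -> R[i]) : Prop :=
  forall (F : fam) (g : Rn -> R[i]),
    (forall i, test_function (F i)) -> test_function g ->
    csupp g `&` \bigcap_(i in [set: 'I_m]) csupp (F i) = set0 ->
    T F g = cintegral (leb R n)
      (fun x => cintegral (lebm R n m) (kernel_integrand K F x) * g x).

(* S is the bounded extension of T to L^{q_1} x .. x L^{q_m} -> L^s. *)
Definition bounded_extension (T : fam -> (Rn -> R[i]) -> R[i])
    (q : 'I_m -> R) (s : R) (S : fam -> Rn -> R[i]) : Prop :=
  [/\ forall F : fam, (forall i, Lp (leb R n) (q i) (F i)) ->
        Lp (leb R n) s (S F),
      forall (F : fam) (i : 'I_m) (a : R[i]) (f h : Rn -> R[i]),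
        (forall k, Lp (leb R n) (q k) (F k)) ->
        Lp (leb R n) (q i) f -> Lp (leb R n) (q i) h ->
        {ae leb R n, forall x, S (upd F i (fun x => a * f x + h x)) x =
                               a * S (upd F i f) x + S (upd F i h) x},
      exists C : R, 0 < C /\
        forall F : fam, (forall i, Lp (leb R n) (q i) (F i)) ->
          (Lpnorm (leb R n) s (S F) <=
           C%:E * \prod_(i < m) Lpnorm (leb R n) (q i) (F i))%E &
      forall F : fam, (forall i, schwartz (F i)) -> represented_by (T F) (S F)].

(* The bounds on Lebesgue spaces do not follow from the other clauses (they
   need a T1-type condition); they are part of the notion. *)
Definition cz_operator (K : 'rV[Rn]_m.+1 -> R[i])
    (T : fam -> (Rn -> R[i]) -> R[i]) : Prop :=
  [/\ cz_kernel K,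
      forall F : fam, (forall i, schwartz (F i)) -> tempered (T F),
      multilinear_on_schwartz T,
      has_kernel K T &
      forall (q : 'I_m -> R) (s : R), (forall i, 1 < q i) ->
        s^-1 = \sum_(i < m) (q i)^-1 -> exists S, bounded_extension T q s S].

(* f_i^0 = f_i \chi_{2B} if a i = false, f_i^oo = f_i \chi_{(2B)^c} otherwise *)
Definition split_fam (x0 : Rn) (r : R) (F : fam) (a : {ffun 'I_m -> bool}) : fam :=
  fun i => cut (if a i then ~` eball x0 (2 * r) else eball x0 (2 * r)) (F i).

Definition far_choice (a : {ffun 'I_m -> bool}) : bool := [exists i, a i].

Definition local_operator (K : 'rV[Rn]_m.+1 -> R[i]) (S : fam -> Rn -> R[i])
    (x0 : Rn) (r : R) (F : fam) (x : Rn) : R[i] :=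
  S (split_fam x0 r F [ffun => false]) x +
  \sum_(a : {ffun 'I_m -> bool} | far_choice a)
     cintegral (lebm R n m) (kernel_integrand K (split_fam x0 r F a) x).

(* g = T_m(f_1, .., f_m): on every ball B(x0, r), the integrals over the far
   parts converge absolutely and g is given by the local formula. *)
Definition operator_value (K : 'rV[Rn]_m.+1 -> R[i]) (S : fam -> Rn -> R[i])
    (x0 : Rn) (F : fam) (g : Rn -> R[i]) : Prop :=
  forall r : R, 0 < r ->
    (forall x (a : {ffun 'I_m -> bool}), eball x0 r x -> far_choice a ->
       cintegrable (lebm R n m)
         (kernel_integrand K (split_fam x0 r F a) x)) /\
    {ae leb R n, forall x, eball x0 r x -> g x = local_operator K S x0 r F x}.

End calderon_zygmund.

Section local_morrey.
Context (R : realType) (n : nat).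
Local Notation Rn := 'rV[R]_n.

Definition positive_measurable (phi : Rn -> R -> R) : Prop :=
  (forall x r, 0 < r -> 0 < phi x r) /\
  measurable_fun ([set: Rn] `*` [set r : R | 0 < r])
    (fun z : Rn * R => phi z.1 z.2).

Definition Lploc (p : R) (f : Rn -> R[i]) : Prop :=
  cmeasurable f /\
  forall A : set Rn, compact A -> (Lpnorm (leb R n) p (cut A f) < +oo)%E.

Definition LMnorm (p : R) (phi : Rn -> R -> R) (x0 : Rn) (f : Rn -> R[i]) :
    \bar R :=
  ereal_sup [set (((phi x0 r)^-1 *
                   (fine (leb R n (eball x0 r))) `^ (- p^-1))%:E *
                  Lpnorm (leb R n) p (cut (eball x0 r) f))%E
            | r in [set r : R | 0 < r]].

Definition LM (p : R) (phi : Rn -> R -> R) (x0 : Rn) (f : Rn -> R[i]) : Prop :=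
  Lploc p f /\ (LMnorm p phi x0 f < +oo)%E.

End local_morrey.

(* ess inf_{t < s < oo} h(s) *)
Definition ess_inf_above (R : realType) (t : R) (h : R -> R) : \bar R :=
  ess_inf (mrestr lebesgue_measure (measurable_itv `]t, +oo[))
    (fun s => (h s)%:E).

(* Main.v *)
(** Fix a radius [r] and let [f_i^0] be the restriction of [f_i] to [B(x0, 2r)].
    On [B(x0, r)] put
      [T_r F := S(f_1^0, .., f_m^0) + \int (K(x, y) \prod f_i(y_i) - K(x, y) \prod f_i^0(y_i)) dy].
    The last integrand lives where some [y_i] is outside [B(x0, 2r)]; cutting
    this region into dyadic shells and using the size of the kernel and Hoelder's
    inequality, the integral is at most a multiple of
      [\sum_k (2^k r)^(-n/p) \prod_i ||f_i||_{L^{q_i}(B(x0, 2^(k+1) r))}].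
    The product of the norms over [B(x0, t)] is at most the product of the Morrey norms times
    the essential infimum over [s > t] of [(\prod_i phi_i(x0, s)) s^(n/p)], since
    it is increasing in [t]; so the sum is dominated by the integral of the
    hypothesis, that is by [psi(x0, r)].  The same infimum controls the local
    part, by the boundedness of [S].

    For [T_r F] to be the restriction of a single function, [T_r F] and [T_s F]
    must agree almost everywhere on the smaller ball.  By multilinearity, this
    amounts to the kernel representation of [S] for bounded supports, one of which
    is at a positive distance of [x].  It holds for test functions by hypothesis,
    and extends to indicators of boxes, then to all of [L^q], by density, one
    argument at a time. *)

From mathcomp Require Import all_boot all_order all_algebra.
From mathcomp Require Import complex.
From mathcomp Require Import all_classical all_reals all_analysis.
From mathcomp Require Import ess_sup_inf measurable_realfun.
From mathcomp Require Import ring lra.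
(* Imported last: the library also has a [cut]. *)
Require Import Defs.

Set Implicit Arguments.
Unset Strict Implicit.
Unset Printing Implicit Defensive.

Import Order.TTheory GRing.Theory Num.Theory.
Import numFieldNormedType.Exports.

Local Open Scope classical_set_scope.
Local Open Scope ring_scope.
Local Open Scope complex_scope.

(** * Products, norms and balls in R^n *)

(** Three obstacles shape the proof. Nothing is assumed on the measurability of K or on its values
    on the diagonal: measurability is deduced from the Hoelder regularity, after K has been set to 0
    on the diagonal. The kernel formula is only known weakly, against test functions, so each
    identity for [S] holds almost everywhere and each use costs a null set; hence the countable
    coverings, by a grid of small cubes and by balls of integer radius. Test functions are built as
    products of one-dimensional bumps, supported in boxes, so separation of supports is first
    treated for boxes lying apart along one coordinate axis; the complement of a ball is then
    reached by cutting with half-spaces around each small cube.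

    The integral of K(x, y) times the product of the f_i^0(y_i) need not converge absolutely, since
    x may lie in all the supports. Only suitable differences of such integrands are integrable, and
    the comparison of two radii is therefore stated for a difference. *)

Lemma ge0_le_integral_nonmeasurable d (T : measurableType d) (R : realType)
    (mu : {measure set T -> \bar R}) (f g : T -> \bar R) :
  (forall x, 0 <= f x)%E -> (forall x, f x <= g x)%E ->
  (\int[mu]_x f x <= \int[mu]_x g x)%E.
Proof.
(* The integral of a non-negative function is a supremum over the simple functions below it, so
   monotonicity holds without measurability. *)
move=> f0 fg; rewrite !ge0_integralTE//; last first.
  by move=> x; exact: le_trans (f0 x) (fg x).
apply: ge_ereal_sup => _ [h hf <-]; apply: ereal_sup_ubound.
by exists h => // x; exact: le_trans (hf x) (fg x).
Qed.

Lemma prod_EFin (R : realType) (I : Type) (s : seq I) (P : pred I) (f : I -> R) :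
  (\prod_(i <- s | P i) (f i)%:E)%E = (\prod_(i <- s | P i) f i)%:E.
Proof. by rewrite (big_morph EFin (fun x y : R => EFinM x y) erefl). Qed.

Lemma emeasurable_prod d (T : measurableType d) (R : realType) (I : Type)
    (s : seq I) (f : I -> T -> \bar R) :
  (forall i, measurable_fun setT (f i)) ->
  measurable_fun setT (fun x => \prod_(i <- s) f i x)%E.
Proof.
move=> mf; elim: s => [|i s IH].
  by under eq_fun do rewrite big_nil; exact: measurable_cst.
by under eq_fun do rewrite big_cons; exact: emeasurable_funM.
Qed.

Section euclidean_norm.
Context (R : realType) (n : nat).
Implicit Types x y : 'rV[R]_n.

Let sqs x : R := \sum_(i < n) x ord0 i ^+ 2.

Let sqs_ge0 x : 0 <= sqs x.
Proof. by apply: sumr_ge0 => i _; rewrite sqr_ge0. Qed.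

Lemma enorm_ge0 x : 0 <= enorm x.
Proof. exact: sqrtr_ge0. Qed.

Lemma enormN x : enorm (- x) = enorm x.
Proof.
by congr Num.sqrt; apply: eq_bigr => i _; rewrite mxE sqrrN.
Qed.

Lemma enormB x y : enorm (x - y) = enorm (y - x).
Proof. by rewrite -enormN opprB. Qed.

Lemma enorm0 : enorm (0 : 'rV[R]_n) = 0.
Proof.
rewrite /enorm big1 ?sqrtr0// => i _; by rewrite mxE expr0n.
Qed.

Lemma coord_le_enorm x i : `|x ord0 i| <= enorm x.
Proof.
rewrite -sqrtr_sqr ler_wsqrtr// (bigD1 i)//= lerDl.
by apply: sumr_ge0 => j _; rewrite sqr_ge0.
Qed.

Lemma enorm_eq0 x : enorm x = 0 -> x = 0.
Proof.
move=> x0; apply/rowP => i; rewrite mxE; apply/eqP; rewrite -normr_le0 -x0.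
exact: coord_le_enorm.
Qed.

Lemma enorm_le_sum x : enorm x <= \sum_(i < n) `|x ord0 i|.
Proof.
rewrite -[leRHS]ger0_norm ?sumr_ge0// -sqrtr_sqr ler_wsqrtr//.
rewrite expr2 mulr_suml; apply: ler_sum => i _.
rewrite -[leLHS]ger0_norm ?sqr_ge0// normrX expr2 ler_wpM2l//.
by rewrite (bigD1 i)//= lerDl sumr_ge0.
Qed.

(** Lagrange's identity: the defect in the Cauchy-Schwarz inequality is half the sum of the squares
    (x_i y_j - x_j y_i)^2. *)
Let lagrange x y : (\sum_(i < n) x ord0 i * y ord0 i) ^+ 2 <= sqs x * sqs y.
Proof.
have : 0 <= \sum_(i < n) \sum_(j < n)
    (x ord0 i * y ord0 j - x ord0 j * y ord0 i) ^+ 2.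
  by apply: sumr_ge0 => i _; apply: sumr_ge0 => j _; rewrite sqr_ge0.
have -> : \sum_(i < n) \sum_(j < n)
    (x ord0 i * y ord0 j - x ord0 j * y ord0 i) ^+ 2 =
    (sqs x * sqs y - (\sum_(i < n) x ord0 i * y ord0 i) ^+ 2) *+ 2.
  rewrite mulrnBl mulr2n {2}[sqs x * _]mulrC /sqs expr2 !mulr_suml.
  rewrite -sumrMnl -big_split -sumrB/=; apply: eq_bigr => i _.
  rewrite !mulr_sumr -sumrMnl -big_split -sumrB/=; apply: eq_bigr => j _.
  ring.
by rewrite pmulrn_lge0// subr_ge0.
Qed.

Lemma enormD x y : enorm (x + y) <= enorm x + enorm y.
Proof.
rewrite -[leRHS]ger0_norm ?addr_ge0 ?enorm_ge0// -sqrtr_sqr ler_wsqrtr//.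
rewrite sqrrD !sqr_sqrtr -/(sqs _) ?sqs_ge0//.
rewrite -!/(sqs _). have -> : sqs (x + y) =
    sqs x + (\sum_(i < n) x ord0 i * y ord0 i) *+ 2 + sqs y.
  rewrite /sqs -sumrMnl -!big_split/=; apply: eq_bigr => i _.
  by rewrite mxE; ring.
rewrite lerD2r lerD2l lerMn2r/=.
apply: le_trans (ler_norm _) _.
by rewrite -sqrtr_sqr /enorm -sqrtrM ?sqs_ge0// ler_wsqrtr// lagrange.
Qed.

Lemma ler_enormB x y z : enorm (x - z) <= enorm (x - y) + enorm (y - z).
Proof. by rewrite -[x - z](subrKA y) enormD. Qed.

Lemma measurable_enorm d (T : measurableType d) (f : T -> 'rV[R]_n) :
  (forall i, measurable_fun setT (fun t => f t ord0 i)) ->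
  measurable_fun setT (fun t => enorm (f t)).
Proof.
move=> mf; apply: (measurableT_comp (continuous_measurable_fun (@sqrt_continuous R))).
  apply: measurable_sum => i; exact: measurable_funX.
Qed.

Lemma measurable_eball x r : measurable (eball x r).
Proof.
have : measurable_fun setT (fun y => enorm (y - x)).
  apply: measurable_enorm => i; under eq_fun do rewrite !mxE.
  apply: measurable_funB => //; exact: measurable_rowvec_coord.
move=> /(_ measurableT `]-oo, r[%classic (measurable_itv _)).
rewrite setTI; congr measurable.
Qed.

End euclidean_norm.

(** * Iterated integrals and boxes for the powers of a measure *)

Section power_measure_theory.
Context d (T : measurableType d) (R : realType).
Variable mu : {sigma_finite_measure set T -> \bar R}.
Local Open Scope ereal_scope.

(** Change of variables along [consv], followed by Tonelli's theorem. *)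
Lemma integral_power_measureS n (f : 'rV[T]_n.+1 -> \bar R) :
  measurable_fun setT f -> (forall v, 0 <= f v) ->
  \int[power_measure mu n.+1]_v f v =
  \int[mu]_x \int[power_measure mu n]_v f (consv x v).
Proof.
move=> mf f0 /=; have mc := @measurable_consv _ T n.
have -> : \int[consv_measure mu (power_measure mu n)]_v f v =
    \int[mu \x power_measure mu n]_z f (consv z.1 z.2).
  rewrite -[RHS]/(\int[mu \x power_measure mu n]_(z in
    (fun z => consv z.1 z.2) @^-1` setT) (f \o (fun z => consv z.1 z.2)) z).
  by rewrite -(ge0_integral_pushforward mc)//; exact: eq_measure_integral.
rewrite fubini_tonelli1//.
exact: measurableT_comp mf mc.
Qed.

Lemma integral_power_measure_prod n (G : 'I_n -> T -> \bar R) :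
  (forall i, measurable_fun setT (G i)) -> (forall i x, 0 <= G i x) ->
  \int[power_measure mu n]_v \prod_(i < n) G i (v ord0 i) =
  \prod_(i < n) \int[mu]_x G i x.
Proof.
elim: n G => [|n IH] G mG G0.
  under eq_integral do rewrite big_ord0.
  by rewrite big_ord0 integral_cst//= diracT mul1e.
rewrite integral_power_measureS; last 2 first.
- apply: emeasurable_prod => i.
  exact: (measurableT_comp (mG i) (measurable_rowvec_coord _)).
- by move=> v; apply: prode_ge0 => i _.
rewrite big_ord_recl -IH//.
under eq_integral => x _.
  under eq_integral => v _.
    rewrite big_ord_recl mxE unlift_none.
    under eq_bigr do rewrite mxE liftK.
  over.
  rewrite ge0_integralZl//; last 2 first.
  - apply: emeasurable_prod => i.
    exact: (measurableT_comp (mG _) (measurable_rowvec_coord _)).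
  - by move=> v _; apply: prode_ge0 => i _.
over.
rewrite ge0_integralZr//; apply: integral_ge0 => v _.
by apply: prode_ge0.
Qed.

(** The indicator of a box is the product of the indicators of its sides, so this is a case of
    [integral_power_measure_prod]. *)
Lemma power_measure_box n (A : 'I_n -> set T) :
  (forall i, measurable (A i)) ->
  power_measure mu n [set v | forall i, A i (v ord0 i)] =
  \prod_(i < n) mu (A i).
Proof.
move=> mA.
have mB : measurable [set v : 'rV[T]_n | forall i, A i (v ord0 i)].
  rewrite (_ : [set _ | _] = \big[setI/setT]_(i < n)
     ((fun v : 'rV[T]_n => v ord0 i) @^-1` A i)).
    apply: bigsetI_measurable => i _; rewrite -[X in measurable X]setTI.
    exact: measurable_rowvec_coord.
  apply/seteqP; split => v /=; rewrite -bigcap_seq/=; first by move=> H i _; exact: H.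
  by move=> H i; apply: H; rewrite /= mem_index_enum.
rewrite -[X in power_measure mu n X](setIT) -integral_indic//.
transitivity (\prod_(i < n) \int[mu]_x (\1_(A i) x)%:E); last first.
  by apply: eq_bigr => i _; rewrite integral_indic// setIT.
rewrite -integral_power_measure_prod.
- apply: eq_integral => v _; rewrite prod_EFin; congr EFin.
  rewrite indicE; case: (asboolP (forall i, A i (v ord0 i))) => [H|H].
    rewrite mem_set// big1// => i _; by rewrite indicE mem_set.
  rewrite memNset//; move/existsNP : H => [i Hi].
  by rewrite (bigD1 i)//= indicE memNset// mul0r.
- by move=> i; apply/measurable_EFinP; exact: measurable_indic.
- by move=> i x; rewrite lee_fin.
Qed.

End power_measure_theory.

(** * Complex-valued functions *)

Section complex_modulus.
Context (R : realType).
Implicit Types z w : R[i].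

Lemma cabs_ge0 z : 0 <= cabs z.
Proof. by case: z => a b; exact: sqrtr_ge0. Qed.

Lemma cabs0 : cabs (0 : R[i]) = 0.
Proof. exact: ComplexField.Normc.normc0. Qed.

Lemma cabs1 : cabs (1 : R[i]) = 1.
Proof. exact: ComplexField.Normc.normc1. Qed.

Lemma cabsM z w : cabs (z * w) = cabs z * cabs w.
Proof. exact: ComplexField.Normc.normcM. Qed.

Lemma cabsN z : cabs (- z) = cabs z.
Proof. exact: normcN. Qed.

Lemma cabsD z w : cabs (z + w) <= cabs z + cabs w.
Proof. exact: le_normcD. Qed.

Lemma cabsB z w : cabs (z - w) = cabs (w - z).
Proof. by rewrite -cabsN opprB. Qed.

Lemma cabs_eq0 z : cabs z = 0 -> z = 0.
Proof. exact: ComplexField.Normc.eq0_normc. Qed.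

Lemma cabs_prod (I : Type) (s : seq I) (P : pred I) (f : I -> R[i]) :
  cabs (\prod_(i <- s | P i) f i) = \prod_(i <- s | P i) cabs (f i).
Proof.
elim/big_ind2 : _ => [|x1 x2 y1 y2 h1 h2|//]; first exact: cabs1.
by rewrite cabsM h1 h2.
Qed.

Lemma normRe_le_cabs z : `|complex.Re z| <= cabs z.
Proof.
case: z => a b; rewrite -sqrtr_sqr; apply: ler_wsqrtr.
by rewrite lerDl sqr_ge0.
Qed.

Lemma normIm_le_cabs z : `|complex.Im z| <= cabs z.
Proof.
case: z => a b; rewrite -sqrtr_sqr; apply: ler_wsqrtr.
by rewrite lerDr sqr_ge0.
Qed.

Lemma cabs_le_normReIm z : cabs z <= `|complex.Re z| + `|complex.Im z|.
Proof.
case: z => a b; rewrite -[leRHS]ger0_norm ?addr_ge0// -sqrtr_sqr.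
apply: ler_wsqrtr => /=; rewrite sqrrD !real_normK ?num_real//.
by rewrite lerD2r lerDl mulrn_wge0// mulr_ge0.
Qed.

Lemma ReD z w : complex.Re (z + w) = complex.Re z + complex.Re w.
Proof. by case: z; case: w. Qed.

Lemma ImD z w : complex.Im (z + w) = complex.Im z + complex.Im w.
Proof. by case: z; case: w. Qed.

Lemma ReM z w : complex.Re (z * w) =
  complex.Re z * complex.Re w - complex.Im z * complex.Im w.
Proof. by case: z; case: w. Qed.

Lemma ImM z w : complex.Im (z * w) =
  complex.Re z * complex.Im w + complex.Im z * complex.Re w.
Proof. by case: z; case: w. Qed.

Lemma complexP z w : complex.Re z = complex.Re w ->
  complex.Im z = complex.Im w -> z = w.
Proof. by case: z => ? ?; case: w => ? ? /= -> ->. Qed.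

End complex_modulus.

Section complex_measurable.
Context (R : realType) d (T : measurableType d).
Implicit Types f g : T -> R[i].

Lemma cmeasurable_cst (c : R[i]) : cmeasurable (fun _ : T => c).
Proof. by split; exact: measurable_cst. Qed.

Lemma cmeasurableD f g : cmeasurable f -> cmeasurable g ->
  cmeasurable (fun x => f x + g x).
Proof.
move=> [f1 f2] [g1 g2]; split.
  by under eq_fun do rewrite ReD; exact: measurable_funD.
by under eq_fun do rewrite ImD; exact: measurable_funD.
Qed.

Lemma cmeasurableM f g : cmeasurable f -> cmeasurable g ->
  cmeasurable (fun x => f x * g x).
Proof.
move=> [f1 f2] [g1 g2]; split.
  by under eq_fun do rewrite ReM; apply: measurable_funB; exact: measurable_funM.
by under eq_fun do rewrite ImM; apply: measurable_funD; exact: measurable_funM.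
Qed.

Lemma cmeasurableB f g : cmeasurable f -> cmeasurable g ->
  cmeasurable (fun x => f x - g x).
Proof.
move=> mf mg; under eq_fun do rewrite -mulN1r.
apply: cmeasurableD => //; apply: cmeasurableM => //; exact: cmeasurable_cst.
Qed.

Lemma cmeasurable_prod (I : Type) (s : seq I) (f : I -> T -> R[i]) :
  (forall i, cmeasurable (f i)) -> cmeasurable (fun x => \prod_(i <- s) f i x).
Proof.
move=> mf; elim: s => [|i s IH].
  by under eq_fun do rewrite big_nil; exact: cmeasurable_cst.
by under eq_fun do rewrite big_cons; exact: cmeasurableM.
Qed.

Lemma cmeasurable_comp d' (S : measurableType d') f (h : S -> T) :
  cmeasurable f -> measurable_fun setT h -> cmeasurable (fun x => f (h x)).
Proof.
by move=> [f1 f2] mh; split;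
  [exact: (measurableT_comp f1 mh)|exact: (measurableT_comp f2 mh)].
Qed.

Lemma cmeasurable_cut (A : set T) f : measurable A -> cmeasurable f ->
  cmeasurable (cut A f).
Proof.
move=> mA [f1 f2]; have mb : measurable_fun setT (fun x => x \in A).
  by apply: (measurable_fun_bool true); rewrite setTI;
    rewrite (_ : _ @^-1` _ = A)//; apply/seteqP;
    split => x /=; [move/set_mem|move/mem_set].
split.
  rewrite (_ : (fun _ => _) = fun x => if x \in A then complex.Re (f x) else 0).
    by apply: measurable_fun_ifT.
  by apply/funext => x; rewrite /cut; case: ifP.
rewrite (_ : (fun _ => _) = fun x => if x \in A then complex.Im (f x) else 0).
  by apply: measurable_fun_ifT.
by apply/funext => x; rewrite /cut; case: ifP.
Qed.

Lemma measurable_cabs f : cmeasurable f ->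
  measurable_fun setT (fun x => cabs (f x)).
Proof.
move=> [f1 f2].
rewrite (_ : (fun _ => _) = fun x =>
    Num.sqrt (complex.Re (f x) ^+ 2 + complex.Im (f x) ^+ 2)); last first.
  by apply/funext => x; case: (f x).
apply: (measurableT_comp (continuous_measurable_fun (@sqrt_continuous R))).
by apply: measurable_funD; exact: measurable_funX.
Qed.

Lemma cmeasurable_cvg (h : (T -> R[i])^nat) f :
  (forall k, cmeasurable (h k)) ->
  (forall x, (fun k => cabs (h k x - f x)) @ \oo --> (0 : R)) -> cmeasurable f.
Proof.
move=> mh hf; split.
- apply: (@measurable_fun_cvg _ _ _ _ (fun k x => complex.Re (h k x))).
  - by move=> k; have [] := mh k.
  - move=> x _; apply/cvgrPdist_lt => e e0.
    have /cvgrPdist_lt/(_ _ e0) := hf x; apply: filterS => k.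
    rewrite sub0r normrN ger0_norm ?cabs_ge0//; apply: le_lt_trans.
    by rewrite distrC; apply: le_trans (normRe_le_cabs _); case: (h k x); case: (f x).
- apply: (@measurable_fun_cvg _ _ _ _ (fun k x => complex.Im (h k x))).
  - by move=> k; have [] := mh k.
  - move=> x _; apply/cvgrPdist_lt => e e0.
    have /cvgrPdist_lt/(_ _ e0) := hf x; apply: filterS => k.
    rewrite sub0r normrN ger0_norm ?cabs_ge0//; apply: le_lt_trans.
    by rewrite distrC; apply: le_trans (normIm_le_cabs _); case: (h k x); case: (f x).
Qed.

End complex_measurable.

Lemma cut_in (R : realType) d (T : measurableType d) (A : set T) (f : T -> R[i]) x :
  A x -> cut A f x = f x.
Proof. by move=> Ax; rewrite /cut mem_set. Qed.

Lemma cut_out (R : realType) d (T : measurableType d) (A : set T) (f : T -> R[i]) x :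
  ~ A x -> cut A f x = 0.
Proof. by move=> Ax; rewrite /cut memNset. Qed.

Lemma cabs_cut_le (R : realType) d (T : measurableType d) (A : set T) (f : T -> R[i]) x :
  cabs (cut A f x) <= cabs (f x).
Proof. by rewrite /cut; case: ifP => // _; rewrite cabs0 cabs_ge0. Qed.

Lemma cabs_cut_subset (R : realType) d (T : measurableType d) (A B : set T)
    (f : T -> R[i]) x : A `<=` B -> cabs (cut A f x) <= cabs (cut B f x).
Proof.
move=> AB; have [Ax|Ax] := pselect (A x).
  by rewrite !cut_in//; exact: AB.
by rewrite cut_out// cabs0 cabs_ge0.
Qed.

Section complex_integral.
Context (R : realType) d (T : measurableType d) (mu : {measure set T -> \bar R}).
Implicit Types f g : T -> R[i].

Lemma cintegrableP f :
  cintegrable mu f <->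
  cmeasurable f /\ (\int[mu]_x (cabs (f x))%:E < +oo)%E.
Proof.
split=> [[/integrableP[mr ir] /integrableP[mi ii]]|[[mr mi] fi]].
  have mf : cmeasurable f by split; exact/measurable_EFinP.
  split=> //; apply: (@le_lt_trans _ _ (\int[mu]_x
    (`|(complex.Re (f x))%:E| + `|(complex.Im (f x))%:E|))%E).
    apply: ge0_le_integral_nonmeasurable => x.
      by rewrite lee_fin cabs_ge0.
    by rewrite -EFinD lee_fin cabs_le_normReIm.
  by rewrite ge0_integralD//; [exact: lte_add_pinfty|
    exact: measurableT_comp|exact: measurableT_comp].
have mf : cmeasurable f by [].
by split; apply/integrableP; split; [exact/measurable_EFinP| |
  exact/measurable_EFinP|]; apply: le_lt_trans fi;
  apply: ge0_le_integral_nonmeasurable => // x; rewrite lee_fin;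
  [exact: normRe_le_cabs|exact: normIm_le_cabs].
Qed.

Lemma cintegrable_le f (g : T -> \bar R) : cmeasurable f ->
  (forall x, ((cabs (f x))%:E <= g x)%E) -> (\int[mu]_x g x < +oo)%E ->
  cintegrable mu f.
Proof.
move=> mf fg gi; apply/cintegrableP; split=> //; apply: le_lt_trans gi.
by apply: ge0_le_integral_nonmeasurable => // x; rewrite lee_fin cabs_ge0.
Qed.

Lemma cintegralD f g : cintegrable mu f -> cintegrable mu g ->
  cintegral mu (fun x => f x + g x) = cintegral mu f + cintegral mu g.
Proof.
move=> [f1 f2] [g1 g2]; apply: complexP; rewrite ?ReD ?ImD /=.
  by under eq_Rintegral do rewrite ReD; rewrite RintegralD.
by under eq_Rintegral do rewrite ImD; rewrite RintegralD.
Qed.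

Lemma cintegralZ (a : R[i]) f : cintegrable mu f ->
  cintegral mu (fun x => a * f x) = a * cintegral mu f.
Proof.
move=> [f1 f2].
have i1 (r : R) : mu.-integrable setT (EFin \o (fun x => r * complex.Re (f x))).
  exact: eq_integrable (integrableZl measurableT r f1).
have i2 (r : R) : mu.-integrable setT (EFin \o (fun x => r * complex.Im (f x))).
  exact: eq_integrable (integrableZl measurableT r f2).
apply: complexP; rewrite ?ReM ?ImM /=.
  by under eq_Rintegral do rewrite ReM; rewrite RintegralB// !RintegralZl.
by under eq_Rintegral do rewrite ImM; rewrite RintegralD// !RintegralZl.
Qed.

Lemma cintegrableD f g : cintegrable mu f -> cintegrable mu g ->
  cintegrable mu (fun x => f x + g x).
Proof.
move=> [f1 f2] [g1 g2]; split.
  by under eq_fun do rewrite ReD EFinD; exact: integrableD.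
by under eq_fun do rewrite ImD EFinD; exact: integrableD.
Qed.

Lemma cintegrableZ (a : R[i]) f : cintegrable mu f ->
  cintegrable mu (fun x => a * f x).
Proof.
move=> [f1 f2]; split.
  under eq_fun do rewrite ReM EFinB !EFinM.
  by apply: integrableB => //; exact: integrableZl.
under eq_fun do rewrite ImM EFinD !EFinM.
by apply: integrableD => //; exact: integrableZl.
Qed.

Lemma cintegrableB f g : cintegrable mu f -> cintegrable mu g ->
  cintegrable mu (fun x => f x - g x).
Proof.
move=> fi gi; under eq_fun do rewrite -mulN1r.
by apply: cintegrableD => //; exact: cintegrableZ.
Qed.

Lemma cintegralB f g : cintegrable mu f -> cintegrable mu g ->
  cintegral mu (fun x => f x - g x) = cintegral mu f - cintegral mu g.
Proof.
move=> fi gi; rewrite -mulN1r -cintegralZ// -cintegralD//; last exact: cintegrableZ.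
by congr cintegral; apply/funext => x; rewrite mulN1r.
Qed.

Lemma cintegral0 : cintegral mu (fun _ => 0) = 0.
Proof. by apply: complexP => /=; rewrite /Rintegral integral0. Qed.

Lemma cintegrable0 : cintegrable mu (fun _ => 0).
Proof. by split; exact: integrable0. Qed.

Lemma cintegral_sum (I : Type) (s : seq I) (P : pred I) (f : I -> T -> R[i]) :
  (forall i, P i -> cintegrable mu (f i)) ->
  cintegrable mu (fun x => \sum_(i <- s | P i) f i x) /\
  cintegral mu (fun x => \sum_(i <- s | P i) f i x) =
  \sum_(i <- s | P i) cintegral mu (f i).
Proof.
move=> fi; elim: s => [|i s [IH1 IH2]].
  under eq_fun do rewrite big_nil.
  by rewrite big_nil; split; [exact: cintegrable0|exact: cintegral0].
under eq_fun do rewrite big_cons.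
rewrite big_cons; case: ifPn => // Pi; have fii := fi _ Pi.
by split; [exact: cintegrableD|rewrite cintegralD// IH2].
Qed.

(** The factor 2 comes from bounding the real and imaginary parts separately; the sharp constant is
    1. *)
Lemma cabs_cintegral_le f : cintegrable mu f ->
  ((cabs (cintegral mu f))%:E <= 2%:E * \int[mu]_x (cabs (f x))%:E)%E.
Proof.
move=> fi; have [f1 f2] := fi; have [mf foo] := (cintegrableP f).1 fi.
have ffin : (\int[mu]_x (cabs (f x))%:E)%E \is a fin_num.
  by rewrite ge0_fin_numE ?integral_ge0// => x _; rewrite lee_fin cabs_ge0.
apply: (@le_trans _ _ ((`|complex.Re (cintegral mu f)| +
                       `|complex.Im (cintegral mu f)|)%:E)).
  by rewrite lee_fin cabs_le_normReIm.
rewrite EFinD -[2]/(1 + 1)%R EFinD ge0_muleDl// mul1e.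
apply: leeD => /=.
- rewrite /Rintegral -fine_abse ?fineK ?abse_fin_num; [|exact: integrable_fin_num..].
  apply: le_trans (le_abse_integral _ _ _) _ => //; first by case/integrableP: f1.
  by apply: ge0_le_integral_nonmeasurable => x //; rewrite lee_fin normRe_le_cabs.
- rewrite /Rintegral -fine_abse ?fineK ?abse_fin_num; [|exact: integrable_fin_num..].
  apply: le_trans (le_abse_integral _ _ _) _ => //; first by case/integrableP: f2.
  by apply: ge0_le_integral_nonmeasurable => x //; rewrite lee_fin normIm_le_cabs.
Qed.

(** Dominated convergence for the real and imaginary parts. Convergence of complex values is
    expressed by the modulus of the difference, here and in all the density arguments. *)
Lemma cintegral_cvg (h : (T -> R[i])^nat) f (G : T -> \bar R) :
  (forall k, cmeasurable (h k)) -> cmeasurable f ->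
  (forall x, (fun k => cabs (h k x - f x)) @ \oo --> (0 : R)) ->
  mu.-integrable setT G -> (forall k x, ((cabs (h k x))%:E <= G x)%E) ->
  [/\ cintegrable mu f, forall k, cintegrable mu (h k) &
   (fun k => cabs (cintegral mu (h k) - cintegral mu f)) @ \oo --> (0 : R)].
Proof.
move=> mh mf hf Gi hG.
have cre x : (fun k => (complex.Re (h k x))%:E) @ \oo --> (complex.Re (f x))%:E.
  apply/fine_cvgP; split; first exact: nearW.
  apply/cvgrPdist_lt => e e0.
  have /cvgrPdist_lt/(_ _ e0) := hf x; apply: filterS => k /=.
  rewrite sub0r normrN ger0_norm ?cabs_ge0//; apply: le_lt_trans.
  by rewrite distrC; apply: le_trans (normRe_le_cabs _); case: (h k x); case: (f x).
have cim x : (fun k => (complex.Im (h k x))%:E) @ \oo --> (complex.Im (f x))%:E.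
  apply/fine_cvgP; split; first exact: nearW.
  apply/cvgrPdist_lt => e e0.
  have /cvgrPdist_lt/(_ _ e0) := hf x; apply: filterS => k /=.
  rewrite sub0r normrN ger0_norm ?cabs_ge0//; apply: le_lt_trans.
  by rewrite distrC; apply: le_trans (normIm_le_cabs _); case: (h k x); case: (f x).
have hi k : cintegrable mu (h k).
  apply: (@cintegrable_le _ (fun x => `|G x|%E)) => //.
    by move=> x; apply: le_trans (hG k x) (lee_abs _).
  by case/integrableP : Gi.
have [] := @dominated_convergence _ _ _ mu setT measurableT
  (fun k x => (complex.Re (h k x))%:E) (fun x => (complex.Re (f x))%:E) G.
- by move=> k; apply/measurable_EFinP; case: (mh k).
- by apply/measurable_EFinP; case: mf.
- by apply: aeW => x _; exact: cre.
- by [].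
- apply: aeW => x k _; apply: le_trans (hG k x).
  by rewrite lee_fin normRe_le_cabs.
move=> i1 _ c1.
have [] := @dominated_convergence _ _ _ mu setT measurableT
  (fun k x => (complex.Im (h k x))%:E) (fun x => (complex.Im (f x))%:E) G.
- by move=> k; apply/measurable_EFinP; case: (mh k).
- by apply/measurable_EFinP; case: mf.
- by apply: aeW => x _; exact: cim.
- by [].
- apply: aeW => x k _; apply: le_trans (hG k x).
  by rewrite lee_fin normIm_le_cabs.
move=> i2 _ c2; split => //.
have d1 : (fun k => complex.Re (cintegral mu (h k))) @ \oo --> complex.Re (cintegral mu f).
  by apply: fine_cvg; rewrite fineK ?integrable_fin_num.
have d2 : (fun k => complex.Im (cintegral mu (h k))) @ \oo --> complex.Im (cintegral mu f).
  by apply: fine_cvg; rewrite fineK ?integrable_fin_num.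
apply/cvgrPdist_lt => e e0.
have e20 : 0 < e / 2 by rewrite divr_gt0.
have /cvgrPdist_lt/(_ _ e20) D1 := d1; have /cvgrPdist_lt/(_ _ e20) D2 := d2.
near=> k; rewrite sub0r normrN ger0_norm ?cabs_ge0//.
rewrite cabsB; apply: le_lt_trans (cabs_le_normReIm _) _.
rewrite [e]splitr ltrD//.
  by near: k; apply: filterS D1 => k; case: (cintegral _ _); case: (cintegral _ _).
by near: k; apply: filterS D2 => k; case: (cintegral _ _); case: (cintegral _ _).
Unshelve. all: by end_near. Qed.

End complex_integral.

(** * Lebesgue spaces *)

Lemma cvg_powR0 (R : realType) (u : R^nat) (p : R) : 0 < p ->
  (forall k, 0 <= u k) -> u @ \oo --> (0 : R) ->
  (fun k => u k `^ p) @ \oo --> (0 : R).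
Proof.
move=> p0 u0 cu; apply/cvgrPdist_lt => e e0.
have d0 : 0 < e `^ p^-1 by rewrite powR_gt0.
have /cvgrPdist_lt/(_ _ d0) := cu; apply: filterS => k.
rewrite !sub0r !normrN !ger0_norm ?powR_ge0// => uk.
have -> : e = (e `^ p^-1) `^ p by rewrite -powRrM mulVf ?gt_eqF// powRr1// ltW.
by apply: gt0_ltr_powR; rewrite ?nnegrE// powR_ge0.
Qed.

Section complex_Lp.
Context (R : realType) d (T : measurableType d) (mu : {measure set T -> \bar R}).
Implicit Types f g h : T -> R[i].
Implicit Types p : R.

Lemma measurable_cabs_powR p f : cmeasurable f ->
  measurable_fun setT (fun x => (cabs (f x) `^ p)%:E).
Proof.
move=> mf; apply/measurable_EFinP.
exact: (measurableT_comp (measurable_powR p) (measurable_cabs mf)).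
Qed.

Lemma LpnormE p f :
  Lpnorm mu p f = ((\int[mu]_x (cabs (f x) `^ p)%:E) `^ p^-1)%E.
Proof.
rewrite /Lpnorm unlock; congr (_ `^ _)%E; apply: eq_integral => x _.
by rewrite /= ger0_norm ?cabs_ge0.
Qed.

Lemma Lpnorm_ge0 p f : (0 <= Lpnorm mu p f)%E.
Proof. exact: Lnorm_ge0. Qed.

Lemma int_cabs_powR_ge0 p f : (0 <= \int[mu]_x (cabs (f x) `^ p)%:E)%E.
Proof. by apply: integral_ge0 => x _; rewrite lee_fin powR_ge0. Qed.

Lemma Lpnorm_lty p f : p != 0 ->
  (Lpnorm mu p f < +oo <-> \int[mu]_x (cabs (f x) `^ p)%:E < +oo)%E.
Proof.
move=> p0; rewrite LpnormE; split; last exact: poweR_lty.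
by apply: lty_poweRy; rewrite invr_eq0.
Qed.

Lemma le_Lpnorm p f h : 0 < p -> (forall x, cabs (f x) <= cabs (h x)) ->
  (Lpnorm mu p f <= Lpnorm mu p h)%E.
Proof.
move=> p0 fh; rewrite !LpnormE; apply: gt0_ler_poweR.
- by rewrite invr_ge0 ltW.
- by rewrite in_itv/= leey int_cabs_powR_ge0.
- by rewrite in_itv/= leey int_cabs_powR_ge0.
apply: ge0_le_integral_nonmeasurable => x; rewrite lee_fin ?powR_ge0//.
by apply: ge0_ler_powR; rewrite ?nnegrE ?cabs_ge0// ltW.
Qed.

Lemma ae_le_Lpnorm p f h : 0 < p -> cmeasurable f -> cmeasurable h ->
  {ae mu, forall x, cabs (f x) <= cabs (h x)} ->
  (Lpnorm mu p f <= Lpnorm mu p h)%E.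
Proof.
move=> p0 mf mh fh; rewrite !LpnormE; apply: gt0_ler_poweR.
- by rewrite invr_ge0 ltW.
- by rewrite in_itv/= leey int_cabs_powR_ge0.
- by rewrite in_itv/= leey int_cabs_powR_ge0.
apply: ae_ge0_le_integral => //; try exact: measurable_cabs_powR.
- by move=> x _; rewrite lee_fin powR_ge0.
- by move=> x _; rewrite lee_fin powR_ge0.
apply: filterS fh => x H _; rewrite lee_fin.
by apply: ge0_ler_powR; rewrite ?nnegrE ?cabs_ge0// ltW.
Qed.

Lemma LpnormD p f g : 1 <= p -> cmeasurable f -> cmeasurable g ->
  (Lpnorm mu p (fun x => f x + g x)%R <= Lpnorm mu p f + Lpnorm mu p g)%E.
Proof.
move=> p1 mf mg; have p0 : 0 < p by exact: lt_le_trans p1.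
apply: le_trans (minkowski_EFin mu (measurable_cabs mf) (measurable_cabs mg) p1).
(* [h] is a real function of modulus |f| + |g|; it reduces the claim to Minkowski's inequality for
   the moduli. *)
pose h x : R[i] := (cabs (f x) + cabs (g x)) +i* 0.
have ch x : cabs (h x) = cabs (f x) + cabs (g x).
  by rewrite /h /cabs/= expr0n addr0 sqrtr_sqr ger0_norm// addr_ge0 ?cabs_ge0.
rewrite (_ : Lnorm _ _ _ = Lpnorm mu p h); last first.
  by apply: eq_Lnorm => x; rewrite ch.
by apply: le_Lpnorm => // x; rewrite ch cabsD.
Qed.

Lemma LpnormZ p (a : R[i]) f : p != 0 -> cmeasurable f ->
  Lpnorm mu p (fun x => a * f x) = ((cabs a)%:E * Lpnorm mu p f)%E.
Proof.
move=> p0 mf; rewrite !LpnormE.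
under eq_integral do rewrite cabsM powRM ?cabs_ge0// EFinM.
rewrite ge0_integralZl//; last 3 first.
- exact: measurable_cabs_powR.
- by move=> x _; rewrite lee_fin powR_ge0.
- by rewrite lee_fin powR_ge0.
rewrite poweRM ?lee_fin ?powR_ge0 ?int_cabs_powR_ge0//.
by rewrite poweR_EFin -powRrM mulfV// powRr1 ?cabs_ge0.
Qed.

Lemma le_Lp p f h : 0 < p -> cmeasurable f ->
  (forall x, cabs (f x) <= cabs (h x)) -> Lp mu p h -> Lp mu p f.
Proof.
by move=> p0 mf fh [mh hoo]; split=> //; exact: le_lt_trans (le_Lpnorm p0 fh) hoo.
Qed.

Lemma LpD p f g : 1 <= p -> Lp mu p f -> Lp mu p g ->
  Lp mu p (fun x => f x + g x).
Proof.
move=> p1 [mf fi] [mg gi]; split; first exact: cmeasurableD.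
by apply: le_lt_trans (LpnormD p1 mf mg) _; rewrite lte_add_pinfty.
Qed.

Lemma LpZ p (a : R[i]) f : p != 0 -> Lp mu p f -> Lp mu p (fun x => a * f x).
Proof.
move=> p0 [mf fi]; split.
  by apply: cmeasurableM => //; exact: cmeasurable_cst.
by rewrite LpnormZ// lte_mul_pinfty// lee_fin cabs_ge0.
Qed.

Lemma LpB p f g : 1 <= p -> Lp mu p f -> Lp mu p g ->
  Lp mu p (fun x => f x - g x).
Proof.
move=> p1 fi gi; under eq_fun do rewrite -mulN1r.
by apply: LpD => //; apply: LpZ => //; rewrite gt_eqF// (lt_le_trans _ p1).
Qed.

Lemma Lp_cut p (A : set T) f : 0 < p -> measurable A -> Lp mu p f ->
  Lp mu p (cut A f).
Proof.
move=> p0 mA Lf; apply: (le_Lp p0 _ _ Lf); last by move=> x; exact: cabs_cut_le.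
by apply: cmeasurable_cut => //; case: Lf.
Qed.

Lemma Lpnorm_eq0 p : p != 0 -> Lpnorm mu p (fun _ => 0) = 0%E.
Proof.
move=> p0; rewrite LpnormE.
under eq_integral do rewrite cabs0 powR0//.
by rewrite integral0 poweR0r ?invr_eq0.
Qed.

Lemma Lp0 p : p != 0 -> Lp mu p (fun _ => 0).
Proof. by move=> p0; split; [exact: cmeasurable_cst|rewrite Lpnorm_eq0]. Qed.

Lemma Lpnorm_bounded_le p (M : R) (A : set T) f : 0 < p -> 0 <= M ->
  measurable A -> (forall x, cabs (f x) <= M) -> (forall x, ~ A x -> f x = 0) ->
  (Lpnorm mu p f <= M%:E * (mu A) `^ p^-1)%E.
Proof.
move=> p0 M0 mA fM fA; rewrite LpnormE.
have -> : M%:E = ((M `^ p)%:E `^ p^-1)%E.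
  by rewrite poweR_EFin -powRrM mulfV ?gt_eqF// powRr1.
rewrite -poweRM ?lee_fin ?powR_ge0//; apply: gt0_ler_poweR.
- by rewrite invr_ge0 ltW.
- by rewrite in_itv/= leey int_cabs_powR_ge0.
- by rewrite in_itv/= leey mule_ge0// lee_fin powR_ge0.
rewrite -[A in mu A]setIT -integral_indic// -ge0_integralZl ?lee_fin ?powR_ge0//; last first.
  by apply/measurable_EFinP; exact: measurable_indic.
apply: ge0_le_integral_nonmeasurable => x; first by rewrite lee_fin powR_ge0.
rewrite indicE; case: (boolP (x \in A)) => Ax.
  rewrite mule1 lee_fin; apply: ge0_ler_powR; rewrite ?nnegrE ?cabs_ge0// ltW//.
rewrite fA ?cabs0 ?powR0 ?gt_eqF// ?mule0//.
by move=> H; move: Ax; rewrite mem_set.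
Qed.

Lemma Lp_bounded p (M : R) (A : set T) f : 0 < p ->
  measurable A -> (mu A < +oo)%E -> cmeasurable f ->
  (forall x, cabs (f x) <= M) -> (forall x, ~ A x -> f x = 0) -> Lp mu p f.
Proof.
move=> p0 mA Aoo mf fM fA; split=> //.
apply: (@le_lt_trans _ _ ((Num.max 0 M)%:E * (mu A) `^ p^-1)%E).
  apply: Lpnorm_bounded_le => //; first by rewrite le_max lexx.
  by move=> x; rewrite le_max fM orbT.
by rewrite lte_mul_pinfty ?lee_fin ?le_max ?lexx// poweR_lty.
Qed.

(** Hoelder's inequality against the indicator of A, whose exponent (1 - p^-1)^-1 is conjugate to
    p. *)
Lemma int_cabs_le_Lpnorm p (A : set T) f : 1 < p -> measurable A ->
  cmeasurable f -> (forall x, ~ A x -> f x = 0) ->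
  (\int[mu]_x (cabs (f x))%:E <= Lpnorm mu p f * (mu A) `^ (1 - p^-1))%E.
Proof.
move=> p1 mA mf fA; have p0 : 0 < p by exact: lt_trans p1.
have q0 : 0 < 1 - p^-1 by rewrite subr_gt0 invf_lt1.
have := @hoelder _ _ _ mu (fun x => cabs (f x)) \1_A p (1 - p^-1)^-1
  (measurable_cabs mf) (measurable_indic mA) p0.
rewrite invr_gt0 q0 invrK => /(_ isT); rewrite addrC subrK => /(_ erefl).
rewrite Lnorm1 (_ : Lnorm mu _ (EFin \o \1_A) = ((mu A) `^ (1 - p^-1))%E).
  apply: le_trans; rewrite le_eqVlt; apply/orP; left; apply/eqP.
  apply: eq_integral => x _ /=; rewrite indicE.
  case: (boolP (x \in A)) => Ax; first by rewrite mulr1 ger0_norm ?cabs_ge0.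
  rewrite fA ?cabs0 ?mulr0 ?normr0//.
  by move=> H; move: Ax; rewrite mem_set.
rewrite unlock invrK; congr (_ `^ _)%E.
rewrite -[A in mu A]setIT -integral_indic//; apply: eq_integral => x _ /=.
rewrite indicE; case: (x \in A); first by rewrite normr1 powR1.
by rewrite normr0 powR0// gt_eqF// invr_gt0.
Qed.

Lemma Lp_int_cabs_lty p (A : set T) f : 1 < p -> measurable A ->
  (mu A < +oo)%E -> Lp mu p f -> (forall x, ~ A x -> f x = 0) ->
  (\int[mu]_x (cabs (f x))%:E < +oo)%E.
Proof.
move=> p1 mA Aoo [mf fi] fA; apply: le_lt_trans (int_cabs_le_Lpnorm p1 mA mf fA) _.
by rewrite lte_mul_pinfty ?Lpnorm_ge0 ?poweR_lty// ge0_fin_numE// Lpnorm_ge0.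
Qed.

Lemma Lp_dominated_cvg p (h : (T -> R[i])^nat) f G : 0 < p ->
  (forall k, cmeasurable (h k)) -> cmeasurable f ->
  (forall x, (fun k => cabs (h k x - f x)) @ \oo --> (0 : R)) ->
  Lp mu p G -> (forall k x, cabs (h k x) <= cabs (G x)) ->
  (forall x, cabs (f x) <= cabs (G x)) /\
  forall e, 0 < e ->
    \forall k \near \oo, (Lpnorm mu p (fun x => h k x - f x)%R <= e%:E)%E.
Proof.
move=> p0 mh mf hf [mG Goo] hG.
have fG x : cabs (f x) <= cabs (G x).
  apply/ler_addgt0Pr => e e0.
  have /cvgrPdist_lt/(_ _ e0)[N _ /(_ N (leqnn N))] := hf x.
  rewrite /= sub0r normrN ger0_norm ?cabs_ge0// => H.
  rewrite -[f x](subrK (h N x)) addrC; apply: le_trans (cabsD _ _) _.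
  by rewrite lerD// cabsB ltW.
split=> // e e0.
(* Both |h_k| and |f| are at most |G|, so |h_k - f|^p is dominated by (2 |G|)^p. *)
pose B x := ((2 * cabs (G x)) `^ p)%:E.
have BE x : B x = ((2 `^ p)%:E * (cabs (G x) `^ p)%:E)%E.
  by rewrite /B powRM ?cabs_ge0.
have iB : mu.-integrable setT B.
  rewrite (_ : B = fun x => ((2 `^ p)%:E * (cabs (G x) `^ p)%:E)%E); last exact/funext.
  apply: integrableZl => //; apply/integrableP; split.
    exact: measurable_cabs_powR.
  under eq_integral do rewrite gee0_abs ?lee_fin ?powR_ge0//.
  by apply/Lpnorm_lty => //; rewrite gt_eqF.
have md k : cmeasurable (fun x => h k x - f x) by exact: cmeasurableB.
have dle k x : cabs (h k x - f x) <= 2 * cabs (G x).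
  by rewrite mulr2n mulrDl mul1r (le_trans (cabsD _ _))// cabsN lerD.
have [] := @dominated_convergence _ _ _ mu setT measurableT
  (fun k x => (cabs (h k x - f x)%R `^ p)%:E) (fun _ => 0%E) B.
- by move=> k; exact: measurable_cabs_powR.
- exact: measurable_cst.
- apply: aeW => x _; apply/fine_cvgP; split; first exact: nearW.
  by apply: cvg_powR0 => // k; exact: cabs_ge0.
- exact: iB.
- apply: aeW => x k _; rewrite /B gee0_abs ?lee_fin ?powR_ge0//.
  by apply: ge0_ler_powR; rewrite ?nnegrE ?mulr_ge0 ?cabs_ge0// ltW.
move=> _ + _.
under eq_fun => k do under eq_integral do rewrite sube0 gee0_abs ?lee_fin ?powR_ge0//.
move=> c0; have ep0 : (0 < (e `^ p)%:E)%E by rewrite lte_fin powR_gt0.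
have : \forall k \near \oo, (\int[mu]_x (cabs (h k x - f x)%R `^ p)%:E < (e `^ p)%:E)%E.
  have := c0 _ (open_ereal_lt' ep0); exact.
apply: filterS => k /ltW kle; rewrite LpnormE.
have -> : e%:E = ((e `^ p)%:E `^ p^-1)%E.
  by rewrite poweR_EFin -powRrM mulfV ?gt_eqF// powRr1// ltW.
apply: gt0_ler_poweR => //.
- by rewrite invr_ge0 ltW.
- by rewrite in_itv/= leey int_cabs_powR_ge0.
- by rewrite in_itv/= leey ltW.
Qed.

End complex_Lp.

(** * Test functions *)

Lemma is_derive_cvg (R : realType) (V W : normedModType R) (f : V -> W)
    (x v : V) (l : W) :
  (fun h : R => h^-1 *: (f (h *: v + x) - f x)) @ 0^' --> l -> is_derive x v f l.
Proof. by move=> fl; apply: DeriveDef; [exact: cvgP fl|exact: cvg_lim fl]. Qed.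

(** * The function exp(-1/t) and its derivatives *)

Section flat_function.
Context (R : realType).

(* Derivatives of exp(-1/t) stay in this class. *)
Definition flat (p : {poly R}) (t : R) : R :=
  if 0 < t then p.[t^-1] * expR (- t^-1) else 0.

Lemma poly_le_pow (p : {poly R}) : exists2 A : R, 0 <= A &
  forall s, 1 <= s -> `|p.[s]| <= A * s ^+ size p.
Proof.
exists (\sum_(i < size p) `|p`_i|); first by rewrite sumr_ge0.
move=> s s1; have s0 : 0 <= s by exact: le_trans s1.
rewrite horner_coef (le_trans (ler_norm_sum _ _ _))// mulr_suml ler_sum// => i _.
rewrite normrM ler_wpM2l// ger0_norm ?exprn_ge0//.
by rewrite ler_weXn2l// ltnW.
Qed.

(** p(1/t) grows at most like t^(-size p), while one term of the exponential series gives exp(-1/t)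
    <= N! t^N for t > 0. Taking N = size p + 2 leaves t^2, which makes the difference quotient at 0
    tend to 0. *)
Lemma flat_le_sqr (p : {poly R}) : exists2 C : R, 0 < C &
  forall t, t <= 1 -> `|flat p t| <= C * t ^+ 2.
Proof.
have [A A0 pA] := poly_le_pow p.
pose N := (size p).+2.
exists (A * N`!%:R + 1); first by rewrite ltr_wpDl// mulr_ge0.
move=> t t1; rewrite /flat; case: ifPn => [t0|_]; last first.
  by rewrite normr0 mulr_ge0 ?sqr_ge0// addr_ge0// mulr_ge0.
have s1 : 1 <= t^-1 by rewrite invf_ge1.
have s0 : 0 < t^-1 by rewrite invr_gt0.
rewrite normrM [X in _ * X]ger0_norm ?expR_ge0// expRN.
have eN : t^-1 ^+ N / N`!%:R <= expR t^-1.
  have := @expR_ge1Dxn R t^-1 (size p).+1 (ltW s0).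
  by apply: le_trans; rewrite lerDr.
have eN' : (expR t^-1)^-1 <= N`!%:R * t ^+ N.
  rewrite -[leRHS]invrK lef_pV2 ?posrE ?expR_gt0//; last first.
    by rewrite invr_gt0 mulr_gt0 ?exprn_gt0// ltr0n fact_gt0.
  by rewrite invfM mulrC -exprVn.
apply: (@le_trans _ _ (A * t^-1 ^+ size p * (N`!%:R * t ^+ N))).
  by apply: ler_pM; rewrite ?invr_ge0 ?expR_ge0 ?pA.
have -> : A * t^-1 ^+ size p * (N`!%:R * t ^+ N) = A * N`!%:R * t ^+ 2.
  rewrite /N -addn2 exprD mulrACA; congr (_ * _); rewrite mulrA exprVn mulVf ?mul1r//.
  by rewrite expf_neq0// gt_eqF.
by rewrite ler_wpM2r ?sqr_ge0// lerDl.
Qed.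

(** With s = 1/t, the derivative of p(s) exp(-s) in t is s^2 (p(s) - p'(s)) exp(-s), of the same
    form with another polynomial. At 0 the quotient is at most C |h| by the quadratic bound. *)
Lemma is_derive_flat (p : {poly R}) (t : R) :
  is_derive t 1 (flat p) (flat ('X^2 * (p - p^`())) t).
Proof.
have [t0|t0|t0] := ltgtP 0 t.
- have near_eq : \forall u \near t, p.[u^-1] * expR (- u^-1) = flat p u.
    have : \forall u \near t, 0 < u.
      by apply: open_nbhs_nbhs; split; [exact: open_gt|].
    by apply: filterS => u u0; rewrite /flat u0.
  apply: near_eq_is_derive near_eq _.
  rewrite /flat t0.
  have tn0 : t != 0 by rewrite gt_eqF.
  have h1 : is_derive t 1 (fun u : R => u^-1) (- t ^- 2 *: 1).
    exact: (@is_deriveV R id t 1 1 tn0 (is_derive_id _ _)).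
  have h2 : is_derive t 1 (fun u : R => p.[u^-1]) (p^`().[t^-1] * (- t ^- 2 *: 1)).
    exact: (@is_derive1_comp R (horner p) (fun u => u^-1)).
  have h3 : is_derive t 1 (fun u : R => - u^-1) (- (- t ^- 2 *: 1)).
    exact: (@is_deriveN R _ _ (fun u : R => u^-1)).
  have h4 : is_derive t 1 (fun u : R => expR (- u^-1))
      (expR (- t^-1) * (- (- t ^- 2 *: 1))).
    exact: (@is_derive1_comp R (@expR R) (fun u => - u^-1)).
  apply: (@is_derive_eq _ _ _ _ _ _ _ _ (@is_deriveM R _ _ _ _ _ _ _ h2 h4)).
  rewrite !hornerE /= /GRing.scale/= -!exprVn; ring.
- have near_eq : \forall u \near t, 0 = flat p u.
    have : \forall u \near t, u < 0.
      by apply: open_nbhs_nbhs; split; [exact: open_lt|].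
    by apply: filterS => u u0; rewrite /flat ltNge ltW.
  apply: near_eq_is_derive near_eq _.
  rewrite /flat ltNge (ltW t0)/=; exact: is_derive_cst.
- rewrite -t0; apply: is_derive_cvg.
  have [C C0 pC] := flat_le_sqr p.
  rewrite {2}/flat ltxx.
  apply/cvgrPdist_lt => e e0.
  have d0 : 0 < Num.min 1 (e / C) by rewrite lt_min ltr01 divr_gt0.
  near=> h.
  have hd : `|h| < Num.min 1 (e / C).
    near: h; apply: (@nbhs_dnbhs _ (0 : R)); apply/nbhs_ballP; exists (Num.min 1 (e / C)) => //= h.
    by rewrite /ball/= sub0r normrN.
  have h0 : h != 0 by near: h; exact: nbhs_dnbhs_neq.
  move: hd; rewrite lt_min => /andP[h1 hC].
  rewrite /flat ltxx subr0 sub0r normrN addr0 normrM.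
  rewrite -/(flat p (h *: 1)) /GRing.scale/= mulr1 normfV.
  rewrite mulrC ltr_pdivrMr ?normr_gt0//.
  apply: le_lt_trans (pC h _) _; first exact: le_trans (ler_norm _) (ltW h1).
  rewrite -[h ^+ 2]ger0_norm ?sqr_ge0// normrX expr2 mulrA ltr_pM2r ?normr_gt0//.
  by rewrite mulrC -ltr_pdivlMr.
Unshelve. all: by end_near. Qed.

Lemma flat1_ge0 t : 0 <= flat 1 t.
Proof. by rewrite /flat; case: ifP => // _; rewrite hornerC mul1r expR_ge0. Qed.

Lemma flat1_le1 t : flat 1 t <= 1.
Proof.
rewrite /flat; case: ifP => // t0; rewrite hornerC mul1r expR_le1.
by rewrite oppr_le0 invr_ge0 ltW.
Qed.

Lemma flat1_le0 t : t <= 0 -> flat 1 t = 0.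
Proof. by rewrite /flat ltNge => ->. Qed.

Lemma cvg_flat1 c : 0 < c -> (fun k => flat 1 (k.+1%:R * c)) @ \oo --> (1 : R).
Proof.
move=> c0.
have h : (fun k => - (k.+1%:R * c)^-1) @ \oo --> (0 : R).
  have -> : (fun k => - (k.+1%:R * c)^-1) = (fun k => harmonic k * (- c^-1)).
    by apply/funext => k; rewrite /harmonic/= invfM mulrN.
  rewrite -(mul0r (- c^-1)); apply: cvgM; [exact: cvg_harmonic|exact: cvg_cst].
have -> : (fun k => flat 1 (k.+1%:R * c)) = (fun k => expR (- (k.+1%:R * c)^-1)).
  by apply/funext => k; rewrite /flat mulr_gt0// hornerC mul1r.
suff : (fun k => expR (- (k.+1%:R * c)^-1)) @ \oo --> expR (0 : R) by rewrite expR0.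
exact: (cvg_comp _ _ h (@continuous_expR R 0)).
Qed.

End flat_function.

(** * Differentiable functions of one variable and bumps *)

Section smooth_functions.
Context (R : realType).
Implicit Types f g : R -> R.

(** Differentiability k times, the derivatives being quantified existentially so that sums and
    products go by induction on k. Continuity of a derivative is not included; it is recovered from
    the next order. *)
Fixpoint Cn (k : nat) f : Prop :=
  if k is k'.+1 then
    exists f', (forall x : R, is_derive x 1 f (f' x)) /\ Cn k' f'
  else True.

Lemma CnW k f : Cn k.+1 f -> Cn k f.
Proof.
elim: k f => [//|k IH] f [f' [df cf]].
by exists f'; split => //; exact: IH.
Qed.

Lemma CnD k f g : Cn k f -> Cn k g -> Cn k (fun x => f x + g x).
Proof.
elim: k f g => [//|k IH] f g [f' [df cf]] [g' [dg cg]].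
exists (fun x => f' x + g' x); split; last exact: IH.
by move=> x; exact: is_deriveD.
Qed.

Lemma CnM k f g : Cn k f -> Cn k g -> Cn k (fun x => f x * g x).
Proof.
elim: k f g => [//|k IH] f g Hf Hg.
have [f' [df cf]] := Hf; have [g' [dg cg]] := Hg.
exists (fun x => f x * g' x + g x * f' x); split.
  by move=> x; exact: is_deriveM.
by apply: CnD; apply: IH => //; exact: CnW.
Qed.

Lemma Cn_cst k (c : R) : Cn k (fun _ => c).
Proof.
elim: k c => [//|k IH] c; exists (fun _ => 0); split => // x.
exact: is_derive_cst.
Qed.

Lemma Cn_affine k f (a b : R) : Cn k f -> Cn k (fun x => f (a * x + b)).
Proof.
elim: k f => [//|k IH] f [f' [df cf]].
exists (fun x => f' (a * x + b) * a); split.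
  move=> x; apply: (@is_derive1_comp R f (fun x => a * x + b)) => //.
  have h1 : is_derive x 1 (fun x : R => a * x) (a *: 1).
    exact: (@is_deriveZ R R R id a x 1 1).
  have h2 := @is_deriveD R R R _ (fun _ => b) x 1 _ _ h1 (is_derive_cst b x 1).
  by apply: (is_derive_eq h2); rewrite addr0 /GRing.scale/= mulr1.
by apply: CnM; [exact: IH|exact: Cn_cst].
Qed.

Lemma Cn_flat k (p : {poly R}) : Cn k (flat p).
Proof.
elim: k p => [//|k IH] p; exists (flat ('X^2 * (p - p^`()))); split => //.
by move=> x; exact: is_derive_flat.
Qed.

Lemma Cn_derive1n k f : (forall k, Cn k f) ->
  forall x : R, derivable (derive1n k f) x 1.
Proof.
elim: k f => [|k IH] f Cf x.
  by have [f' [df _]] := Cf 1; rewrite derive1n0.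
rewrite derive1Sn; apply: IH => j.
have [f' [df cf]] := Cf j.+1.
suff -> : (derive1 f) = f' by [].
by apply/funext => y; rewrite derive1E; exact: derive_val.
Qed.

(* Increases to the indicator function of ]a, b[ as k tends to infinity. *)
Definition bump (a b : R) (k : nat) (x : R) : R :=
  flat 1 (k.+1%:R * (x - a)) * flat 1 (k.+1%:R * (b - x)).

Lemma bump_ge0 a b k x : 0 <= bump a b k x.
Proof. by rewrite mulr_ge0 ?flat1_ge0. Qed.

Lemma bump_le1 a b k x : bump a b k x <= 1.
Proof. by rewrite mulr_ile1 ?flat1_ge0 ?flat1_le1. Qed.

Lemma bump_out a b k x : ~~ (a < x < b) -> bump a b k x = 0.
Proof.
rewrite negb_and -!leNgt => /orP[xa|bx]; rewrite /bump.
  by rewrite flat1_le0 ?mul0r// pmulr_rle0// subr_le0.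
by rewrite [X in _ * X]flat1_le0 ?mulr0// pmulr_rle0// subr_le0.
Qed.

Lemma cvg_bump a b x :
  (fun k => bump a b k x) @ \oo --> ((a < x < b)%R%:R : R).
Proof.
case: (boolP (a < x < b)) => [/andP[ax xb]|xab].
  rewrite -[1%:R](mulr1 1); apply: cvgM; apply: cvg_flat1; by rewrite subr_gt0.
by under eq_fun do rewrite bump_out//; exact: cvg_cst.
Qed.

Lemma Cn_bump a b k j : Cn j (bump a b k).
Proof.
apply: CnM.
  rewrite (_ : (fun _ => _) = fun x => flat 1 (k.+1%:R * x + - k.+1%:R * a)).
    exact/Cn_affine/Cn_flat.
  by apply/funext => x; rewrite mulrBr mulNr.
rewrite (_ : (fun _ => _) = fun x => flat 1 (- k.+1%:R * x + k.+1%:R * b)).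
  exact/Cn_affine/Cn_flat.
by apply/funext => x; rewrite mulrBr mulNr addrC.
Qed.

Lemma derive1n_out f (a b : R) k : (forall x, ~~ (a <= x <= b) -> f x = 0) ->
  forall x, ~~ (a <= x <= b) -> (derive1n k f) x = 0.
Proof.
move=> f0; elim: k => [//|k IH] x xab; rewrite derive1nS derive1E.
rewrite -(@near_eq_derive _ _ _ (fun _ => 0)); first exact: derive_cst.
move: (xab); rewrite negb_and -!ltNge => /orP[xa|bx].
  have : \forall u \near x, u < a by apply: open_nbhs_nbhs; split; [exact: open_lt|].
  by apply: filterS => u ua; rewrite IH// negb_and -ltNge ua.
have : \forall u \near x, b < u by apply: open_nbhs_nbhs; split; [exact: open_gt|].
by apply: filterS => u ua; rewrite IH// negb_and -!ltNge ua orbT.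
Qed.

Lemma continuous_derive1n f k : (forall k, Cn k f) -> continuous (derive1n k f).
Proof.
move=> Cf x; apply: differentiable_continuous.
by apply/derivable1_diffP; exact: Cn_derive1n.
Qed.

Lemma bounded_support (h : R -> R) (a b : R) : continuous h ->
  (forall x, ~~ (a <= x <= b) -> h x = 0) ->
  exists2 M, 0 <= M & forall x, `|h x| <= M.
Proof.
move=> ch h0; have [ab|ba] := leP a b; last first.
  exists 0 => // x; rewrite h0 ?normr0//; apply/negP => /andP[ax xb].
  by have := le_trans ax xb; rewrite leNgt ba.
have [|c _ cM] := @EVT_max R (fun x => `|h x|) a b ab.
  apply: continuous_subspaceT => x.
  by apply: (@continuous_comp _ _ _ h (@Num.norm _ R)); [exact: ch|exact: norm_continuous].
exists `|h c| => // x; case: (boolP (a <= x <= b)) => [xab|/h0 ->].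
  by apply: cM; rewrite in_itv.
by rewrite normr0.
Qed.

End smooth_functions.

(** * Tensor products of bumps as test functions *)

Section tensor_products.
Context (R : realType) (n : nat).
Implicit Types (c : 'I_n -> R -> R) (x : 'rV[R]_n).

Definition tensor c x : R := \prod_(i < n) c i (x ord0 i).

Definition ctensor c x : R[i] := (tensor c x)%:C.

(** Moving along the j-th axis changes only the factor c j, and the other factors form a
    constant. *)
Lemma is_derive_tensor c (c' : R -> R) (j : 'I_n) x :
  is_derive (x ord0 j) 1 (c j) (c' (x ord0 j)) ->
  is_derive x (delta_mx ord0 j) (tensor c)
    (tensor (fun i => if i == j then c' else c i) x).
Proof.
move=> [dc vc]; apply: is_derive_cvg.
have tE (y : 'rV[R]_n) : (forall i, i != j -> y ord0 i = x ord0 i) ->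
    tensor c y = c j (y ord0 j) * \prod_(i < n | i != j) c i (x ord0 i).
  move=> yx; rewrite /tensor (bigD1 j)//=; congr (_ * _).
  by apply: eq_bigr => i ij; rewrite yx.
have -> : tensor (fun i => if i == j then c' else c i) x =
    c' (x ord0 j) * \prod_(i < n | i != j) c i (x ord0 i).
  rewrite /tensor (bigD1 j)//= eqxx; congr (_ * _).
  by apply: eq_bigr => i /negPf ->.
rewrite (_ : (fun _ => _) = fun h : R => (h^-1 *: (c j (h *: 1 + x ord0 j) -
    c j (x ord0 j))) * \prod_(i < n | i != j) c i (x ord0 i)); last first.
  apply/funext => h; rewrite (tE x)// tE; last first.
    by move=> i ij; rewrite !mxE (negPf ij) andbF mulr0 add0r.
  by rewrite !mxE !eqxx -mulrBl scalerAl.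
apply: cvgM; last exact: cvg_cst.
by rewrite -vc; exact: dc.
Qed.

(** The order of the directions is irrelevant on a tensor product: only the number of occurrences of
    each coordinate matters. *)
Lemma partials_tensor c (s : seq 'I_n) : (forall i k, Cn k (c i)) ->
  partials s (tensor c) = tensor (fun i => (derive1n (count_mem i s) (c i))).
Proof.
move=> Cc; elim: s => [|j s IH] /=.
  by [].
apply/funext => x; rewrite IH.
pose c1 i := (derive1n (count_mem i s) (c i)).
have dc : is_derive (x ord0 j) 1 (c1 j) (derive1 (c1 j) (x ord0 j)).
  by apply: DeriveDef; [exact: Cn_derive1n|rewrite derive1E].
have := is_derive_tensor dc => /(@derive_val _ _ _ _ _ _ _) ->.
apply: eq_bigr => i _; rewrite eq_sym; case: eqVneq => [->|ij].
  by rewrite add1n derive1nS.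
by rewrite add0n.
Qed.

Lemma continuous_tensor c : (forall i, continuous (c i)) -> continuous (tensor c).
Proof.
move=> cc x; rewrite /tensor.
elim: (index_enum _) => [|i s IH].
  rewrite (_ : (fun _ => _) = cst 1); first exact: cst_continuous.
  by apply/funext => y; rewrite big_nil.
rewrite (_ : (fun _ => _) = (fun y : 'rV[R]_n => c i (y ord0 i)) \*
    (fun y => \prod_(i0 <- s) c i0 (y ord0 i0))); last first.
  by apply/funext => y; rewrite big_cons.
apply: continuousM => //.
by apply: (@continuous_comp _ _ _ (fun y : 'rV[R]_n => y ord0 i) (c i));
  [exact: coord_continuous|exact: cc].
Qed.

Lemma smooth_tensor c : (forall i k, Cn k (c i)) -> smooth (tensor c).
Proof.
move=> Cc s; rewrite partials_tensor//; split.
  by apply: continuous_tensor => i; exact: continuous_derive1n.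
move=> j x; pose c1 i := (derive1n (count_mem i s) (c i)).
have dc : is_derive (x ord0 j) 1 (c1 j) (derive1 (c1 j) (x ord0 j)).
  by apply: DeriveDef; [exact: Cn_derive1n|rewrite derive1E].
by have [] := is_derive_tensor dc.
Qed.

Lemma partials0 (s : seq 'I_n) : partials s (fun _ : 'rV[R]_n => 0) = fun _ => 0.
Proof.
elim: s => [//|j s IH] /=; rewrite IH.
by apply/funext => x; exact: derive_cst.
Qed.

Lemma smooth0 : smooth (fun _ : 'rV[R]_n => 0 : R).
Proof.
move=> s; rewrite partials0; split; first by move=> x; exact: cst_continuous.
by move=> j x; exact: derivable_cst.
Qed.

Lemma csmooth_ctensor c : (forall i k, Cn k (c i)) -> csmooth (ctensor c).
Proof. by move=> Cc; split => /=; [exact: smooth_tensor|exact: smooth0]. Qed.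

Lemma cabs_real (r : R) : cabs r%:C = `|r|.
Proof. by rewrite /cabs/= expr0n addr0 sqrtr_sqr. Qed.

(** The weighted derivative splits into one-variable factors t^a c^(k)(t), each continuous and zero
    outside a compact interval, hence bounded. *)
Lemma schwartz_ctensor c (a b : 'I_n -> R) : (forall i k, Cn k (c i)) ->
  (forall i t, ~~ (a i <= t <= b i) -> c i t = 0) -> schwartz (ctensor c).
Proof.
move=> Cc c0; split; first exact: csmooth_ctensor.
move=> [al s]; pose u i (t : R) := t ^+ al i * (derive1n (count_mem i s) (c i)) t.
have uM i : exists M, 0 <= M /\ forall t, `|u i t| <= M.
  have [|t tab|M M0 uM] := @bounded_support R (u i) (a i) (b i).
  - move=> t; apply: cvgM; last exact: continuous_derive1n.
    exact: exprn_continuous.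
  - by rewrite /u (derive1n_out _ (c0 i))// mulr0.
  - by exists M.
have [M uM'] := choice uM.
apply: (@le_lt_trans _ _ (\prod_(i < n) M i)%:E); last by rewrite ltry.
apply: ge_ereal_sup => _ [x _ <-]; rewrite lee_fin.
change (al, s).2 with s; change (al, s).1 with al.
have -> : cpartials s (ctensor c) x = (partials s (tensor c) x)%:C.
  by apply: complexP => //=; rewrite partials0.
rewrite cabs_real partials_tensor// -normrM /tensor -big_split/= normr_prod.
apply: ler_prod => i _; rewrite normr_ge0/=; exact: (uM' i).2.
Qed.

Lemma csupp_subset (f : 'rV[R]_n -> R[i]) (A : set 'rV[R]_n) : closed A ->
  (forall x, ~ A x -> f x = 0) -> csupp f `<=` A.
Proof.
move=> cA fA x cx; suff : closure A x by rewrite -((closure_id A).1 cA).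
by apply: closureS cx => y /=; apply: contraNP => /fA ->.
Qed.

Lemma closed_box (a b : 'I_n -> R) :
  closed [set x : 'rV[R]_n | forall i, a i <= x ord0 i <= b i].
Proof.
rewrite (_ : mkset _ = \bigcap_(i in setT) ((fun x : 'rV[R]_n => x ord0 i) @^-1` `[a i, b i])).
  apply: closed_bigI => i _; apply: preimage_closed; last exact: itv_closed.
  by move=> x _; exact: coord_continuous.
apply/seteqP; split => x H.
  by move=> i _ /=; rewrite in_itv/=; exact: H.
by move=> i; have := H i I; rewrite /= in_itv.
Qed.

Lemma test_function_ctensor c (a b : 'I_n -> R) : (forall i k, Cn k (c i)) ->
  (forall i t, ~~ (a i <= t <= b i) -> c i t = 0) -> test_function (ctensor c).
Proof.
move=> Cc c0; split; first exact: csmooth_ctensor.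
pose B := [set x : 'rV[R]_n | forall i, a i <= x ord0 i <= b i].
apply: (@subclosed_compact _ _ B); first exact: closed_closure.
  rewrite (_ : B = [set x | forall i, `[a i, b i]%classic (x ord0 i)]).
    have := @rV_compact R n (fun i => `[a i, b i]%classic); apply => i.
    exact: segment_compact.
  by apply/seteqP; split => x /= H i; have := H i; rewrite in_itv.
apply: csupp_subset; first exact: closed_box.
move=> x /existsNP[i /negP Hi]; rewrite /ctensor /tensor (bigD1 i)//= c0// mul0r.
by [].
Qed.

End tensor_products.

(** * Extension from test functions to Lebesgue spaces *)

(** Open sides, because the bumps converge pointwise to indicators of open intervals; these boxes
    form a pi-system generating the sigma-algebra of R^n. *)
Definition obox (R : realType) (n : nat) (a b : 'I_n -> R) : set 'rV[R]_n :=
  [set x | forall i, a i < x ord0 i < b i].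

Definition oboxes (R : realType) (n : nat) : set (set 'rV[R]_n) :=
  [set A | exists a b : 'I_n -> R, A = obox a b].

Section boxes.
Context (R : realType) (n : nat).
Implicit Types (a b : 'I_n -> R).

Lemma measurable_obox a b : measurable (obox a b).
Proof.
rewrite (_ : obox a b = \big[setI/setT]_(i < n)
   ((fun v : 'rV[R]_n => v ord0 i) @^-1` `]a i, b i[)).
  apply: bigsetI_measurable => i _; rewrite -[X in measurable X]setTI.
  by apply: measurable_rowvec_coord => //; exact: measurable_itv.
apply/seteqP; split => v /=; rewrite -bigcap_seq/=.
  by move=> H i _; rewrite /= in_itv/=.
by move=> H i; have := H i (mem_index_enum i); rewrite /= in_itv.
Qed.

Lemma oboxI a b a' b' : obox a b `&` obox a' b' =
  obox (fun i => Num.max (a i) (a' i)) (fun i => Num.min (b i) (b' i)).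
Proof.
apply/seteqP; split => x.
  move=> [H H'] i; rewrite gt_max lt_min.
  by have /andP[-> ->] := H i; have /andP[-> ->] := H' i.
move=> H; split=> i; have := H i; rewrite gt_max lt_min.
  by move=> /andP[/andP[-> _] /andP[-> _]].
by move=> /andP[/andP[_ ->] /andP[_ ->]].
Qed.

Lemma measurable_oboxesE : @measurable _ 'rV[R]_n = <<s @oboxes R n >>.
Proof.
rewrite eqEsubset; split; last first.
  apply: smallest_sub; first exact: sigma_algebra_measurable.
  by move=> _ [a [b ->]]; exact: measurable_obox.
apply: smallest_sub; first exact: smallest_sigma_algebra.
move=> _ [i [B [mB ->]]].
pose D : set (set R) := [set B | <<s @oboxes R n >>
  ((fun v : 'rV[R]_n => v ord0 i) @^-1` B)].
suff : measurable `<=` D by apply.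
have sD : sigma_algebra setT D.
  split.
  - rewrite /D/= preimage_set0; exact: sigma_algebra0.
  - move=> A DA; rewrite /D/= setTD preimage_setC -setTD; exact: sigma_algebraCD.
  - by move=> F DF; rewrite /D/= preimage_bigcup; exact: sigma_algebra_bigcup.
suff GD : @RGenOInfty.G R `<=` D.
  have : (@RGenOInfty.G R).-sigma.-measurable `<=` D by exact: smallest_sub.
  by rewrite -RGenOInfty.measurableE.
move=> _ [c ->]; rewrite /D/=.
(* The half-space x_i > c is exhausted by boxes whose i-th side is ]c,
   k[ and whose other sides are ]-k, k[. *)
rewrite (_ : _ @^-1` _ = \bigcup_k obox (fun j => if j == i then c else - k%:R)
   (fun j => k%:R)).
  apply: sigma_algebra_bigcup => k; apply: sub_sigma_algebra.
  by exists (fun j => if j == i then c else - k%:R), (fun j => k%:R).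
apply/seteqP; split => x /=; rewrite in_itv/= andbT.
  move=> cx; pose M := \sum_(j < n) `|x ord0 j|.
  exists (Num.truncn M).+1 => // j.
  have /andP[H1 H2] : (- (Num.truncn M).+1%:R < x ord0 j < (Num.truncn M).+1%:R).
    rewrite -ltr_norml; apply: le_lt_trans (truncnS_gt M).
    by rewrite /M (bigD1 j)//= lerDl sumr_ge0.
  by rewrite H2 andbT; case: eqVneq => [->|].
by move=> [k _ /(_ i)]; rewrite eqxx => /andP[].
Qed.

End boxes.

(** * From bumps to indicators, and from indicators to L^p *)

Section extension.
Import HBNNSimple.
Context (R : realType) (n : nat).
Local Notation Rn := 'rV[R]_n.

Definition indC (A : set Rn) : Rn -> R[i] := cut A (fun _ => 1).

Lemma cmeasurable_indC A : measurable A -> cmeasurable (indC A).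
Proof. by move=> mA; apply: cmeasurable_cut => //; exact: cmeasurable_cst. Qed.

Lemma cabs_indC_le1 A x : cabs (indC A x) <= 1.
Proof. by rewrite (le_trans (cabs_cut_le _ _ _))// cabs1. Qed.

Lemma cabs_cvg_eventually (u : nat -> R[i]) l :
  (\forall k \near \oo, u k = l) -> (fun k => cabs (u k - l)) @ \oo --> (0 : R).
Proof.
move=> ul; apply: cvg_near_cst; apply: filterS ul => k ->.
by rewrite subrr cabs0.
Qed.

Lemma cabs_cvg_real (u : R^nat) (l : R) : u @ \oo --> l ->
  (fun k => cabs ((u k)%:C - l%:C)) @ \oo --> (0 : R).
Proof.
move=> ul; apply/cvgrPdist_lt => e e0; have /cvgrPdist_lt/(_ _ e0) := ul.
apply: filterS => k; rewrite sub0r normrN [`|cabs _|]ger0_norm ?cabs_ge0//.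
by rewrite -rmorphB cabs_real distrC.
Qed.

Lemma cmeasurable_ctensor_bump (a b : 'I_n -> R) k :
  cmeasurable (ctensor (fun i => bump (a i) (b i) k)).
Proof.
split; last exact: measurable_cst.
rewrite /ctensor /tensor /=; apply: measurable_prod => i _.
apply: (@measurableT_comp _ _ _ _ _ _ (bump (a i) (b i) k)).
  apply: continuous_measurable_fun.
  apply: (@continuous_derive1n R _ 0) => j; exact: Cn_bump.
exact: measurable_rowvec_coord.
Qed.

Lemma ctensor_bump_le1 (a b : 'I_n -> R) k x :
  cabs (ctensor (fun i => bump (a i) (b i) k) x) <= 1.
Proof.
rewrite cabs_real ger0_norm; last by apply: prodr_ge0 => i _; exact: bump_ge0.
rewrite /tensor -[leRHS](@big1_eq _ _ *%R _ (index_enum 'I_n) xpredT).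
by apply: ler_prod => i _; rewrite bump_ge0 bump_le1.
Qed.

Lemma ctensor_bump_out (a b : 'I_n -> R) k x : ~ obox a b x ->
  ctensor (fun i => bump (a i) (b i) k) x = 0.
Proof.
move=> /existsNP[i /negP Hi].
by rewrite /ctensor /tensor (bigD1 i)//= bump_out// mul0r.
Qed.

Lemma cvg_ctensor_bump (a b : 'I_n -> R) x :
  (fun k => cabs (ctensor (fun i => bump (a i) (b i) k) x - indC (obox a b) x))
    @ \oo --> (0 : R).
Proof.
have [Hx|Hx] := pselect (obox a b x); last first.
  apply: cabs_cvg_eventually; apply: nearW => k.
  by rewrite ctensor_bump_out// /indC cut_out.
have c1 : (fun k => tensor (fun i => bump (a i) (b i) k) x) @ \oo --> (1 : R).
  rewrite -[X in _ --> X](@big1_eq _ _ *%R _ (index_enum 'I_n) xpredT) /tensor.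
  elim: (index_enum _) => [|i s IH].
    by rewrite big_nil; under eq_fun do rewrite big_nil; exact: cvg_cst.
  under eq_fun do rewrite big_cons.
  rewrite big_cons; apply: cvgM => //.
  by have := @cvg_bump R (a i) (b i) (x ord0 i); rewrite Hx.
by rewrite /indC cut_in//; exact: cabs_cvg_real c1.
Qed.

Definition bounded_in (P : set Rn) (f : Rn -> R[i]) : Prop :=
  [/\ cmeasurable f, exists M : R, forall x, cabs (f x) <= M &
      forall x, ~ P x -> f x = 0].

Lemma bounded_in_indC P A : measurable P -> measurable A ->
  bounded_in P (indC (A `&` P)).
Proof.
move=> mP mA; split.
- by apply: cmeasurable_indC; exact: measurableI.
- by exists 1 => x; exact: cabs_indC_le1.
- by move=> x Px; rewrite /indC cut_out// => -[].
Qed.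

(** Dynkin's pi-lambda argument inside a fixed box P: boxes are limits of bumps, complements are
    taken relative to P by linearity, and countable disjoint unions are limits. All functions passed
    to the limit are bounded by 1 and supported in P, so that the limit hypothesis can be met by
    dominated convergence. *)
Lemma indicator_extension (a b : 'I_n -> R) (Pr : (Rn -> R[i]) -> Prop) :
  (forall (c : R[i]) f h, bounded_in (obox a b) f -> bounded_in (obox a b) h ->
     Pr f -> Pr h -> Pr (fun x => c * f x + h x)) ->
  (forall (h : (Rn -> R[i])^nat) f, (forall k, bounded_in (obox a b) (h k)) ->
     bounded_in (obox a b) f -> (forall k x, cabs (h k x) <= 1) ->
     (forall x, (fun k => cabs (h k x - f x)) @ \oo --> (0 : R)) ->
     (forall k, Pr (h k)) -> Pr f) ->
  (forall a' b' k, obox a' b' `<=` obox a b ->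
     Pr (ctensor (fun i => bump (a' i) (b' i) k))) ->
  forall A, measurable A -> Pr (indC (A `&` obox a b)).
Proof.
move=> Plin Plim Pbump; set P := obox a b in Plin Plim *.
have mP : measurable P by exact: measurable_obox.
have Pbox a' b' : obox a' b' `<=` P -> Pr (indC (obox a' b')).
  move=> sub; apply: (Plim (fun k => ctensor (fun i => bump (a' i) (b' i) k))).
  - move=> k; split; first exact: cmeasurable_ctensor_bump.
    + by exists 1 => x; exact: ctensor_bump_le1.
    + by move=> x Px; apply: ctensor_bump_out => H; exact/Px/sub.
  - rewrite -(setIidl sub); apply: bounded_in_indC => //; exact: measurable_obox.
  - by move=> k x; exact: ctensor_bump_le1.
  - by move=> x; exact: cvg_ctensor_bump.
  - by move=> k; exact: Pbump.
have PP : Pr (indC P) by exact: Pbox.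
have bP : bounded_in P (indC P) by rewrite -[X in indC X]setTI; exact: bounded_in_indC.
have Peq f h : (forall x, f x = h x) -> Pr f -> Pr h by move=> /funext ->.
have PC S : measurable S -> Pr (indC (S `&` P)) -> Pr (indC (~` S `&` P)).
  move=> mS PS; apply: Peq (Plin (-1) _ _ (bounded_in_indC mP mS) bP PS PP) => x.
  rewrite /indC mulN1r; have [Px|Px] := pselect (P x); last first.
    by rewrite !cut_out ?oppr0 ?addr0// => -[].
  have [Sx|Sx] := pselect (S x).
    rewrite cut_in// [X in _ + X]cut_in// [RHS]cut_out ?addNr//.
    by case.
  by rewrite [X in - X]cut_out ?oppr0 ?add0r ?cut_in// => -[].
rewrite measurable_oboxesE; apply: dynkin_induction.
- exact: measurable_oboxesE.
- move=> _ _ [a1 [b1 ->]] [a2 [b2 ->]]; rewrite oboxI.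
  by eexists; eexists.
- by rewrite setTI.
- move=> _ [a' [b' ->]]; rewrite oboxI; apply: Pbox.
  by rewrite -oboxI; exact: subIsetr.
- exact: PC.
- move=> F mF tF PF.
  have mU k : measurable (\big[setU/set0]_(j < k) F j) by exact: bigsetU_measurable.
  (* Finite unions by linearity, since disjointness makes the indicators add up; they converge to
     the countable union while staying below 1. *)
  have PU k : Pr (indC (\big[setU/set0]_(j < k) F j `&` P)).
    elim: k => [|k IH].
      rewrite big_ord0 set0I -(set0I P) -setCT; apply: PC => //.
      by rewrite setTI.
    rewrite big_ord_recr/=.
    apply: Peq (Plin 1 _ _ (bounded_in_indC mP (mF k)) (bounded_in_indC mP (mU k)) (PF k) IH) => x.
    rewrite mul1r /indC; have [Px|Px] := pselect (P x); last first.
      by rewrite !cut_out ?addr0// => -[].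
    have [Fx|Fx] := pselect (F k x).
      rewrite cut_in// cut_out ?addr0 ?cut_in//; first by split => //; right.
      move=> [+ _]; rewrite -bigcup_mkord => -[j /= jk Fjx].
      move/trivIsetP : tF => /(_ j k I I); rewrite (ltn_eqF jk) => /(_ isT).
      by move=> H; have : (F j `&` F k) x by []; rewrite H.
    rewrite cut_out ?add0r; last by case.
    have [Ux|Ux] := pselect ((\big[setU/set0]_(j < k) F j) x).
      by rewrite !cut_in//; split => //; left.
    by rewrite !cut_out// => -[]// [].
  apply: Plim PU.
  + by move=> k; exact: bounded_in_indC.
  + by apply: bounded_in_indC => //; exact: bigcupT_measurable.
  + by move=> k x; exact: cabs_indC_le1.
  + move=> x; apply: cabs_cvg_eventually; rewrite /indC.
    have [Px|Px] := pselect (P x); last first.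
      by apply: nearW => k; rewrite !cut_out// => -[].
    have [[j _ Fjx]|Ux] := pselect ((\bigcup_k F k) x).
      exists j.+1 => // k /= jk; rewrite !cut_in//.
        by split => //; exists j.
      by split => //; rewrite -bigcup_mkord; exists j.
    apply: nearW => k; rewrite !cut_out//; first by case.
    by move=> [+ _]; rewrite -bigcup_mkord => -[j /= _ Fjx]; apply: Ux; exists j.
Qed.

(** Indicators give simple functions by linearity, these increase to non-negative functions, and a
    complex function is a combination of four non-negative ones. Limits are taken only below a fixed
    function of L^p supported in P, as dominated convergence demands. *)
Lemma Lp_extension (p : R) (P : set Rn) (Pr : (Rn -> R[i]) -> Prop) :
  1 < p -> measurable P -> (leb R n P < +oo)%E ->
  (forall (c : R[i]) f h, Lp (leb R n) p f -> Lp (leb R n) p h ->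
     (forall x, ~ P x -> f x = 0) -> (forall x, ~ P x -> h x = 0) ->
     Pr f -> Pr h -> Pr (fun x => c * f x + h x)) ->
  (forall (h : (Rn -> R[i])^nat) f G, (forall k, cmeasurable (h k)) ->
     cmeasurable f -> Lp (leb R n) p G -> (forall x, ~ P x -> G x = 0) ->
     (forall k x, cabs (h k x) <= cabs (G x)) ->
     (forall x, (fun k => cabs (h k x - f x)) @ \oo --> (0 : R)) ->
     (forall k, Pr (h k)) -> Pr f) ->
  (forall A, measurable A -> Pr (indC (A `&` P))) ->
  forall f, Lp (leb R n) p f -> (forall x, ~ P x -> f x = 0) -> Pr f.
Proof.
move=> p1 mP Poo Plin Plim Pind.
have p0 : 0 < p by exact: lt_trans p1.
have Peq f h : (forall x, f x = h x) -> Pr f -> Pr h by move=> /funext ->.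
have LI A : measurable A -> Lp (leb R n) p (indC (A `&` P)).
  move=> mA; apply: (@Lp_bounded _ _ _ _ p 1 P) => //.
  - by apply: cmeasurable_indC; exact: measurableI.
  - by move=> x; exact: cabs_indC_le1.
  - by move=> x Px; rewrite /indC cut_out// => -[].
have IP A x : ~ P x -> indC (A `&` P) x = 0.
  by move=> Px; rewrite /indC cut_out// => -[].
have P0 : Pr (fun _ => 0).
  by apply: Peq (Pind _ measurable0) => x; rewrite /indC cut_out// => -[].
have Psimple N (c : 'I_N -> R) (A : 'I_N -> set Rn) : (forall i, measurable (A i)) ->
    Pr (fun x => \sum_(i < N) (c i)%:C * indC (A i `&` P) x) /\
    Lp (leb R n) p (fun x => \sum_(i < N) (c i)%:C * indC (A i `&` P) x).
  move=> mA; elim: (index_enum _) => [|i s [IH1 IH2]].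
    by under eq_fun do rewrite big_nil; split=> //; apply: Lp0; rewrite gt_eqF.
  under eq_fun do rewrite big_cons; split; last first.
    apply: LpD => //; first exact: ltW.
    by apply: LpZ; [rewrite gt_eqF|exact: LI].
  apply: Plin => //; [exact: LI|exact: IP| |exact: Pind].
  by move=> x Px; rewrite big1// => j _; rewrite IP// mulr0.
have Pnneg (g : Rn -> R) : measurable_fun setT g -> (forall x, 0 <= g x) ->
    Lp (leb R n) p (fun x => (g x)%:C) -> (forall x, ~ P x -> g x = 0) ->
    Pr (fun x => (g x)%:C).
  move=> mg g0 Lg gP.
  have mEg : measurable_fun setT (EFin \o g) by exact/measurable_EFinP.
  pose s := nnsfun_approx measurableT mEg.
  have sg k x : s k x <= g x.
    rewrite -lee_fin nnsfun_approxE.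
    by apply: (le_approx _ (f := EFin \o g)) => // y _; rewrite lee_fin.
  have sc x : (fun k => s k x) @ \oo --> g x.
    have g0' y : setT y -> (0 <= (EFin \o g) y)%E by rewrite lee_fin.
    have := @cvg_nnsfun_approx _ _ _ _ measurableT _ mEg g0' x I.
    by move/fine_cvg.
  apply: (Plim (fun k x => (s k x)%:C) _ (fun x => (g x)%:C)) => //.
  - by move=> x Px; rewrite gP.
  - by move=> k x; rewrite !cabs_real !ger0_norm.
  - by move=> x; exact: cabs_cvg_real (sc x).
  - move=> k; pose c : seq R := finmap.enum_fset (fset_set (s k @` setT)).
    have mA (i : 'I_(size c)) : measurable (s k @^-1` [set c`_i]).
      by rewrite -[X in measurable X]setTI; exact: measurable_funPT.
    have [Ps _] := Psimple (size c) (fun i => c`_i) _ mA.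
    apply: Peq Ps => x; apply: esym.
    rewrite (fimfunEord (s k) x) rmorph_sum; apply: eq_bigr => i _.
    rewrite rmorphM /= indicE.
    have [Ax|Ax] := pselect ((s k @^-1` [set c`_i]) x); last first.
      by rewrite memNset// mulr0 /indC cut_out ?mulr0// => -[].
    rewrite mem_set//; have [Px|Px] := pselect (P x).
      by rewrite /indC cut_in.
    (* Outside P the simple approximation lies between 0 and g = 0, so the value taken there is 0
       and restricting the level set to P loses nothing. *)
    suff -> : c`_i = 0 by rewrite !mul0r.
    rewrite -Ax; apply/eqP; rewrite eq_le; apply/andP; split => //.
    by rewrite -(gP _ Px).
move=> f Lf fP; have [mf _] := Lf; have [m1 m2] := mf.
have aux (g : Rn -> R) : measurable_fun setT g -> (forall x, `|g x| <= cabs (f x)) ->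
    let h := fun x => (Num.max (g x) 0)%:C in
    [/\ Lp (leb R n) p h, forall x, ~ P x -> h x = 0 & Pr h].
  move=> mg gf; have mh : measurable_fun setT (fun x => Num.max (g x) 0).
    by apply: measurable_maxr.
  have Lh : Lp (leb R n) p (fun x => (Num.max (g x) 0)%:C).
    apply: le_Lp Lf => // x; rewrite cabs_real; apply: le_trans (gf x).
    by case: (leP 0 (g x)) => H; rewrite ?normr0.
  have h0 x : ~ P x -> Num.max (g x) 0 = 0.
    move=> Px; have := gf x; rewrite fP// cabs0 normr_le0 => /eqP ->.
    by rewrite maxxx.
  split => //; first by move=> x Px; rewrite h0.
  by apply: Pnneg => // x; rewrite le_max lexx orbT.
have [L1 z1 P1] := aux _ m1 (fun x => normRe_le_cabs _).
have N2 x : `|- complex.Re (f x)| <= cabs (f x) by rewrite normrN normRe_le_cabs.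
have [L2 z2 P2] := aux _ (measurable_funN m1) N2.
have [L3 z3 P3] := aux _ m2 (fun x => normIm_le_cabs _).
have N4 x : `|- complex.Im (f x)| <= cabs (f x) by rewrite normrN normIm_le_cabs.
have [L4 z4 P4] := aux _ (measurable_funN m2) N4.
have pn0 : p != 0 by rewrite gt_eqF.
have p1' : 1 <= p by exact: ltW.
have Pa := Plin (-1) _ _ L2 L1 z2 z1 P2 P1.
have La := LpD p1' (LpZ (-1) pn0 L2) L1.
have Pb := Plin (-1) _ _ L4 L3 z4 z3 P4 P3.
have Lb := LpD p1' (LpZ (-1) pn0 L4) L3.
apply: Peq (Plin 'i _ _ Lb La _ _ Pb Pa).
- have mx (r : R) : - Num.max (- r) 0 + Num.max r 0 = r.
    by case: (leP r 0) => r0; case: (leP (- r) 0) => r0'; lra.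
  by move=> x; apply: complexP => /=; rewrite !(mul0r, mul1r, mulr0, oppr0, add0r,
    addr0, subr0, mulN1r) mx.
- by move=> x Px; rewrite z3// z4// mulr0 addr0.
- by move=> x Px; rewrite z1// z2// mulr0 addr0.
Qed.

End extension.

(** * The kernel away from the diagonal *)

Section parametric_integral.
Context d1 d2 (T1 : measurableType d1) (T2 : measurableType d2) (R : realType).
Variable nu : {sigma_finite_measure set T2 -> \bar R}.

(** Tonelli's theorem makes the integrals of the positive and negative parts measurable in x. Where
    their difference is infinite, [fine] returns 0, and composition with [fine] stays measurable. *)
Lemma measurable_fun_Rintegral (f : T1 * T2 -> R) : measurable_fun setT f ->
  measurable_fun setT (fun x => \int[nu]_y f (x, y)).
Proof.
move=> mf; have mEf : measurable_fun setT (EFin \o f) by exact/measurable_EFinP.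
apply: (measurableT_comp (fine_measurable measurableT)) => //.
rewrite (_ : (fun _ => _) = fun x => ((\int[nu]_y ((EFin \o f)^\+ (x, y))) -
    (\int[nu]_y ((EFin \o f)^\- (x, y))))%E); last first.
  apply/funext => x; rewrite integralE.
  by congr (_ - _)%E; apply: eq_integral => y _; rewrite ?funeposE ?funenegE.
apply: emeasurable_funB.
- have : measurable_fun setT (fubini_F nu (EFin \o f)^\+%E).
    by apply: measurable_fun_fubini_tonelli_F => //; exact: measurable_funepos.
  exact.
- have : measurable_fun setT (fubini_F nu (EFin \o f)^\-%E).
    by apply: measurable_fun_fubini_tonelli_F => //; exact: measurable_funeneg.
  exact.
Qed.

Lemma cmeasurable_cintegral (f : T1 * T2 -> R[i]) : cmeasurable f ->
  cmeasurable (fun x => cintegral nu (fun y => f (x, y))).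
Proof.
move=> [f1 f2]; split => /=.
  exact: (measurable_fun_Rintegral f1).
exact: (measurable_fun_Rintegral f2).
Qed.

End parametric_integral.

(** * Rounding points to a grid *)

Section rounding.
Context (R : realType) (M n : nat).
Local Notation Rn := 'rV[R]_n.

(** Integer labels rather than points: there are countably many, so every function of [cell k y] is
    measurable. Evaluating the kernel at the corner [grid_point] of a cell then turns continuity
    into measurability. *)
Definition cell (k : nat) (y : 'rV[Rn]_M) : 'rV['rV[int]_n]_M :=
  \row_i \row_j Num.floor (k.+1%:R * y ord0 i ord0 j).

Definition grid_point (k : nat) (z : 'rV['rV[int]_n]_M) : 'rV[Rn]_M :=
  \row_i \row_j ((z ord0 i ord0 j)%:~R / k.+1%:R).

Lemma measurable_cell_eq k z : measurable [set y | cell k y = z].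
Proof.
rewrite (_ : mkset _ = \big[setI/setT]_(i < M) \big[setI/setT]_(j < n)
   ((fun y : 'rV[Rn]_M => y ord0 i ord0 j) @^-1`
     [set t | Num.floor (k.+1%:R * t) = z ord0 i ord0 j])).
  apply: bigsetI_measurable => i _; apply: bigsetI_measurable => j _.
  rewrite -[X in measurable X]setTI.
  apply: (measurableT_comp (@measurable_rowvec_coord _ R n j)
    (@measurable_rowvec_coord _ _ M i)) => //.
  rewrite (_ : mkset _ = `[(z ord0 i ord0 j)%:~R / k.+1%:R,
       (z ord0 i ord0 j + 1)%:~R / k.+1%:R[%classic); first exact: measurable_itv.
  apply/seteqP; split => t /=; rewrite in_itv/= ler_pdivrMr// ltr_pdivlMr// mulrC.
    by move=> <-; rewrite ge_floor floorD1_gt.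
  by move=> H; apply/floor_def.
apply/seteqP; split => y /=.
  move=> <-; rewrite -bigcap_seq => i _ /=; rewrite -bigcap_seq => j _ /=.
  by rewrite !mxE.
rewrite -bigcap_seq => H; apply/rowP => i; apply/rowP => j.
have := H i (mem_index_enum i); rewrite -bigcap_seq => /(_ j (mem_index_enum j)).
by rewrite /= !mxE.
Qed.

(** A preimage is a union of cells, made countable by [unpickle]; this works for an arbitrary g. *)
Lemma measurable_fun_cell k (g : 'rV['rV[int]_n]_M -> R) :
  measurable_fun setT (fun y : 'rV[Rn]_M => g (cell k y)).
Proof.
move=> _ B mB; rewrite setTI.
rewrite (_ : _ @^-1` B = \bigcup_N
   (if unpickle N is Some z then
      if pselect (B (g z)) is left _ then [set y | cell k y = z] else set0
    else set0)).
  apply: bigcupT_measurable => N; case: (unpickle N) => [z|//].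
  by case: pselect => // _; exact: measurable_cell_eq.
apply/seteqP; split => y /=.
  move=> By; exists (pickle (cell k y)) => //; rewrite pickleK.
  by case: pselect.
move=> [N _]; case: (unpickle N) => // z; case: pselect => // Bz.
by move=> /= ->.
Qed.

Lemma grid_point_dist k (y : 'rV[Rn]_M) i :
  enorm (grid_point k (cell k y) ord0 i - y ord0 i) <= n%:R * k.+1%:R^-1.
Proof.
apply: le_trans (enorm_le_sum _) _.
rewrite mulr_natl -[X in _ <= _ *+ X]card_ord -sumr_const; apply: ler_sum => j _.
rewrite !mxE; set t := y ord0 i ord0 j.
have -> : (Num.floor (k.+1%:R * t))%:~R / k.+1%:R - t =
    ((Num.floor (k.+1%:R * t))%:~R - k.+1%:R * t) / k.+1%:R.
  by rewrite mulrBl mulrAC divff ?mul1r.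
rewrite normrM [X in _ * X]ger0_norm ?invr_ge0// ler_piMl ?invr_ge0// distrC.
have h1 : (Num.floor (k.+1%:R * t))%:~R <= k.+1%:R * t by exact: ge_floor.
have h2 : k.+1%:R * t < (Num.floor (k.+1%:R * t) + 1)%:~R by exact: floorD1_gt.
rewrite intrD in h2; rewrite ger0_norm ?subr_ge0//; lra.
Qed.

End rounding.

(** * Continuity and size of the kernel *)

Section kernel_estimates.
Context (R : realType) (n m : nat).
Local Notation Rn := 'rV[R]_n.
Variable K : 'rV[Rn]_m.+1 -> R[i].

(** The unconstrained values of K on the diagonal could spoil measurability. Where K is compared
    with [offdiag K] in an integrand, a factor f_i vanishes near x, so that the diagonal does not
    contribute. *)
Definition offdiag : 'rV[Rn]_m.+1 -> R[i] :=
  fun y => if `[< on_diagonal y >] then 0 else K y.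

Lemma offdiagE y : ~ on_diagonal y -> offdiag y = K y.
Proof. by move=> H; rewrite /offdiag; case: asboolP. Qed.

Lemma spread_ge (y : 'rV[Rn]_m.+1) k l : enorm (y ord0 k - y ord0 l) <= spread y.
Proof.
rewrite /spread (bigD1 k)//= (bigD1 l)//= -addrA lerDl addr_ge0//.
  by apply: sumr_ge0 => i _; exact: enorm_ge0.
by apply: sumr_ge0 => i _; apply: sumr_ge0 => j _; exact: enorm_ge0.
Qed.

Lemma consv0 (x : Rn) (y : 'rV[Rn]_m) : consv x y ord0 ord0 = x.
Proof. by rewrite mxE unlift_none. Qed.

Lemma consvS (x : Rn) (y : 'rV[Rn]_m) i : consv x y ord0 (lift ord0 i) = y ord0 i.
Proof. by rewrite mxE liftK. Qed.

Lemma consv_offdiag (x : Rn) (y : 'rV[Rn]_m) i (del : R) : 0 < del ->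
  del <= enorm (x - y ord0 i) -> ~ on_diagonal (consv x y).
Proof.
move=> d0 dx /(_ ord0 (lift ord0 i)); rewrite consv0 consvS => xy.
by move: dx; rewrite xy subrr enorm0 leNgt d0.
Qed.

(** Regularity of the kernel moves one variable at a time. The intermediate points take each
    component from y or from z, whence the condition on w. *)
Lemma updv_telescope (y z : 'rV[Rn]_m.+1) (f : 'rV[Rn]_m.+1 -> R[i]) (E : R) :
  (forall (w : 'rV[Rn]_m.+1) i, (forall k, w ord0 k = y ord0 k \/ w ord0 k = z ord0 k) ->
     w ord0 i = y ord0 i -> cabs (f w - f (updv w i (z ord0 i))) <= E) ->
  cabs (f y - f z) <= m.+1%:R * E.
Proof.
move=> H.
pose w j : 'rV[Rn]_m.+1 := \row_k if (k < j)%N then z ord0 k else y ord0 k.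
have w0 : w 0%N = y by apply/rowP => k; rewrite mxE.
have wm : w m.+1 = z by apply/rowP => k; rewrite mxE ltn_ord.
have wS (j : nat) (jm : (j < m.+1)%N) : w j.+1 = updv (w j) (Ordinal jm) (z ord0 (Ordinal jm)).
  apply/rowP => k; rewrite !mxE ltnS leq_eqVlt -val_eqE/=.
  by case: eqVneq => //= kj; congr (z _ _); exact: val_inj.
suff : forall j, (j <= m.+1)%N -> cabs (f y - f (w j)) <= j%:R * E.
  by move=> /(_ _ (leqnn _)); rewrite wm.
elim=> [_|j IH jm]; first by rewrite w0 subrr cabs0 mul0r.
rewrite -[f y - _](subrKA (f (w j))) -natr1 mulrDl mul1r.
apply: le_trans (cabsD _ _) _; apply: lerD; first exact/IH/ltnW.
rewrite (wS _ jm); apply: H.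
  by move=> k; rewrite mxE; case: ifP; [right|left].
by rewrite mxE ltnn.
Qed.

(** Hoelder continuity off the diagonal, by telescoping over the variables. D is the distance of two
    distinct components of y; moves of at most D / 16 keep them D / 2 apart at every intermediate
    point. *)
Lemma cz_kernel_continuous : cz_kernel K ->
  forall y, ~ on_diagonal y -> exists A del eps : R,
    [/\ 0 < del, 0 < eps & forall (t : R) (z : 'rV[Rn]_m.+1), 0 <= t -> t <= del ->
    (forall i, enorm (z ord0 i - y ord0 i) <= t) ->
    ~ on_diagonal z /\ cabs (K y - K z) <= A * t `^ eps].
Proof.
move=> [C [eps [C0 e0 Ksize Kreg]]] y /existsNP[a /existsNP[b yab]].
pose D := enorm (y ord0 a - y ord0 b).
have D0 : 0 < D.
  rewrite lt_neqAle enorm_ge0 andbT eq_sym; apply/eqP => /enorm_eq0/eqP.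
  by rewrite subr_eq0 => /eqP.
exists (m.+1%:R * (C / (D / 2) `^ ((m * n)%N%:R + eps))), (D / 16), eps.
split => // [|t z t0 tD zy]; first by rewrite divr_gt0.
have near (w : 'rV[Rn]_m.+1) : (forall k, w ord0 k = y ord0 k \/ w ord0 k = z ord0 k) ->
    forall k, enorm (w ord0 k - y ord0 k) <= t.
  by move=> H k; case: (H k) => -> //; rewrite subrr enorm0.
have far (w : 'rV[Rn]_m.+1) : (forall k, enorm (w ord0 k - y ord0 k) <= t) ->
    D / 2 <= enorm (w ord0 a - w ord0 b).
  move=> H; have Ha := H a; have Hb := H b.
  have := ler_enormB (y ord0 a) (w ord0 a) (y ord0 b).
  have := ler_enormB (w ord0 a) (w ord0 b) (y ord0 b).
  rewrite (enormB (y ord0 a) (w ord0 a)) -/D => h1 h2; lra.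
have off (w : 'rV[Rn]_m.+1) : (forall k, enorm (w ord0 k - y ord0 k) <= t) -> ~ on_diagonal w.
  move=> H /(_ a b) wab; have := far _ H; rewrite wab subrr enorm0; lra.
split; first exact: off.
rewrite -mulrA; apply: updv_telescope => w i Hw wi.
have nw := near w Hw.
have fw := far w nw.
apply: le_trans (Kreg w i (z ord0 i) (off _ nw) _) _.
  apply: (@le_trans _ _ t).
    by rewrite wi enormB; exact: zy.
  (* Since w_a and w_b are D / 2 apart, one of them is at distance at least D / 4 from w_i. Half of
     this exceeds t <= D / 16, so regularity in the i-th variable applies. *)
  have [k Hk] : exists k, D / 4 <= enorm (w ord0 i - w ord0 k).
    have := ler_enormB (w ord0 a) (w ord0 i) (w ord0 b).
    rewrite (enormB (w ord0 a) (w ord0 i)) => h.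
    case: (leP (D / 4) (enorm (w ord0 i - w ord0 a))) => h1; first by exists a.
    by exists b; lra.
  have : enorm (w ord0 i - w ord0 k) <=
      \big[Num.max/0]_(k < m.+1) enorm (w ord0 i - w ord0 k).
    exact: le_bigmax.
  move=> h; lra.
rewrite mulrAC -mulrA [leRHS]mulrAC -mulrA; apply: ler_wpM2l; first exact: ltW.
rewrite mulrC ler_pM ?powR_ge0 ?invr_ge0 ?powR_ge0//.
  by rewrite ge0_ler_powR ?nnegrE ?enorm_ge0 ?(ltW e0)// wi enormB.
have sp : D / 2 <= spread w by exact: le_trans fw (spread_ge _ _ _).
have D20 : 0 < D / 2 by rewrite divr_gt0.
rewrite lef_pV2 ?posrE ?powR_gt0// ?(lt_le_trans D20)//.
by rewrite ge0_ler_powR ?nnegrE ?addr_ge0 ?(ltW e0) ?(ltW D20)// (le_trans (ltW D20)).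
Qed.

(** The kernel is the pointwise limit of its values at the rounded points, each of these
    approximations being measurable. *)
Lemma cmeasurable_offdiag : cz_kernel K -> cmeasurable offdiag.
Proof.
move=> hK; apply: (@cmeasurable_cvg R _ 'rV['rV[R]_n]_m.+1 (fun k y => offdiag (grid_point R k (cell k y)))).
  move=> k; split.
    exact: (measurable_fun_cell k (fun z => complex.Re (offdiag (grid_point R k z)))).
  exact: (measurable_fun_cell k (fun z => complex.Im (offdiag (grid_point R k z)))).
move=> y; have [yd|yd] := pselect (on_diagonal y).
  (* Equal components have equal roundings, so a diagonal point is rounded to a diagonal point and
     both values are 0. *)
  apply: cabs_cvg_eventually; apply: nearW => k; rewrite /offdiag.
  case: asboolP => [_|]; first by case: asboolP.
  move=> H; exfalso; apply: H => i j; apply/rowP => l; rewrite !mxE.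
  by rewrite (yd i j).
have [A [del [eps [d0 e0 H]]]] := cz_kernel_continuous hK yd.
pose u k : R := n%:R * k.+1%:R^-1.
have u0 k : 0 <= u k by rewrite mulr_ge0 ?invr_ge0.
have cu : u @ \oo --> (0 : R).
  rewrite -(mulr0 n%:R); apply: cvgM; [exact: cvg_cst|exact: cvg_harmonic].
have cb : (fun k => A * u k `^ eps) @ \oo --> (0 : R).
  rewrite -(mulr0 A); apply: cvgM; [exact: cvg_cst|exact: cvg_powR0].
have cu' : \forall k \near \oo, u k <= del.
  have /cvgrPdist_lt/(_ _ d0) := cu; apply: filterS => k.
  by rewrite sub0r normrN ger0_norm// => /ltW.
apply: (squeeze_cvgr _ (@cvg_cst _ (0 : R) _ \oo _) cb).
apply: filterS cu' => k uk; rewrite cabs_ge0/= cabsB.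
have [od le] := H (u k) _ (u0 k) uk (fun i => grid_point_dist k y i).
by rewrite !offdiagE.
Qed.

Lemma offdiag_size : cz_kernel K -> exists2 C : R, 0 < C &
  forall (x : Rn) (y : 'rV[Rn]_m) i (del : R), 0 < del ->
    del <= enorm (x - y ord0 i) ->
    cabs (offdiag (consv x y)) <= C / del ^+ (m * n)%N.
Proof.
move=> [C [eps [C0 e0 Ksize Kreg]]]; exists C => // x y i del d0 dxy.
have od := consv_offdiag d0 dxy.
rewrite offdiagE//; apply: le_trans (Ksize _ od) _.
have sp : del <= spread (consv x y).
  apply: le_trans dxy _; have := spread_ge (consv x y) ord0 (lift ord0 i).
  by rewrite consv0 consvS.
rewrite ler_wpM2l ?(ltW C0)// lef_pV2 ?posrE ?exprn_gt0// ?(lt_le_trans d0)//.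
by rewrite lerXn2r// nnegrE ?(ltW d0)// (le_trans (ltW d0)).
Qed.

End kernel_estimates.

(** * Kernel representation for separated supports *)

Lemma prode_lty (R : realType) (I : Type) (s : seq I) (P : pred I) (f : I -> \bar R) :
  (forall i, 0 <= f i)%E -> (forall i, P i -> f i < +oo)%E ->
  (\prod_(i <- s | P i) f i < +oo)%E.
Proof.
move=> f0 foo; elim: s => [|i s IH]; first by rewrite big_nil ltry.
rewrite big_cons; case: ifPn => // Pi; rewrite lte_mul_pinfty ?f0//.
by rewrite ge0_fin_numE ?f0// foo.
Qed.

Lemma lee_prod (R : realType) (I : Type) (s : seq I) (f g : I -> \bar R) :
  (forall i, 0 <= f i)%E -> (forall i, f i <= g i)%E ->
  (\prod_(i <- s) f i <= \prod_(i <- s) g i)%E.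
Proof.
move=> f0 fg; elim: s => [|i s IH]; first by rewrite !big_nil.
by rewrite !big_cons lee_pmul// prode_ge0.
Qed.

Section function_update.
Context (R : realType) (n m : nat).
Local Notation Rn := 'rV[R]_n.
Implicit Types F : 'I_m -> Rn -> R[i].

Lemma upd_eq F i f : upd F i f i = f.
Proof. by rewrite /upd eqxx. Qed.

Lemma upd_neq F i f k : k != i -> upd F i f k = F k.
Proof. by rewrite /upd => /negPf ->. Qed.

Lemma upd_id F i : upd F i (F i) = F.
Proof. by apply/funext => k; rewrite /upd; case: eqVneq => // ->. Qed.

Lemma upd_all (Q : 'I_m -> (Rn -> R[i]) -> Prop) F i f :
  (forall k, Q k (F k)) -> Q i f -> forall k, Q k (upd F i f k).
Proof. by move=> QF Qf k; rewrite /upd; case: eqVneq => // ->. Qed.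

Lemma kernel_integrand_upd (K : 'rV[Rn]_m.+1 -> R[i]) F i (c : R[i]) f h x y :
  kernel_integrand K (upd F i (fun u => c * f u + h u)) x y =
  c * kernel_integrand K (upd F i f) x y + kernel_integrand K (upd F i h) x y.
Proof.
have E g : \prod_(l < m) upd F i g l (y ord0 l) =
    g (y ord0 i) * \prod_(l < m | l != i) F l (y ord0 l).
  rewrite (bigD1 i)//= upd_eq; congr (_ * _).
  by apply: eq_bigr => l li; rewrite upd_neq.
rewrite /kernel_integrand !E; ring.
Qed.

End function_update.

Section kernel_integral.
Context (R : realType) (n m : nat).
Local Notation Rn := 'rV[R]_n.
Implicit Types F : 'I_m -> Rn -> R[i].
Variable K : 'rV[Rn]_m.+1 -> R[i].
Hypothesis hK : cz_kernel K.

Definition kernel_int F (x : Rn) : R[i] :=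
  cintegral (lebm R n m) (kernel_integrand (offdiag K) F x).

Lemma cmeasurable_kernel_integrand2 F : (forall i, cmeasurable (F i)) ->
  cmeasurable (fun z : Rn * 'rV[Rn]_m => kernel_integrand (offdiag K) F z.1 z.2).
Proof.
move=> mF; apply: cmeasurableM.
  exact: (cmeasurable_comp (cmeasurable_offdiag hK) (@measurable_consv _ _ _)).
apply: cmeasurable_prod => i; apply: (cmeasurable_comp (mF i)).
exact: (measurableT_comp (@measurable_rowvec_coord _ _ _ i) measurable_snd).
Qed.

Lemma cmeasurable_kernel_integrand F x : (forall i, cmeasurable (F i)) ->
  cmeasurable (kernel_integrand (offdiag K) F x).
Proof.
move=> mF; apply: (cmeasurable_comp (cmeasurable_kernel_integrand2 mF) (h := fun y => (x, y))).
exact: measurable_pair1.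
Qed.

Lemma cmeasurable_kernel_int F : (forall i, cmeasurable (F i)) ->
  cmeasurable (kernel_int F).
Proof.
by move=> mF; apply: (cmeasurable_cintegral _ (cmeasurable_kernel_integrand2 mF)).
Qed.

Lemma int_tensor F : (forall i, cmeasurable (F i)) ->
  (\int[lebm R n m]_y (\prod_(i < m) cabs (F i (y ord0 i)))%:E =
   \prod_(i < m) \int[leb R n]_x (cabs (F i x))%:E)%E.
Proof.
move=> mF; rewrite -(integral_power_measure_prod (leb R n)).
- by apply: eq_integral => y _; rewrite prod_EFin.
- by move=> i; apply/measurable_EFinP; exact: measurable_cabs.
- by move=> i x; rewrite lee_fin cabs_ge0.
Qed.

Lemma kernel_integrand_bound F x (A : R) : (forall i, cmeasurable (F i)) -> 0 <= A ->
  (forall y : 'rV[Rn]_m, (forall i, F i (y ord0 i) != 0) ->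
    cabs (offdiag K (consv x y)) <= A) ->
  (\int[lebm R n m]_y (cabs (kernel_integrand (offdiag K) F x y))%:E <=
   A%:E * \prod_(i < m) \int[leb R n]_x (cabs (F i x))%:E)%E.
Proof.
move=> mF A0 KA; rewrite -int_tensor// -ge0_integralZl//; last 2 first.
- apply/measurable_EFinP; apply: measurable_prod => i _.
  apply: measurable_cabs; apply: (cmeasurable_comp (mF i)).
  exact: measurable_rowvec_coord.
- by move=> y _; rewrite lee_fin prodr_ge0// => i _; exact: cabs_ge0.
apply: ge0_le_integral_nonmeasurable => y; first by rewrite lee_fin cabs_ge0.
rewrite -EFinM lee_fin /kernel_integrand cabsM cabs_prod.
case: (boolP [forall i, F i (y ord0 i) != 0]) => [/forallP H|].
  by rewrite ler_wpM2r ?KA// prodr_ge0// => i _; exact: cabs_ge0.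
rewrite negb_forall => /existsP; case=> i; rewrite negbK => /eqP Fi.
by rewrite (bigD1 i)//= Fi cabs0 !mul0r !mulr0.
Qed.

End kernel_integral.

Lemma leb_oboxE (R : realType) (n : nat) (a b : 'I_n -> R) :
  leb R n (obox a b) = (\prod_(i < n) leb1 (`]a i, b i[%classic : set R))%E.
Proof.
have := @power_measure_box _ _ R (@leb1 R) n (fun i => `]a i, b i[%classic).
move=> <-; last by move=> i; exact: measurable_itv.
by congr (leb R n _); apply/seteqP; split => x H i; have := H i; rewrite /= in_itv.
Qed.

Lemma leb_obox_lty (R : realType) (n : nat) (a b : 'I_n -> R) :
  (leb R n (obox a b) < +oo)%E.
Proof.
rewrite leb_oboxE; apply: prode_lty => i; first exact: measure_ge0.
move=> _; rewrite /leb1 lebesgue_measure_itv/=.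
by case: ifP => // _; rewrite -EFinB ltry.
Qed.

Lemma cintegral_ae_eq0 (R : realType) d (T : measurableType d)
    (mu : {measure set T -> \bar R}) (w : T -> R[i]) : cintegrable mu w ->
  (forall A, measurable A -> cintegral mu (cut A w) = 0) ->
  {ae mu, forall x, w x = 0}.
Proof.
move=> wi H; have [w1 w2] := wi; have [[m1 m2] _] := (cintegrableP mu w).1 wi.
have part (u : T -> R) : mu.-integrable setT (EFin \o u) ->
    (forall A, measurable A -> \int[mu]_x (if x \in A then u x else 0) = 0) ->
    {ae mu, forall x, u x = 0}.
  move=> ui uA.
  have := @integral_ae_eq _ T R mu setT measurableT (cst 0%E) (EFin \o u) ui.
  move=> /(_ (measurable_cst _)) h.
  have {h} : ae_eq mu setT (EFin \o u) (cst 0%E).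
    apply: h => E _ mE; rewrite integral0.
    rewrite integral_mkcond -[LHS]fineK; last first.
      by apply: integrable_fin_num => //; apply/(integrable_mkcond _ mE)/(integrableS measurableT).
    congr EFin; rewrite -[RHS](uA E mE) /Rintegral; congr fine.
    by apply: eq_integral => x _; rewrite patchE; case: ifP.
  by apply: filterS => x /(_ I) /= [].
have a1 : {ae mu, forall x, complex.Re (w x) = 0}.
  apply: part => // A mA; apply: etrans (congr1 (@complex.Re R) (H A mA)).
  by apply: eq_Rintegral => x _; rewrite /cut; case: ifP.
have a2 : {ae mu, forall x, complex.Im (w x) = 0}.
  apply: part => // A mA; apply: etrans (congr1 (@complex.Im R) (H A mA)).
  by apply: eq_Rintegral => x _; rewrite /cut; case: ifP.
by apply: filterS2 a1 a2 => x r i; apply: complexP.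
Qed.

Section representation.
Context (R : realType) (n m : nat).
Local Notation Rn := 'rV[R]_n.
Local Notation fam := ('I_m -> Rn -> R[i]).
Variable K : 'rV[Rn]_m.+1 -> R[i].
Variable T : fam -> (Rn -> R[i]) -> R[i].
Hypothesis hT : cz_operator K T.
Variables (p : R) (q : 'I_m -> R).
Hypotheses (hp : 1 < p) (hq : forall i, 1 < q i).
Variable S : fam -> Rn -> R[i].
Hypothesis hS : bounded_extension T q p S.

Let hK : cz_kernel K. Proof. by case: hT. Qed.
Let p0 : 0 < p. Proof. exact: lt_trans hp. Qed.
Let pn0 : p != 0. Proof. by rewrite gt_eqF. Qed.
Let q0 i : 0 < q i. Proof. exact: lt_trans (hq i). Qed.
Let qn0 i : q i != 0. Proof. by rewrite gt_eqF. Qed.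

Section separated_boxes.
Variables (a0 b0 : 'I_n -> R) (a b : 'I_m -> 'I_n -> R).
Variables (i0 : 'I_m) (j0 : 'I_n) (del : R).
Hypothesis del0 : 0 < del.
Hypothesis sep : b0 j0 + del <= a i0 j0 \/ b i0 j0 + del <= a0 j0.
Let Q := obox a0 b0.
Let P i := obox (a i) (b i).

(** Q is the box of the output variable and P i that of the i-th argument. Only the box of the
    argument i0 is separated from Q, along the axis j0 and with gap [del]. *)
Definition good i (f : Rn -> R[i]) : Prop :=
  Lp (leb R n) (q i) f /\ forall x, ~ P i x -> f x = 0.

Let mQ : measurable Q. Proof. exact: measurable_obox. Qed.
Let mP i : measurable (P i). Proof. exact: measurable_obox. Qed.

Lemma sep_dist x y : Q x -> P i0 y -> del <= enorm (x - y).
Proof.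
move=> /(_ j0) /andP[h1 h2] /(_ j0) /andP[h3 h4].
apply: le_trans (coord_le_enorm _ j0); rewrite !mxE ler_normr.
by case: sep => h; apply/orP; [right|left]; lra.
Qed.

(** The positive gap also separates the closed boxes, in which the closed supports of the bumps
    lie. *)
Lemma sep_closed (t : R) : a0 j0 <= t <= b0 j0 -> a i0 j0 <= t <= b i0 j0 -> False.
Proof.
move=> /andP[h1 h2] /andP[h3 h4]; case: sep => h.
  by have := le_trans (le_trans h h3) h2; rewrite gerDl leNgt del0.
by have := le_trans (le_trans h h1) h4; rewrite gerDl leNgt del0.
Qed.

Lemma sep_kernel_bound : exists2 A, 0 <= A & forall F x, Q x ->
  (forall i, good i (F i)) -> forall y : 'rV[Rn]_m, (forall i, F i (y ord0 i) != 0) ->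
    cabs (offdiag K (consv x y)) <= A.
Proof.
have [C C0 HC] := offdiag_size hK.
exists (C / del ^+ (m * n)); first by rewrite divr_ge0 ?exprn_ge0 ?ltW.
move=> F x Qx gF y Fy; apply: (HC x y i0) => //; apply: sep_dist => //.
by apply: contrapT => /(gF i0).2 /eqP; apply/negP/Fy.
Qed.

Lemma good_int i f : good i f -> (\int[leb R n]_x (cabs (f x))%:E < +oo)%E.
Proof. by move=> [Lf fP]; apply: (Lp_int_cabs_lty (hq i) (mP i)) => //; exact: leb_obox_lty. Qed.

Lemma good_measurable i f : good i f -> cmeasurable f.
Proof. by case=> -[]. Qed.

Lemma int_cabs_ge0 (f : Rn -> R[i]) : (0 <= \int[leb R n]_x (cabs (f x))%:E)%E.
Proof. by apply: integral_ge0 => x _; rewrite lee_fin cabs_ge0. Qed.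

Lemma sep_cintegrable F x : Q x -> (forall i, good i (F i)) ->
  cintegrable (lebm R n m) (kernel_integrand (offdiag K) F x).
Proof.
move=> Qx gF; have [A A0 HA] := sep_kernel_bound.
have mF i := good_measurable (gF i).
apply/cintegrableP; split; first exact: cmeasurable_kernel_integrand.
apply: le_lt_trans (kernel_integrand_bound mF A0 (HA F x Qx gF)) _.
rewrite lte_mul_pinfty ?lee_fin//; apply: prode_lty => i; first exact: int_cabs_ge0.
by move=> _; exact: good_int (gF i).
Qed.

Lemma sep_kernel_int_bound : exists2 A, 0 <= A & forall F x, Q x ->
  (forall i, good i (F i)) ->
  ((cabs (kernel_int K F x))%:E <= A%:E * \prod_(i < m) \int[leb R n]_x (cabs (F i x))%:E)%E.
Proof.
have [A A0 HA] := sep_kernel_bound; exists (2 * A); first by rewrite mulr_ge0.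
move=> F x Qx gF; apply: le_trans (cabs_cintegral_le (sep_cintegrable Qx gF)) _.
rewrite EFinM -muleA lee_pmul2l//.
have mF i := good_measurable (gF i).
exact: (kernel_integrand_bound mF A0 (HA F x Qx gF)).
Qed.

Lemma kernel_int_upd F i (c : R[i]) f h x : Q x -> (forall k, good k (F k)) ->
  good i f -> good i h ->
  kernel_int K (upd F i (fun u => c * f u + h u)) x =
  c * kernel_int K (upd F i f) x + kernel_int K (upd F i h) x.
Proof.
move=> Qx gF gf gh.
have if_ := sep_cintegrable Qx (upd_all gF gf).
have ih := sep_cintegrable Qx (upd_all gF gh).
rewrite /kernel_int -cintegralZ// -cintegralD//; last exact: cintegrableZ.
by congr cintegral; apply/funext => y; exact: kernel_integrand_upd.
Qed.

(** What has to vanish for the representation to hold on Q. In each slot its vanishing is preserved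
    by linear combinations and dominated limits, and so spreads from bumps to L^q. *)
Definition defect F x := cut Q (fun x => S F x - kernel_int K F x) x.

Lemma good_Lp F : (forall i, good i (F i)) -> Lp (leb R n) p (S F).
Proof. by move=> gF; case: hS => H _ _ _; apply: H => i; case: (gF i). Qed.

Lemma cmeasurable_defect F : (forall i, good i (F i)) -> cmeasurable (defect F).
Proof.
move=> gF; apply: cmeasurable_cut => //; apply: cmeasurableB.
  by case: (good_Lp gF).
by apply: cmeasurable_kernel_int => // i; exact: good_measurable (gF i).
Qed.

(** Continuity in one slot, the others being frozen. The term [S] is bounded by hypothesis; the
    kernel integral is bounded on Q by a multiple of the L^1 norms, and Hoelder's inequality on P i
    returns to L^(q i). *)
Lemma defect_bound F i : (forall k, good k (F k)) -> exists2 B : R, 0 <= B &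
  forall f, good i f ->
  (Lpnorm (leb R n) p (defect (upd F i f)) <= B%:E * Lpnorm (leb R n) (q i) f)%E.
Proof.
move=> gF; have [A A0 HA] := sep_kernel_int_bound.
have [_ _ [C [C0 HC]] _] := hS.
have Qoo : (leb R n Q < +oo)%E by exact: leb_obox_lty.
pose B1 := (C%:E * \prod_(k < m | k != i) Lpnorm (leb R n) (q k) (F k))%E.
pose I2 := (\prod_(k < m | k != i) \int[leb R n]_x (cabs (F k x))%:E)%E.
pose v := (leb R n (P i) `^ (1 - (q i)^-1))%E.
pose B2 := (A%:E * (v * I2) * (leb R n Q `^ p^-1))%E.
have I20 : (0 <= I2)%E by apply: prode_ge0 => k _; exact: int_cabs_ge0.
have I2oo : (I2 < +oo)%E.
  by apply: prode_lty => k; [exact: int_cabs_ge0|move=> _; exact: good_int (gF k)].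
have voo : (v < +oo)%E by apply: poweR_lty; exact: leb_obox_lty.
have v0 : (0 <= v)%E by exact: poweR_ge0.
have B10 : (0 <= B1)%E.
  by rewrite mule_ge0 ?lee_fin ?(ltW C0)// prode_ge0// => k _; exact: Lpnorm_ge0.
have B1oo : (B1 < +oo)%E.
  rewrite lte_mul_pinfty ?lee_fin ?(ltW C0)//.
  by apply: prode_lty => k; [exact: Lpnorm_ge0|move=> _; case: (gF k) => -[]].
have B20 : (0 <= B2)%E by rewrite !mule_ge0 ?lee_fin// poweR_ge0.
have B2oo : (B2 < +oo)%E.
  have vI : (A%:E * (v * I2) < +oo)%E.
    by rewrite lte_mul_pinfty ?lee_fin// lte_mul_pinfty// ge0_fin_numE.
  by rewrite lte_mul_pinfty ?mule_ge0 ?poweR_lty ?ge0_fin_numE ?mule_ge0.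
exists (fine B1 + fine B2); first by rewrite addr_ge0// fine_ge0.
move=> f gf; have gU := upd_all gF gf.
have mf := good_measurable gf.
have [LS _] := good_Lp gU.
have mK : cmeasurable (kernel_int K (upd F i f)).
  by apply: cmeasurable_kernel_int => // k; exact: good_measurable (gU k).
rewrite EFinD !fineK ?ge0_fin_numE// ge0_muleDl//.
have -> : defect (upd F i f) = fun x => cut Q (S (upd F i f)) x +
    (-1) * cut Q (kernel_int K (upd F i f)) x.
  apply/funext => x; rewrite /defect mulN1r; have [Qx|Qx] := pselect (Q x).
    by rewrite !cut_in.
  by rewrite !cut_out// subrr.
apply: le_trans (LpnormD _ (ltW hp) _ _) _.
- exact: cmeasurable_cut.
- by apply: cmeasurableM; [exact: cmeasurable_cst|exact: cmeasurable_cut].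
apply: leeD.
  apply: (@le_trans _ _ (Lpnorm (leb R n) p (S (upd F i f)))).
    by apply: le_Lpnorm => // x; exact: cabs_cut_le.
  apply: le_trans (HC _ _) _; first by move=> k; case: (gU k).
  rewrite (bigD1 i)//= upd_eq /B1 muleCA muleC.
  rewrite le_eqVlt; apply/orP; left; apply/eqP; rewrite -!muleA; congr (_ * _)%E.
  by congr (_ * _)%E; apply: eq_bigr => k ki; rewrite upd_neq.
rewrite LpnormZ//; last exact: cmeasurable_cut.
rewrite cabsN cabs1 mul1e.
have intf := int_cabs_le_Lpnorm (leb R n) (hq i) (mP i) mf gf.2.
pose M := (A%:E * \prod_(k < m) \int[leb R n]_x (cabs (upd F i f k x))%:E)%E.
have ME : M = (A%:E * ((\int[leb R n]_x (cabs (f x))%:E) * I2))%E.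
  rewrite /M (bigD1 i)//= upd_eq; congr (_ * (_ * _))%E.
  by apply: eq_bigr => k ki; rewrite upd_neq.
have M0 : (0 <= M)%E by rewrite ME !mule_ge0 ?lee_fin ?int_cabs_ge0.
have Moo : (M < +oo)%E.
  rewrite ME lte_mul_pinfty ?lee_fin// lte_mul_pinfty ?int_cabs_ge0//.
  by rewrite ge0_fin_numE ?int_cabs_ge0//; exact: good_int gf.
apply: (@le_trans _ _ (M * (leb R n Q `^ p^-1))%E).
  rewrite -[M]fineK ?ge0_fin_numE//.
  apply: Lpnorm_bounded_le => //; first exact: fine_ge0.
    move=> x; have [Qx|Qx] := pselect (Q x); last by rewrite cut_out// cabs0 fine_ge0.
    by rewrite cut_in// -lee_fin fineK ?ge0_fin_numE//; exact: HA.
  by move=> x; exact: cut_out.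
rewrite ME /B2 [leRHS]muleAC; apply: lee_wpmul2r; first exact: poweR_ge0.
rewrite -[leRHS]muleA; apply: lee_wpmul2l; first by rewrite lee_fin.
rewrite [leRHS]muleAC; apply: lee_wpmul2r => //.
by rewrite muleC.
Qed.

Lemma defect_linear F i (c : R[i]) f h : (forall k, good k (F k)) ->
  good i f -> good i h ->
  {ae leb R n, forall x, defect (upd F i (fun u => c * f u + h u)) x =
    c * defect (upd F i f) x + defect (upd F i h) x}.
Proof.
move=> gF gf gh; have [_ SL _ _] := hS.
have LF k : Lp (leb R n) (q k) (F k) by case: (gF k).
apply: filterS (SL F i c f h LF gf.1 gh.1) => x Hx.
rewrite /defect; have [Qx|Qx] := pselect (Q x); last first.
  by rewrite !cut_out// mulr0 addr0.
rewrite !cut_in// Hx kernel_int_upd//; ring.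
Qed.

Lemma good_linear i (c : R[i]) f h : good i f -> good i h ->
  good i (fun u => c * f u + h u).
Proof.
move=> [Lf fP] [Lh hP]; split.
  by apply: LpD; [exact: ltW|exact: LpZ|].
by move=> x Px; rewrite fP// hP// mulr0 addr0.
Qed.

Lemma good_bounded_in i f : bounded_in (P i) f -> good i f.
Proof.
move=> [mf [M fM] fP]; split => //.
by apply: (@Lp_bounded _ _ _ _ _ M (P i)) => //; exact: leb_obox_lty.
Qed.

(** As the defect of h_k is zero, that of h_k - f equals minus that of f almost everywhere; its norm
    tends to 0 by [defect_bound] and dominated convergence in L^(q i). *)
Lemma defect_limit F i (h : (Rn -> R[i])^nat) f G : (forall k, good k (F k)) ->
  (forall k, cmeasurable (h k)) -> cmeasurable f -> good i G ->
  (forall k x, cabs (h k x) <= cabs (G x)) ->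
  (forall x, (fun k => cabs (h k x - f x)) @ \oo --> (0 : R)) ->
  (forall k, {ae leb R n, forall x, defect (upd F i (h k)) x = 0}) ->
  {ae leb R n, forall x, defect (upd F i f) x = 0}.
Proof.
move=> gF mh mf [LG GP] hG hf Eh.
have [fG small] := Lp_dominated_cvg (q0 i) mh mf hf LG hG.
have dom g : cmeasurable g -> (forall x, cabs (g x) <= cabs (G x)) -> good i g.
  move=> mg gG; split; first exact: le_Lp LG.
  move=> x Px; apply: cabs_eq0; apply/eqP; rewrite eq_le cabs_ge0 andbT.
  by rewrite (le_trans (gG x))// GP// cabs0.
have gf := dom f mf fG.
have gh k := dom (h k) (mh k) (hG k).
have gu k : good i (fun x => -1 * f x + h k x) by exact: good_linear.
have [B B0 HB] := defect_bound i gF.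
have md g : good i g -> cmeasurable (defect (upd F i g)).
  by move=> gg; apply: cmeasurable_defect; exact: upd_all.
have N0 : Lpnorm (leb R n) p (defect (upd F i f)) = 0%E.
  apply/eqP; rewrite eq_le Lpnorm_ge0 andbT; apply/lee_addgt0Pr => e e0; rewrite add0e.
  have d0 : 0 < e / (B + 1) by rewrite divr_gt0// ltr_wpDl.
  have [k0 _ /(_ k0 (leqnn _)) Hk] := small _ d0.
  apply: (@le_trans _ _ (Lpnorm (leb R n) p (defect (upd F i (fun x => -1 * f x + h k0 x))))).
    apply: ae_le_Lpnorm => //; [exact: md|exact: md|].
    apply: filterS2 (defect_linear (-1) gF gf (gh k0)) (Eh k0) => x -> ->.
    by rewrite addr0 mulN1r cabsN.
  apply: le_trans (HB _ (gu k0)) _.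
  have -> : (fun x => -1 * f x + h k0 x) = (fun x => h k0 x - f x).
    by apply/funext => x; rewrite mulN1r addrC.
  apply: (@le_trans _ _ (B%:E * (e / (B + 1))%:E)%E).
    by apply: lee_wpmul2l; rewrite ?lee_fin.
  rewrite -EFinM lee_fin mulrCA ger_pMr// ler_pdivrMr ?ltr_wpDl//.
  by rewrite mul1r lerDl.
have := @Lnorm_eq0_eq0 _ _ _ (leb R n) (fun x => (cabs (defect (upd F i f) x))%:E) p%:E.
move=> /(_ _ _ N0) H.
have {}H : ae_eq (leb R n) setT (fun x => (cabs (defect (upd F i f) x))%:E) (cst 0%E).
  apply: H; last by rewrite lte_fin.
  by apply/measurable_EFinP; apply: measurable_cabs; exact: md.
by apply: filterS H => x /(_ I) /= [] /cabs_eq0.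
Qed.

Lemma defect_slot F i : (forall k, good k (F k)) ->
  (forall a' b' k, obox a' b' `<=` P i ->
    {ae leb R n, forall x, defect (upd F i (ctensor (fun l => bump (a' l) (b' l) k))) x = 0}) ->
  forall f, good i f -> {ae leb R n, forall x, defect (upd F i f) x = 0}.
Proof.
move=> gF Hbump f [Lf fP].
pose Pr f := {ae leb R n, forall x, defect (upd F i f) x = 0}.
have Plin c g h : good i g -> good i h -> Pr g -> Pr h -> Pr (fun x => c * g x + h x).
  move=> gg gh Pg Ph.
  apply: filterS3 (defect_linear c gF gg gh) Pg Ph => x -> -> ->.
  by rewrite mulr0 addr0.
have gI A : measurable A -> good i (indC (A `&` P i)).
  by move=> mA; apply: good_bounded_in; exact: bounded_in_indC.
apply: (@Lp_extension R n (q i) (P i) Pr); first exact: hq.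
- exact: mP.
- exact: leb_obox_lty.
- by move=> c g h Lg Lh gP hP; apply: Plin.
- move=> h g G mh mg LG GP hG hg Ph.
  by apply: (@defect_limit F i h g G).
- apply: indicator_extension.
  + by move=> c g h /good_bounded_in gg /good_bounded_in gh; exact: Plin.
  + move=> h g bh bg h1 hg Ph.
    have mh k : cmeasurable (h k) by case: (bh k).
    have mg : cmeasurable g by case: bg.
    (* Functions bounded by 1 and supported in P i are dominated by the indicator of P i, which lies
       in L^(q i) because the box has finite measure. *)
    apply: (@defect_limit F i h g (indC (setT `&` P i))) => //; first exact: gI.
    move=> k x; have [Px|Px] := pselect (P i x).
      by rewrite setTI /indC cut_in// cabs1.
    by have [_ _ ->] := bh k; rewrite // cabs0 cabs_ge0.
  + by move=> a' b' k sub; exact: Hbump.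
- exact: Lf.
- exact: fP.
Qed.

Definition is_bump i (f : Rn -> R[i]) : Prop := exists a' b' k,
  obox a' b' `<=` P i /\ f = ctensor (fun l => bump (a' l) (b' l) k).

Lemma good_bump i f : is_bump i f -> good i f.
Proof.
move=> [a' [b' [k [sub ->]]]]; apply: good_bounded_in; split.
- exact: cmeasurable_ctensor_bump.
- by exists 1 => x; exact: ctensor_bump_le1.
- by move=> x Px; apply: ctensor_bump_out => H; exact/Px/sub.
Qed.

Lemma bump_test (a1 b1 a' b' : 'I_n -> R) k : obox a' b' `<=` obox a1 b1 ->
  let f := ctensor (fun l => bump (a' l) (b' l) k) in
  [/\ schwartz f, test_function f &
      csupp f `<=` [set x : Rn | forall i, a1 i <= x ord0 i <= b1 i]].
Proof.
move=> sub f.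
have Cf (i : 'I_n) j : Cn j (bump (a' i) (b' i) k) by exact: Cn_bump.
have f0 (i : 'I_n) t : ~~ (a' i <= t <= b' i) -> bump (a' i) (b' i) k t = 0.
  by move=> H; apply: bump_out; apply: contraNN H => /andP[/ltW -> /ltW ->].
split; [exact: schwartz_ctensor Cf f0|exact: test_function_ctensor Cf f0|].
apply: csupp_subset; first exact: closed_box.
move=> x H; apply: ctensor_bump_out => /sub Hx; apply: H => i.
by have /andP[/ltW -> /ltW ->] := Hx i.
Qed.

(** Both [has_kernel] and [represented_by] give only integrals against a test function. Their
    comparison makes the defect orthogonal to the bumps in Q, then to indicators of measurable
    subsets of Q, hence zero almost everywhere. *)
Lemma defect_bumps F : (forall i, is_bump i (F i)) ->
  {ae leb R n, forall x, defect F x = 0}.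
Proof.
move=> bF; have gF i : good i (F i) by exact: good_bump.
have [_ _ _ hker _] := hT; have [_ _ _ hrep] := hS.
have sF i : schwartz (F i).
  by have [a' [b' [k [sub ->]]]] := bF i; have [] := bump_test k sub.
have tF i : test_function (F i).
  by have [a' [b' [k [sub ->]]]] := bF i; have [] := bump_test k sub.
have mF i := good_measurable (gF i).
have mU : cmeasurable (kernel_int K F) by exact: cmeasurable_kernel_int.
have mS : cmeasurable (S F) by case: (good_Lp gF).
have Qoo : (leb R n Q < +oo)%E by exact: leb_obox_lty.
have LU : Lp (leb R n) p (cut Q (kernel_int K F)).
  have [A A0 HA] := sep_kernel_int_bound.
  pose M := (A%:E * \prod_(k < m) \int[leb R n]_x (cabs (F k x))%:E)%E.
  have M0 : (0 <= M)%E.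
    by rewrite mule_ge0 ?lee_fin// prode_ge0// => k _; exact: int_cabs_ge0.
  have Moo : (M < +oo)%E.
    rewrite lte_mul_pinfty ?lee_fin//; apply: prode_lty => k; first exact: int_cabs_ge0.
    by move=> _; exact: good_int (gF k).
  apply: (@Lp_bounded _ _ _ _ p (fine M) Q) => //.
  - exact: cmeasurable_cut.
  - move=> x; have [Qx|Qx] := pselect (Q x); last by rewrite cut_out// cabs0 fine_ge0.
    by rewrite cut_in// -lee_fin fineK ?ge0_fin_numE//; exact: HA.
  - by move=> x; exact: cut_out.
have Lw : Lp (leb R n) p (defect F).
  have -> : defect F = fun x => cut Q (S F) x - cut Q (kernel_int K F) x.
    apply/funext => x; rewrite /defect; have [Qx|Qx] := pselect (Q x).
      by rewrite !cut_in.
    by rewrite !cut_out// subrr.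
  by apply: LpB => //; [exact: ltW|apply: Lp_cut => //; exact: good_Lp].
have wQ x : ~ Q x -> defect F x = 0 by exact: cut_out.
have iw : cintegrable (leb R n) (defect F).
  by apply/cintegrableP; split; [case: Lw|exact: Lp_int_cabs_lty hp mQ Qoo Lw wQ].
have mw : cmeasurable (defect F) by case: Lw.
have iwg g : bounded_in Q g -> cintegrable (leb R n) (fun x => defect F x * g x).
  move=> [mg [M gM] gQ]; have [_ woo] := (cintegrableP _ _).1 iw.
  have M0 : 0 <= M by apply: le_trans (gM 0); exact: cabs_ge0.
  apply: (@cintegrable_le _ _ _ _ _ (fun x => M%:E * (cabs (defect F x))%:E)%E).
  - exact: cmeasurableM.
  - by move=> x; rewrite -EFinM lee_fin cabsM mulrC ler_wpM2r ?cabs_ge0.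
  - rewrite ge0_integralZl//; first by rewrite lte_mul_pinfty ?lee_fin.
    + by apply/measurable_EFinP; exact: measurable_cabs.
    + by move=> x _; rewrite lee_fin cabs_ge0.
pose Pr g := cintegral (leb R n) (fun x => defect F x * g x) = 0.
have Pind : forall A, measurable A -> Pr (indC (A `&` Q)).
  apply: indicator_extension.
  - move=> c g h bg bh Pg Ph; rewrite /Pr.
    rewrite (_ : (fun _ => _) = fun x => c * (defect F x * g x) + defect F x * h x).
      rewrite cintegralD ?cintegralZ ?Pg ?Ph ?mulr0 ?addr0//; try exact: iwg.
      by apply: cintegrableZ; exact: iwg.
    by apply/funext => x; ring.
  - move=> h g bh bg h1 hg Ph; rewrite /Pr.
    have [] := @cintegral_cvg _ _ _ (leb R n) (fun k x => defect F x * h k x)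
      (fun x => defect F x * g x) (fun x => (cabs (defect F x))%:E).
    + by move=> k; apply: cmeasurableM => //; case: (bh k).
    + by apply: cmeasurableM => //; case: bg.
    + move=> x; rewrite (_ : (fun _ => _) = fun k => cabs (defect F x) * cabs (h k x - g x)).
        by rewrite -(mulr0 (cabs (defect F x))); apply: cvgM; [exact: cvg_cst|exact: hg].
      by apply/funext => k; rewrite -mulrBr cabsM.
    + apply/integrableP; split; first by apply/measurable_EFinP; exact: measurable_cabs.
      under eq_integral do rewrite gee0_abs ?lee_fin ?cabs_ge0//.
      by case: ((cintegrableP _ _).1 iw).
    + by move=> k x; rewrite lee_fin cabsM ler_piMr ?cabs_ge0.
    move=> _ _; under eq_fun do rewrite (Ph _) sub0r cabsN.
    by move=> /(cvg_lim (@Rhausdorff R)); rewrite lim_cst// => /cabs_eq0.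
  - move=> a' b' k sub; rewrite /Pr.
    set g := ctensor _.
    have [sg tg cg] := bump_test k sub.
    have bg : bounded_in Q g.
      split; first exact: cmeasurable_ctensor_bump.
      + by exists 1 => x; exact: ctensor_bump_le1.
      + by move=> x Qx; apply: ctensor_bump_out => H; exact/Qx/sub.
    have [_ _ gQ] := bg.
    have [iSg TS] := hrep F sF g sg.
    (* Supports are closures, contained in closed boxes; those of g and of [F i0] are disjoint along
       the axis j0. This is the support condition of [has_kernel]. *)
    have disj : csupp g `&` \bigcap_(i in [set: 'I_m]) csupp (F i) = set0.
      rewrite -subset0 => x [/cg gx /(_ i0 I) Fx].
      have [a2 [b2 [k2 [sub2 EF]]]] := bF i0.
      have [_ _ cF] := bump_test k2 sub2; rewrite EF in Fx.
      by case: (sep_closed (gx j0) (cF _ Fx j0)).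
    have TK := hker F g tF tg disj.
    (* On Q the kernels K and [offdiag K] give the same integrand: where [F i0] is nonzero, y_{i0}
       is at distance at least [del] from x. *)
    have KE : (fun x => cintegral (lebm R n m) (kernel_integrand K F x) * g x) =
              (fun x => kernel_int K F x * g x).
      apply/funext => x; have [Qx|Qx] := pselect (Q x); last by rewrite gQ// !mulr0.
      congr (_ * _); congr cintegral; apply/funext => y; rewrite /kernel_integrand.
      case: (eqVneq (F i0 (y ord0 i0)) 0) => [F0|F0].
        by rewrite [X in _ * X](bigD1 i0)//= [in RHS](bigD1 i0)//= F0 !mul0r !mulr0.
      rewrite offdiagE//; apply: (@consv_offdiag _ _ _ x y i0 del) => //.
      apply: sep_dist => //; apply: contrapT => /(gF i0).2 /eqP.
      by rewrite (negPf F0).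
    rewrite (_ : (fun _ => _) = fun x => S F x * g x - kernel_int K F x * g x); last first.
      apply/funext => x; have [Qx|Qx] := pselect (Q x).
        by rewrite /defect cut_in// mulrBl.
      by rewrite gQ// !mulr0 subrr.
    have iU : cintegrable (leb R n) (fun x => kernel_int K F x * g x).
      have := cintegrableB iSg (iwg g bg); congr cintegrable; apply/funext => x.
      have [Qx|Qx] := pselect (Q x).
        by rewrite /defect cut_in//; ring.
      by rewrite gQ// !mulr0 subrr.
    by rewrite cintegralB// -TS TK KE subrr.
apply: cintegral_ae_eq0 => // A mA.
rewrite -(Pind A mA); congr cintegral; apply/funext => x.
have [Qx|Qx] := pselect (Q x); last first.
  by rewrite wQ// mul0r /cut wQ//; case: ifP.
have [Ax|Ax] := pselect (A x).
  by rewrite /indC !cut_in// mulr1.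
by rewrite /indC !cut_out ?mulr0// => -[].
Qed.

Theorem separated_representation F : (forall i, good i (F i)) ->
  {ae leb R n, forall x, Q x -> S F x = kernel_int K F x}.
Proof.
(* Arguments of index below j are arbitrary and those from j on are bumps; passing from j to j + 1
   frees the argument j through [defect_slot]. *)
suff H : forall j F, (j <= m)%N -> (forall i : 'I_m, good i (F i)) ->
    (forall i : 'I_m, (j <= i)%N -> is_bump i (F i)) ->
    {ae leb R n, forall x, defect F x = 0}.
  move=> gF; have := H m F (leqnn m) gF.
  (* At j = m no index is left, and the condition on bumps is void. *)
  move=> /(_ (fun i mi => False_ind _ (elimF idP (leq_gtF (ltn_ord i)) mi))).
  apply: filterS => x; rewrite /defect => + Qx; rewrite cut_in// => /eqP.
  by rewrite subr_eq0 => /eqP.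
elim=> [|j IH] {}F jm gF bF; first by apply: defect_bumps => i; exact: bF.
pose i : 'I_m := Ordinal jm.
rewrite -(upd_id F i); apply: defect_slot => // a' b' k sub.
have bb : is_bump i (ctensor (fun l => bump (a' l) (b' l) k)) by exists a', b', k.
apply: IH; first exact: ltnW.
  by apply: upd_all => //; exact: good_bump.
move=> l jl; have [->|li] := eqVneq l i; first by rewrite upd_eq.
rewrite upd_neq//; apply: bF; rewrite ltn_neqAle jl andbT eq_sym.
by apply: contra li => /eqP lj; apply/eqP/val_inj.
Qed.

End separated_boxes.
End representation.

(** * Change of radius in the local part *)

Lemma eball_subset (R : realType) (n : nat) (x : 'rV[R]_n) (r s : R) : r <= s ->
  eball x r `<=` eball x s.
Proof. by move=> rs y; rewrite /eball/= => /lt_le_trans; exact. Qed.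

Lemma eball_obox (R : realType) (n : nat) (x : 'rV[R]_n) (r : R) :
  eball x r `<=` obox (fun i => x ord0 i - r) (fun i => x ord0 i + r).
Proof.
move=> y; rewrite /eball/= => yr i.
have := le_lt_trans (coord_le_enorm (y - x) i) yr.
by rewrite !mxE ltr_distl.
Qed.

Lemma leb_eball_lty (R : realType) (n : nat) (x : 'rV[R]_n) (r : R) :
  (leb R n (eball x r) < +oo)%E.
Proof.
apply: le_lt_trans (leb_obox_lty (fun i => x ord0 i - r) (fun i => x ord0 i + r)).
apply: le_measure; rewrite ?inE; last exact: eball_obox.
  exact: measurable_eball.
exact: measurable_obox.
Qed.

Lemma ae_bigcup (R : realType) d (T : measurableType d)
    (mu : {measure set T -> \bar R}) (I : countType) (P : I -> T -> Prop) :
  (forall i, {ae mu, forall x, P i x}) -> {ae mu, forall x, forall i, P i x}.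
Proof.
move=> H; have : {ae mu, forall x, forall k : nat,
    if unpickle k is Some i then P i x else True}.
  apply/ae_foralln => k; case: (unpickle k) => [i|]; first exact: H.
  exact: aeW.
by apply: filterS => x Hx i; have := Hx (pickle i); rewrite pickleK.
Qed.

Section local_representation.
Context (R : realType) (n m : nat).
Local Notation Rn := 'rV[R]_n.
Local Notation fam := ('I_m -> Rn -> R[i]).
Hypothesis hn : (0 < n)%N.
Variable K : 'rV[Rn]_m.+1 -> R[i].
Variable T : fam -> (Rn -> R[i]) -> R[i].
Hypothesis hT : cz_operator K T.
Variables (p : R) (q : 'I_m -> R).
Hypotheses (hp : 1 < p) (hq : forall i, 1 < q i).
Variable S : fam -> Rn -> R[i].
Hypothesis hS : bounded_extension T q p S.
Variable x0 : Rn.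

Let hK : cz_kernel K. Proof. by case: hT. Qed.
Let p0 : 0 < p. Proof. exact: lt_trans hp. Qed.
Let q0 i : 0 < q i. Proof. exact: lt_trans (hq i). Qed.
Let qn0 i : q i != 0. Proof. by rewrite gt_eqF. Qed.

Definition ball_Lp (M : R) i (f : Rn -> R[i]) : Prop :=
  Lp (leb R n) (q i) f /\ forall x, ~ eball x0 M x -> f x = 0.

Lemma ball_Lp_cut M (A : set Rn) i f : measurable A -> ball_Lp M i f ->
  ball_Lp M i (cut A f).
Proof.
move=> mA [Lf f0]; split; first exact: Lp_cut.
by move=> x Mx; rewrite /cut f0//; case: ifP.
Qed.

Lemma ball_Lp_linear M i (c : R[i]) f h : ball_Lp M i f -> ball_Lp M i h ->
  ball_Lp M i (fun x => c * f x + h x).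
Proof.
move=> [Lf f0] [Lh h0]; split; first by apply: LpD; [exact: ltW|exact: LpZ|].
by move=> x Mx; rewrite f0// h0// mulr0 addr0.
Qed.

Lemma dist_cintegrable M F j x (del : R) : 0 < del ->
  (forall i, ball_Lp M i (F i)) ->
  (forall y, F j y != 0 -> del <= enorm (x - y)) ->
  cintegrable (lebm R n m) (kernel_integrand (offdiag K) F x).
Proof.
move=> d0 bF Fd; have [C C0 HC] := offdiag_size hK.
have mF i : cmeasurable (F i) by case: (bF i) => -[].
have A0 : 0 <= C / del ^+ (m * n) by rewrite divr_ge0 ?exprn_ge0 ?ltW.
have HA (y : 'rV[Rn]_m) : (forall i, F i (y ord0 i) != 0) ->
    cabs (offdiag K (consv x y)) <= C / del ^+ (m * n).
  by move=> Fy; apply: (HC x y j) => //; exact: Fd.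
apply/cintegrableP; split; first exact: cmeasurable_kernel_integrand.
apply: le_lt_trans (kernel_integrand_bound mF A0 HA) _.
rewrite lte_mul_pinfty ?lee_fin//; apply: prode_lty => i.
  by apply: integral_ge0 => u _; rewrite lee_fin cabs_ge0.
move=> _; have [LF F0] := bF i.
by apply: (Lp_int_cabs_lty (hq i) (measurable_eball x0 M)) => //; exact: leb_eball_lty.
Qed.

(** * Representation on a small cube, one argument vanishing around it *)

Section cell.
Variables (M del : R) (F : fam) (j : 'I_m) (z : Rn).
Hypothesis del0 : 0 < del.
Hypothesis bF : forall i, ball_Lp M i (F i).

Let Q := obox (fun i => z ord0 i - del) (fun i => z ord0 i + del).
(** Only the first l coordinates are constrained: the whole space for l = 0, the open cube of
    half-side 2 del around z for l = n. *)
Let V l : set Rn :=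
  [set y | forall i : 'I_n, (i < l)%N -> `|y ord0 i - z ord0 i| < 2 * del].
Let Pr f := {ae leb R n, forall x, Q x ->
  S (upd F j f) x = kernel_int K (upd F j f) x}.

Let far_from_Q (f : Rn -> R[i]) : (forall y, V n y -> f y = 0) ->
  forall x y : Rn, Q x -> f y != 0 -> del <= enorm (x - y).
Proof.
move=> fV x y Qx; apply: contraNT; rewrite -ltNge => xy; apply/eqP/fV => i _.
have := Qx i; rewrite -ltr_distl => h1.
have := le_lt_trans (coord_le_enorm (x - y) i) xy; rewrite !mxE distrC => h2.
rewrite -(subrKA (x ord0 i)); apply: le_lt_trans (ler_normD _ _) _.
by rewrite mulr2n mulrDl mul1r ltrD.
Qed.

Let Pr_add f h : ball_Lp M j f -> ball_Lp M j h ->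
  (forall y, V n y -> f y = 0) -> (forall y, V n y -> h y = 0) ->
  Pr f -> Pr h -> Pr (fun y => 1 * f y + h y).
Proof.
move=> bf bh fV hV Pf Ph; have [_ SL _ _] := hS.
have LF k : Lp (leb R n) (q k) (F k) by case: (bF k).
apply: filterS3 (SL F j 1 f h LF bf.1 bh.1) Pf Ph => x -> Hf Hh Qx.
rewrite Hf// Hh//.
have if_ : cintegrable (lebm R n m) (kernel_integrand (offdiag K) (upd F j f) x).
  apply: (@dist_cintegrable M _ j x del) => //; first exact: upd_all.
  by move=> y; rewrite upd_eq; exact: far_from_Q.
have ih : cintegrable (lebm R n m) (kernel_integrand (offdiag K) (upd F j h) x).
  apply: (@dist_cintegrable M _ j x del) => //; first exact: upd_all.
  by move=> y; rewrite upd_eq; exact: far_from_Q.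
rewrite /kernel_int -cintegralZ// -cintegralD//; last exact: cintegrableZ.
by congr cintegral; apply/funext => y; rewrite kernel_integrand_upd.
Qed.

(** A slab beside Q is separated from it along the axis l, with gap del / 2; the other sides of the
    boxes come from the ball of radius M containing the supports. *)
Let Pr_half f (l : 'I_n) (a b : R) : ball_Lp M j f ->
  z ord0 l + del + del / 2 <= a \/ b + del / 2 <= z ord0 l - del ->
  (forall y, f y != 0 -> a < y ord0 l < b) -> Pr f.
Proof.
move=> bf ab fab.
pose a1 i k := if (i == j) && (k == l) then a else x0 ord0 k - M.
pose b1 i k := if (i == j) && (k == l) then b else x0 ord0 k + M.
have d20 : 0 < del / 2 by rewrite divr_gt0.
apply: (@separated_representation R n m K T hT p q hp hq S hS _ _ a1 b1 j l
  (del / 2) d20); first by rewrite /a1 /b1 !eqxx.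
move=> i; rewrite /upd; case: eqVneq => [->|ij].
  split; first by case: bf.
  move=> y Py; apply/eqP; apply: contraT => fy; exfalso; apply: Py => k.
  rewrite /a1 /b1 eqxx /=; case: eqVneq => [->|kl]; first exact: fab.
  apply: eball_obox; apply: contrapT => /bf.2 /eqP; by rewrite (negPf fy).
split; first by case: (bF i).
move=> y Py; apply/eqP; apply: contraT => fy; exfalso; apply: Py => k.
rewrite /a1 /b1 (negPf ij) /=.
by apply: eball_obox; apply: contrapT => /(bF i).2 /eqP; rewrite (negPf fy).
Qed.

Let mhalf (l : 'I_n) (B : set R) : measurable B ->
  measurable [set y : Rn | B (y ord0 l)].
Proof.
by move=> mB; rewrite -[X in measurable X]setTI; apply: measurable_rowvec_coord.
Qed.

(** The complement of a cube is not a box, but it can be peeled one coordinate at a time. The parts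
    of f beyond the two hyperplanes at distance 3/2 del from z fall under [Pr_half]; what remains
    vanishes on a set [V l] with one constraint fewer. *)
Lemma cell_representation : (forall y, V n y -> F j y = 0) ->
  {ae leb R n, forall x, Q x -> S F x = kernel_int K F x}.
Proof.
move=> FV; suff H : forall l f, (l <= n)%N -> ball_Lp M j f ->
    (forall y, V l y -> f y = 0) -> Pr f.
  by have := H n (F j) (leqnn n) (bF j) FV; rewrite /Pr upd_id.
elim=> [|l IH] f ln bf fV.
  (* [V 0] is the whole space, so f = 0: the bounds of the slab are arbitrary, and [hn] supplies an
     axis. *)
  apply: (@Pr_half _ (Ordinal hn) (z ord0 (Ordinal hn) + del + del / 2) 0) => //.
    by left.
  by move=> y; rewrite fV ?eqxx.
pose i : 'I_n := Ordinal ln.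
pose c := z ord0 i.
pose Hp := [set y : Rn | `]c + del + del / 2, +oo[%classic (y ord0 i)].
pose Hm := [set y : Rn | `]-oo, c - del - del / 2[%classic (y ord0 i)].
have mHp : measurable Hp by apply: mhalf; exact: measurable_itv.
have mHm : measurable Hm by apply: mhalf; exact: measurable_itv.
pose fp := cut Hp f; pose fm := cut Hm f; pose fr := cut (~` (Hp `|` Hm)) f.
have d20 : 0 < del / 2 by rewrite divr_gt0.
have fE : f = fun y => 1 * fp y + (1 * fm y + fr y).
  apply/funext => y; rewrite !mul1r /fp /fm /fr.
  have [yp|yp] := pselect (Hp y).
    rewrite cut_in// [X in _ + (X + _)]cut_out ?[X in _ + (_ + X)]cut_out ?addr0//.
      by move=> H; apply: H; left.
    move: yp; rewrite /Hp /Hm/= !in_itv/= andbT => h1 h2; lra.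
  have [ym|ym] := pselect (Hm y).
    rewrite cut_out// [X in _ + (X + _)]cut_in// cut_out ?addr0 ?add0r//.
    by move=> H; apply: H; right.
  rewrite cut_out// [X in _ + (X + _)]cut_out// cut_in ?add0r//.
  by case.
have cutV (A : set Rn) y : V n y -> cut A f y = 0.
  move=> Vy; rewrite /cut fV; first by case: ifP.
  by move=> k kl; apply: Vy; rewrite ltn_ord.
have bp : ball_Lp M j fp by exact: ball_Lp_cut.
have bm : ball_Lp M j fm by exact: ball_Lp_cut.
have br : ball_Lp M j fr.
  by apply: ball_Lp_cut => //; apply: measurableC; exact: measurableU.
rewrite fE; apply: Pr_add => //; try exact: cutV.
- exact: ball_Lp_linear.
- by move=> y Vy; rewrite /fm /fr !cutV// mulr0 addr0.
- apply: (@Pr_half _ i (c + del + del / 2) (x0 ord0 i + M)) => //; first by left.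
  move=> y fy; have [yp|yp] := pselect (Hp y); last by move: fy; rewrite /fp cut_out ?eqxx.
  move: (yp); rewrite /Hp/= in_itv/= andbT => ->/=.
  have : eball x0 M y by apply: contrapT => /bp.2 /eqP; rewrite (negPf fy).
  by move/eball_obox => /(_ i) /andP[].
- apply: Pr_add => //; try exact: cutV.
  + apply: (@Pr_half _ i (x0 ord0 i - M) (c - del - del / 2)) => //.
      by right; rewrite subrK.
    move=> y fy; have [ym|ym] := pselect (Hm y); last by move: fy; rewrite /fm cut_out ?eqxx.
    move: (ym); rewrite /Hm/= in_itv/= => ->/=; rewrite andbT.
    have : eball x0 M y by apply: contrapT => /bm.2 /eqP; rewrite (negPf fy).
    by move/eball_obox => /(_ i) /andP[].
  + apply: IH => //; first exact: ltnW.
    (* In the middle slab |y_i - c| <= 3/2 del < 2 del, so a point of [V l] lying there belongs to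
       [V l.+1], where f vanishes. *)
    move=> y Vy; rewrite /fr; have [h|h] := pselect ((~` (Hp `|` Hm)) y); last by rewrite cut_out.
    rewrite cut_in// fV// => k; rewrite ltnS leq_eqVlt => /predU1P[kl|]; last exact: Vy.
    have -> : k = i by exact: val_inj.
    have h1 : y ord0 i <= c + del + del / 2.
      by rewrite leNgt; apply/negP => H; apply: h; left; rewrite /Hp/= in_itv/= andbT.
    have h2 : c - del - del / 2 <= y ord0 i.
      by rewrite leNgt; apply/negP => H; apply: h; right; rewrite /Hm/= in_itv/=.
    rewrite -/c ltr_distl; apply/andP; split; lra.
Qed.

End cell.

(** A grid of small cubes covers the ball; countably many null sets are discarded, one for each
    cube. *)
Lemma ball_representation (r M : R) F j : 0 < r ->
  (forall i, ball_Lp M i (F i)) -> (forall y, eball x0 (2 * r) y -> F j y = 0) ->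
  {ae leb R n, forall x, eball x0 r x -> S F x = kernel_int K F x}.
Proof.
move=> r0 bF Fj.
(* Let u be a common point of the ball and a cell. The cube of half-side 2 del around the node lies
   within 3 del of u in each coordinate, hence within 3 n del < r of u, so inside B(x0, 2r), where
   [F j] vanishes. *)
pose del := r / (3 * n.+1%:R).
have n10 : 0 < 3 * n.+1%:R :> R by rewrite mulr_gt0.
have d0 : 0 < del by rewrite divr_gt0.
pose z (k : 'rV[int]_n) : Rn := \row_i (del * (k ord0 i)%:~R).
pose Q k := obox (fun i => z k ord0 i - del) (fun i => z k ord0 i + del).
have HQ k : {ae leb R n, forall x, eball x0 r x -> Q k x -> S F x = kernel_int K F x}.
  have [[u [ur Qu]]|none] := pselect (exists u, eball x0 r u /\ Q k u); last first.
    by apply: aeW => x xr Qx; exfalso; apply: none; exists x.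
  have := @cell_representation M del F j (z k) d0 bF.
  have FV (y : Rn) : (forall i : 'I_n, (i < n)%N -> `|y ord0 i - z k ord0 i| < 2 * del) -> F j y = 0.
    move=> Vy; apply: Fj; rewrite /eball/=.
    have yu : enorm (y - u) <= n%:R * (3 * del).
      apply: le_trans (enorm_le_sum _) _.
      rewrite mulr_natl -[X in _ <= _ *+ X]card_ord -sumr_const; apply: ler_sum => i _.
      rewrite !mxE; have h1 := Vy i (ltn_ord i).
      have := Qu i; rewrite -ltr_distl => h2.
      rewrite -(subrKA (z k ord0 i)); apply: le_trans (ler_normD _ _) _.
      rewrite [X in _ + X]distrC; lra.
    have nd : n%:R * (3 * del) < r.
      rewrite /del -[ltRHS]mul1r invfM !mulrA [n%:R * 3]mulrC.
      rewrite (_ : 3 * n%:R * r / 3 / n.+1%:R = n%:R / n.+1%:R * r); last first.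
        by field; rewrite ?pnatr_eq0// nat1r.
      by rewrite ltr_pM2r// ltr_pdivrMr// mul1r ltr_nat.
    apply: le_lt_trans (ler_enormB y u x0) _.
    rewrite mulr2n mulrDl mul1r ltrD//; exact: le_lt_trans yu nd.
  move=> /(_ FV); apply: filterS => x H _ Qx; exact: H.
have := ae_bigcup HQ; apply: filterS => x Hx xr.
pose k : 'rV[int]_n := \row_i Num.floor (x ord0 i / del).
apply: (Hx k xr) => i; rewrite /z !mxE.
have h1 : (Num.floor (x ord0 i / del))%:~R <= x ord0 i / del by exact: floor_le.
have h2 : x ord0 i / del < (Num.floor (x ord0 i / del) + 1)%:~R by exact: floorD1_gt.
rewrite ler_pdivlMr// in h1; rewrite intrD ltr_pdivrMr// mulrDl mul1r in h2.
rewrite mulrC; apply/andP; split; lra.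
Qed.

(** * Shrinking the local part one argument at a time *)

Section telescoping.
Variables (F : fam) (r s : R).
Hypotheses (r0 : 0 < r) (rs : r <= s).
Hypothesis LF : forall i t, 0 < t -> Lp (leb R n) (q i) (cut (eball x0 t) (F i)).

Definition near_fam (t : R) : fam := fun i => cut (eball x0 (2 * t)) (F i).

Let W (j : nat) : fam := fun i => if (i < j)%N then near_fam r i else near_fam s i.

Let bN t i : 0 < t -> t <= s -> ball_Lp (2 * s) i (near_fam t i).
Proof.
move=> t0 ts; split; first by apply: LF; rewrite mulr_gt0.
by move=> y ys; apply: cut_out => H; apply: ys; apply: eball_subset H; rewrite ler_pM2l.
Qed.

Let s0 : 0 < s. Proof. exact: lt_le_trans rs. Qed.

Let bW j i : ball_Lp (2 * s) i (W j i).
Proof. by rewrite /W; case: ifP => _; exact: bN. Qed.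

(** The families [W j] and [W j.+1] differ in one slot, by the part of [F i] between the two balls;
    it vanishes on B(x0, 2r) and [ball_representation] applies. Integrability is part of the
    induction, as the two integrands need not be integrable separately. *)
Lemma near_fam_difference :
  {ae leb R n, forall x, eball x0 r x ->
    cintegrable (lebm R n m) (fun y => kernel_integrand (offdiag K) (near_fam s) x y -
      kernel_integrand (offdiag K) (near_fam r) x y) /\
    S (near_fam s) x - S (near_fam r) x =
    cintegral (lebm R n m) (fun y => kernel_integrand (offdiag K) (near_fam s) x y -
      kernel_integrand (offdiag K) (near_fam r) x y)}.
Proof.
have W0 : W 0 = near_fam s by [].
have Wm : W m = near_fam r by apply/funext => i; rewrite /W ltn_ord.
have H j : (j <= m)%N -> {ae leb R n, forall x, eball x0 r x ->
    cintegrable (lebm R n m) (fun y => kernel_integrand (offdiag K) (W 0) x y -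
      kernel_integrand (offdiag K) (W j) x y) /\
    S (W 0) x - S (W j) x =
    cintegral (lebm R n m) (fun y => kernel_integrand (offdiag K) (W 0) x y -
      kernel_integrand (offdiag K) (W j) x y)}; last first.
  by have := H m (leqnn m); rewrite Wm.
elim: j => [|j IH] jm.
  apply: aeW => x _; under eq_fun do rewrite subrr.
  by rewrite subrr cintegral0; split => //; exact: cintegrable0.
pose i : 'I_m := Ordinal jm.
pose D := eball x0 (2 * s) `\` eball x0 (2 * r).
have mD : measurable D by apply: measurableD; exact: measurable_eball.
pose f := cut D (F i).
have bf : ball_Lp (2 * s) i f.
  have -> : f = cut D (near_fam s i).
    apply/funext => y; rewrite /f /near_fam; have [Dy|Dy] := pselect (D y).
      by rewrite !cut_in//; case: Dy.
    by rewrite !cut_out.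
  by apply: ball_Lp_cut => //; exact: bN.
have E1 : W j = upd (W j) i (fun y => 1 * f y + near_fam r i y).
  apply/funext => k; rewrite /upd; case: eqVneq => // ->; apply/funext => y.
  rewrite /W/= ltnn mul1r /f /near_fam.
  have sub : eball x0 (2 * r) `<=` eball x0 (2 * s) by apply: eball_subset; rewrite ler_pM2l.
  have [yr|yr] := pselect (eball x0 (2 * r) y).
    rewrite cut_in; last exact: sub.
    by rewrite cut_out ?cut_in ?add0r// => -[_]; apply.
  have [ys|ys] := pselect (eball x0 (2 * s) y).
    by rewrite cut_in// cut_in// cut_out ?addr0.
  by rewrite !cut_out ?addr0// => -[].
have E2 : W j.+1 = upd (W j) i (near_fam r i).
  apply/funext => k; rewrite /upd /W ltnS leq_eqVlt -(inj_eq val_inj)/=.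
  by case: eqVneq => [kj|] //=; rewrite (_ : k = i)//; exact: val_inj.
have [_ SL _ _] := hS.
have LW k : Lp (leb R n) (q k) (W j k) by case: (bW j k).
have br : ball_Lp (2 * s) i (near_fam r i) by exact: bN.
have bU : forall k, ball_Lp (2 * s) k (upd (W j) i f k) by apply: upd_all.
have fr y : eball x0 (2 * r) y -> upd (W j) i f i y = 0.
  by move=> yr; rewrite upd_eq /f cut_out// => -[].
have rep := ball_representation r0 bU fr.
apply: filterS3 (IH (ltnW jm)) (SL (W j) i 1 f (near_fam r i) LW bf.1 br.1) rep.
move=> x IHx Lx rx xr; have [I1 V1] := IHx xr.
have iU : cintegrable (lebm R n m) (kernel_integrand (offdiag K) (upd (W j) i f) x).
  have d0 : 0 < r by [].
  apply: (@dist_cintegrable (2 * s) _ i x r) => // y; rewrite upd_eq => fy.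
  have yr : 2 * r <= enorm (y - x0).
    rewrite leNgt; apply/negP => H; move: fy; rewrite /f cut_out ?eqxx// => -[_].
    exact.
  have xr' : enorm (x - x0) < r by exact: xr.
  have := ler_enormB y x x0; rewrite (enormB y x) => h; lra.
have DE y : kernel_integrand (offdiag K) (W j) x y -
    kernel_integrand (offdiag K) (W j.+1) x y = kernel_integrand (offdiag K) (upd (W j) i f) x y.
  by rewrite {1}E1 E2 kernel_integrand_upd mul1r addrK.
have -> : (fun y => kernel_integrand (offdiag K) (W 0) x y - kernel_integrand (offdiag K) (W j.+1) x y) =
    (fun y => (kernel_integrand (offdiag K) (W 0) x y - kernel_integrand (offdiag K) (W j) x y) +
      kernel_integrand (offdiag K) (upd (W j) i f) x y).
  by apply/funext => y; rewrite -DE subrKA.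
split; first exact: cintegrableD.
rewrite cintegralD// -V1 -/(kernel_int K _ x) -rx//.
rewrite -E1 -E2 mul1r in Lx; rewrite -[LHS](subrKA (S (W j) x)); congr (_ + _).
by rewrite Lx addrK.
Qed.

End telescoping.
End local_representation.

(** * The far part *)

Lemma leb_cube (R : realType) (n : nat) (x : 'rV[R]_n) (h : R) : 0 < h ->
  leb R n (obox (fun i => x ord0 i - h) (fun i => x ord0 i + h)) = ((2 * h) ^+ n)%:E.
Proof.
move=> h0; rewrite leb_oboxE (eq_bigr (fun _ => (2 * h)%:E)); last first.
  move=> i _; rewrite /leb1 lebesgue_measure_itv/= lte_fin ifT; last by lra.
  by rewrite -EFinB; congr EFin; ring.
by rewrite prod_EFin prodr_const card_ord.
Qed.

(** The ball lies between the cubes of half-sides r / (n + 1) and r, which gives the growth r^n on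
    both sides. *)
Lemma leb_eball_bounds (R : realType) (n : nat) (x : 'rV[R]_n) :
  exists c1 c2 : R, [/\ 0 < c1, 0 < c2 & forall r, 0 < r ->
    ((c1 * r ^+ n)%:E <= leb R n (eball x r) <= (c2 * r ^+ n)%:E)%E].
Proof.
exists ((2 / n.+1%:R) ^+ n), (2 ^+ n); split.
- by rewrite exprn_gt0// divr_gt0.
- by rewrite exprn_gt0.
move=> r r0; apply/andP; split.
  have h0 : 0 < r / n.+1%:R by rewrite divr_gt0.
  rewrite -exprMn mulrAC -mulrA -(leb_cube x h0).
  apply: le_measure; rewrite ?inE; [exact: measurable_obox|exact: measurable_eball|].
  move=> y Hy; rewrite /eball/=; apply: le_lt_trans (enorm_le_sum _) _.
  apply: (@le_lt_trans _ _ (n%:R * (r / n.+1%:R))).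
    rewrite mulr_natl -[X in _ <= _ *+ X]card_ord -sumr_const; apply: ler_sum => i _.
    by rewrite !mxE ltW// ltr_distl; exact: Hy.
  by rewrite mulrCA gtr_pMr// ltr_pdivrMr// mul1r ltr_nat.
rewrite -exprMn -(leb_cube x r0).
apply: le_measure; rewrite ?inE; [exact: measurable_eball|exact: measurable_obox|].
exact: eball_obox.
Qed.

Section far_part.
Context (R : realType) (n m : nat).
Local Notation Rn := 'rV[R]_n.
Local Notation fam := ('I_m -> Rn -> R[i]).
Variable K : 'rV[Rn]_m.+1 -> R[i].
Hypothesis hK : cz_kernel K.
Variable x0 : Rn.
Variable F : fam.
Hypothesis mF : forall i, cmeasurable (F i).

Definition far_diff (r : R) (x : Rn) (y : 'rV[Rn]_m) : R[i] :=
  kernel_integrand (offdiag K) F x y -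
  kernel_integrand (offdiag K) (near_fam x0 F r) x y.

Definition far_int (r : R) (x : Rn) : R[i] :=
  cintegral (lebm R n m) (far_diff r x).

Let m_near r i : cmeasurable (near_fam x0 F r i).
Proof. by apply: cmeasurable_cut => //; exact: measurable_eball. Qed.

Lemma cmeasurable_far_int r : cmeasurable (far_int r).
Proof.
apply: (cmeasurable_cintegral (lebm R n m) (f := fun z => far_diff r z.1 z.2)).
by apply: cmeasurableB; apply: cmeasurable_kernel_integrand2.
Qed.

Lemma cmeasurable_far_diff r x : cmeasurable (far_diff r x).
Proof. by apply: cmeasurableB; apply: cmeasurable_kernel_integrand. Qed.

Let outside (r : R) (y : 'rV[Rn]_m) : {ffun 'I_m -> bool} :=
  [ffun i => `[< ~ eball x0 (2 * r) (y ord0 i) >]].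

Lemma far_diff_inside r x (y : 'rV[Rn]_m) : (forall i, eball x0 (2 * r) (y ord0 i)) ->
  far_diff r x y = 0.
Proof.
move=> Hy; rewrite /far_diff /kernel_integrand.
under [X in _ - _ * X]eq_bigr do rewrite /near_fam cut_in//.
by rewrite subrr.
Qed.

Lemma far_diff_outside r x (y : 'rV[Rn]_m) i : ~ eball x0 (2 * r) (y ord0 i) ->
  far_diff r x y = kernel_integrand (offdiag K) F x y.
Proof.
move=> Hy; rewrite /far_diff [X in _ - X](_ : _ = 0) ?subr0//.
by rewrite /kernel_integrand (bigD1 i)//= /near_fam cut_out// mul0r mulr0.
Qed.

Lemma outside_dist r x (y : Rn) : eball x0 r x -> ~ eball x0 (2 * r) y ->
  r <= enorm (x - y).
Proof.
rewrite /eball/= => xr /negP; rewrite -leNgt => yr.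
have := ler_enormB y x x0; rewrite (enormB y x) => h; lra.
Qed.

(** The terms of the local formula have disjoint supports: the choice a contributes only at the y
    whose components outside B(x0, 2r) are exactly those selected by a. *)
Lemma split_fam_integrand r x (a : {ffun 'I_m -> bool}) y : 0 < r ->
  eball x0 r x -> far_choice a ->
  kernel_integrand K (split_fam x0 r F a) x y =
  if a == outside r y then far_diff r x y else 0.
Proof.
move=> r0 xr /existsP; case=> i ai; case: eqVneq => [aE|aN].
  have yi : ~ eball x0 (2 * r) (y ord0 i).
    by move: ai; rewrite aE ffunE => /asboolP.
  rewrite (far_diff_outside _ yi) /kernel_integrand offdiagE; last first.
    by apply: (@consv_offdiag _ _ _ x y i r) => //; exact: outside_dist.
  congr (_ * _); apply: eq_bigr => l _; rewrite /split_fam aE ffunE.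
  by case: asboolP => H; rewrite cut_in//; exact: contrapT.
have [l al] : exists l, a l != outside r y l.
  apply: contrapT => H; move/eqP: aN; apply; apply/ffunP => l.
  by apply/eqP/negPn/negP => al; apply: H; exists l.
rewrite /kernel_integrand (bigD1 l)//= [X in _ * (X * _)](_ : _ = 0) ?mul0r ?mulr0//.
move: al; rewrite /outside ffunE /split_fam; case: (a l); case: asboolP => // H _.
  by rewrite cut_out//; apply/contrapT.
by rewrite cut_out.
Qed.

(** Each far term is dominated by [far_diff], and at each y at most one of them is nonzero; so a
    single integral replaces the 2^m - 1 terms of the local formula. *)
Lemma far_sum r x : 0 < r -> eball x0 r x ->
  cintegrable (lebm R n m) (far_diff r x) ->
  (forall a : {ffun 'I_m -> bool}, far_choice a ->
    cintegrable (lebm R n m) (kernel_integrand K (split_fam x0 r F a) x)) /\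
  \sum_(a : {ffun 'I_m -> bool} | far_choice a)
     cintegral (lebm R n m) (kernel_integrand K (split_fam x0 r F a) x) =
  far_int r x.
Proof.
move=> r0 xr ifar; have [_ foo] := (cintegrableP _ _).1 ifar.
have int_a (a : {ffun 'I_m -> bool}) : far_choice a ->
    cintegrable (lebm R n m) (kernel_integrand K (split_fam x0 r F a) x).
  move=> fa; apply: (@cintegrable_le _ _ _ _ _ (fun y => (cabs (far_diff r x y))%:E)) => //.
    rewrite (_ : kernel_integrand K _ x = kernel_integrand (offdiag K) (split_fam x0 r F a) x).
      apply: cmeasurable_kernel_integrand => // i; apply: cmeasurable_cut => //.
      by case: (a i); [apply: measurableC|]; exact: measurable_eball.
    apply/funext => y; rewrite /kernel_integrand; have /existsP := fa; case=> i ai.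
    have [yi|yi] := pselect (eball x0 (2 * r) (y ord0 i)).
      rewrite [X in _ * X](bigD1 i)//= [in RHS](bigD1 i)//=.
      by rewrite /split_fam ai cut_out ?mul0r ?mulr0.
    rewrite offdiagE//; apply: (@consv_offdiag _ _ _ x y i r) => //.
    exact: outside_dist.
  move=> y; rewrite split_fam_integrand//; case: ifP => // _.
  by rewrite cabs0 lee_fin cabs_ge0.
split=> //; have [_ <-] := cintegral_sum (index_enum _) int_a.
congr cintegral; apply/funext => y.
under eq_bigr => a fa do rewrite split_fam_integrand//.
have [fo|fo] := boolP (far_choice (outside r y)).
  rewrite (bigD1 (outside r y))//= eqxx big1 ?addr0// => a /andP[_ /negPf ->//].
rewrite far_diff_inside; last first.
  move=> i; apply: contrapT => Hi; move: fo; rewrite negb_exists => /forallP/(_ i).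
  by rewrite ffunE => /negP; apply; apply/asboolP.
by rewrite big1// => a fa; case: eqVneq => // aE; move: fo; rewrite -aE fa.
Qed.

Definition radius (r : R) (k : nat) : R := 2 ^+ k * (2 * r).

Lemma radius_gt0 r k : 0 < r -> 0 < radius r k.
Proof. by move=> r0; rewrite mulr_gt0 ?exprn_gt0 ?mulr_gt0. Qed.

Lemma radiusS r k : radius r k.+1 = 2 * radius r k.
Proof. by rewrite /radius exprS -mulrA. Qed.

Lemma radius_ge r k : 0 < r -> 2 * r <= radius r k.
Proof. by move=> r0; rewrite /radius ler_peMl ?mulr_ge0 ?(ltW r0)// exprn_ege1// ler1n. Qed.

(** On the k-th shell some y_i is at distance at least [radius r k] from x0, hence at least half of
    it from x, which accounts for 2^(mn). The shells are never integrated over: [far_diff] is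
    bounded pointwise by the series of all the terms [t k], integrated by monotone convergence. *)
Lemma far_diff_bound (C : R) : 0 < C ->
  (forall (x : Rn) (y : 'rV[Rn]_m) i (del : R), 0 < del ->
    del <= enorm (x - y ord0 i) ->
    cabs (offdiag K (consv x y)) <= C / del ^+ (m * n)%N) ->
  forall r x, 0 < r -> eball x0 r x ->
  (\int[lebm R n m]_y (cabs (far_diff r x y))%:E <=
   \sum_(k <oo) (C * 2 ^+ (m * n) / (radius r k) ^+ (m * n))%:E *
     \prod_(i < m) \int[leb R n]_u (cabs (cut (eball x0 (radius r k.+1)) (F i) u))%:E)%E.
Proof.
move=> C0 HC r x r0 xr.
pose G k i := cut (eball x0 (radius r k.+1)) (F i).
have mG k i : cmeasurable (G k i) by apply: cmeasurable_cut => //; exact: measurable_eball.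
pose c k := C * 2 ^+ (m * n) / radius r k ^+ (m * n).
have c0 k : 0 <= c k by rewrite divr_ge0 ?mulr_ge0 ?exprn_ge0 ?(ltW C0) ?(ltW (radius_gt0 k r0)).
pose t k (y : 'rV[Rn]_m) := ((c k)%:E * (\prod_(i < m) cabs (G k i (y ord0 i)))%:E)%E.
have prod0 k (y : 'rV[Rn]_m) : 0 <= \prod_(i < m) cabs (G k i (y ord0 i)).
  by apply: prodr_ge0 => i _; exact: cabs_ge0.
have t0 k y : (0 <= t k y)%E by rewrite mule_ge0 ?lee_fin.
have mprod k : measurable_fun setT (fun y : 'rV[Rn]_m => (\prod_(i < m) cabs (G k i (y ord0 i)))%:E).
  apply/measurable_EFinP; apply: measurable_prod => i _.
  apply: measurable_cabs; apply: (cmeasurable_comp (mG k i)).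
  exact: measurable_rowvec_coord.
have mt k : measurable_fun setT (t k) by exact: measurable_funeM.
have -> : (\sum_(k <oo) (c k)%:E *
     \prod_(i < m) \int[leb R n]_u (cabs (G k i u))%:E =
     \sum_(k <oo) \int[lebm R n m]_y t k y)%E.
  apply: eq_eseriesr => k _; rewrite /t ge0_integralZl ?lee_fin//.
    by rewrite int_tensor.
  by move=> y _; rewrite lee_fin.
rewrite -integral_nneseries//.
apply: ge0_le_integral_nonmeasurable => y; first by rewrite lee_fin cabs_ge0.
have [inside|] := pselect (forall i, eball x0 (2 * r) (y ord0 i)).
  by rewrite far_diff_inside// cabs0; apply: nneseries_ge0.
move=> /existsNP [i0 yi0]; rewrite (far_diff_outside _ yi0).
have [k1 Hk1] : exists k, [forall i, enorm (y ord0 i - x0) < radius r k].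
  pose M := \sum_(i < m) enorm (y ord0 i - x0).
  exists (Num.truncn (M / (2 * r))).+1; apply/forallP => i.
  apply: (@le_lt_trans _ _ M).
    by rewrite /M (bigD1 i)//= lerDl sumr_ge0// => l _; exact: enorm_ge0.
  rewrite -ltr_pdivrMr ?mulr_gt0//.
  apply: lt_le_trans (truncnS_gt _) _; rewrite -natrX ler_nat.
  by apply: ltnW; exact: ltn_expl.
have exk : exists k, [forall i, enorm (y ord0 i - x0) < radius r k] by exists k1.
(* The least radius containing all the y_i is not [radius r 0] = 2r, because of y_{i0}. Its
   predecessor k indexes the shell: some y_i is outside [radius r k], all are inside
   [radius r k.+1]. *)
case: (ex_minnP exk) => -[|k] /forallP Hk kmin.
  by exfalso; apply: yi0; have := Hk i0; rewrite /radius expr0 mul1r.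
have /existsP : [exists i, radius r k <= enorm (y ord0 i - x0)].
  apply: contraT; rewrite negb_exists => /forallP H.
  have : [forall i, enorm (y ord0 i - x0) < radius r k].
    by apply/forallP => i; rewrite ltNge.
  by move=> /kmin; rewrite ltnn.
case=> i Hi.
apply: (@le_trans _ _ (t k y)); last first.
  rewrite (nneseriesD1 (n := k))//.
  by rewrite leeDl// nneseries_ge0.
rewrite /t -EFinM lee_fin /kernel_integrand cabsM cabs_prod.
have rk0 := radius_gt0 k r0.
have d0 : 0 < radius r k / 2 by rewrite divr_gt0.
apply: ler_pM; rewrite ?cabs_ge0 ?prodr_ge0//.
- by move=> l _; exact: cabs_ge0.
- apply: le_trans (HC x y i _ d0 _) _.
    have xr' : enorm (x - x0) < r by exact: xr.
    have rk := radius_ge k r0.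
    have := ler_enormB (y ord0 i) x x0; rewrite (enormB (y ord0 i) x) => h; lra.
  by rewrite /c expr_div_n invf_div mulrA.
- apply: ler_prod => l _; rewrite cabs_ge0/= /G cut_in//.
  exact: Hk.
Qed.

End far_part.

(** * Morrey estimates *)

Lemma prod_powR (R : realType) (I : Type) (s : seq I) (e : I -> R) (x : R) : 0 < x ->
  \prod_(i <- s) x `^ e i = x `^ (\sum_(i <- s) e i).
Proof.
move=> x0; elim: s => [|i s IH]; first by rewrite !big_nil powRr0.
by rewrite !big_cons IH powRD// (gt_eqF x0) implybT.
Qed.

(** * Dyadic sums and the integral of the hypothesis *)

Section dyadic_sum.
Context (R : realType).
Variables (h : R -> R) (al : R).
Hypothesis h0 : forall s, 0 < s -> 0 <= h s.
Hypothesis al0 : 0 <= al.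

Lemma ess_inf_above_ge0 t : 0 <= t -> (0 <= ess_inf_above t h)%E.
Proof.
(* The half-line up to t is null for the measure restricted to s > t, so it can serve as the
   exceptional set. *)
move=> t0; apply/ess_infP; exists `]-oo, t]%classic; split.
- exact: measurable_itv.
- rewrite /= /mrestr (_ : _ `&` _ = set0) ?measure0//.
  apply/seteqP; split => x //= []; rewrite !in_itv/= andbT => h1 h2.
  by have := le_lt_trans h1 h2; rewrite ltxx.
move=> x /= H; rewrite in_itv/= leNgt; apply/negP => tx; apply: H.
by rewrite lee_fin h0// (le_lt_trans t0).
Qed.

Lemma ess_inf_above_ge t (c : R) : (forall s, t < s -> c <= h s) ->
  (c%:E <= ess_inf_above t h)%E.
Proof.
move=> ch; apply/ess_infP; exists `]-oo, t]%classic; split.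
- exact: measurable_itv.
- rewrite /= /mrestr (_ : _ `&` _ = set0) ?measure0//.
  apply/seteqP; split => x //= []; rewrite !in_itv/= andbT => h1 h2.
  by have := le_lt_trans h1 h2; rewrite ltxx.
move=> x /= H; rewrite in_itv/= leNgt; apply/negP => tx; apply: H.
by rewrite lee_fin ch.
Qed.

Lemma ess_inf_above_mono s t : s <= t -> (ess_inf_above s h <= ess_inf_above t h)%E.
Proof.
move=> st; apply/ess_infP.
have [N [mN N0 HN]] := ess_inf_le (mrestr lebesgue_measure (measurable_itv `]s, +oo[))
  (fun s => (h s)%:E).
exists N; split => //.
apply/eqP; rewrite eq_le measure_ge0 andbT -[leRHS]N0 /mrestr.
apply: le_measure; rewrite ?inE; [exact: measurableI|exact: measurableI|].
apply: setIS => x /=; rewrite !in_itv/= !andbT; exact: le_lt_trans.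
Qed.

(** On the interval from [radius r k] to its double, the infimum is at least its value at the left
    end and t^(-al-1) at least its value at the right end. The length [radius r k] restores the
    exponent -al, and the doubling costs 2^(al+1). Comparing with a step function uses only
    monotonicity of the integral. *)
Lemma dyadic_sum_le r : 0 < r ->
  (\sum_(k <oo) ess_inf_above (radius r k) h * ((radius r k) `^ (- al))%:E <=
   (2 `^ (al + 1))%:E * \int[lebesgue_measure]_(t in `]r, +oo[)
     (ess_inf_above t h * ((t `^ (al + 1))^-1)%:E))%E.
Proof.
move=> r0; pose E t := ess_inf_above t h.
have rad0 k : 0 < radius r k by exact: radius_gt0.
have radS k : radius r k <= radius r k.+1.
  by have := rad0 k; rewrite radiusS; lra.
have radM : {homo radius r : i j / (i <= j)%N >-> i <= j}.
  by apply: homo_leq => //; exact: le_trans.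
have E0 t : 0 < t -> (0 <= E t)%E by move=> t0; apply: ess_inf_above_ge0; exact: ltW.
pose I k := `]radius r k, radius r k.+1]%classic : set R.
pose e k := (E (radius r k) * ((radius r k.+1 `^ (al + 1))^-1)%:E)%E.
have e0 k : (0 <= e k)%E by rewrite mule_ge0 ?E0// lee_fin invr_ge0 powR_ge0.
pose v t := (E t * ((t `^ (al + 1))^-1)%:E)%E.
have finite_sum N : (\sum_(k < N) e k * (radius r k)%:E <=
    \int[lebesgue_measure]_(t in `]r, +oo[) v t)%E.
  have mI k : measurable (I k) by exact: measurable_itv.
  have -> : (\sum_(k < N) e k * (radius r k)%:E)%E =
     (\int[lebesgue_measure]_t (\sum_(k < N) (e k * (\1_(I k) t)%:E)))%E.
    rewrite ge0_integral_sum//; last 2 first.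
    - move=> k; apply: emeasurable_funM; first exact: measurable_cst.
      by apply/measurable_EFinP; apply: measurable_indic; exact: measurable_itv.
    - by move=> k t _; rewrite mule_ge0// lee_fin.
    apply: eq_bigr => k _; rewrite ge0_integralZl//; last first.
      by apply/measurable_EFinP; apply: measurable_indic; exact: measurable_itv.
    have -> : (\int[lebesgue_measure]_x (\1_(I k) x)%:E)%E = lebesgue_measure (I k).
      by rewrite integral_indic ?setIT//; exact: mI.
    rewrite lebesgue_measure_itv/= lte_fin.
    rewrite radiusS ifT; last by rewrite ltr_pMl// ltr1n.
    by rewrite -EFinB; congr (_ * _%:E)%E; ring.
  rewrite [leRHS]integral_mkcond; apply: ge0_le_integral_nonmeasurable => t.
    by apply: sume_ge0 => k _; rewrite mule_ge0// lee_fin.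
  have v0 : (0 <= (v \_ `]r, +oo[) t)%E.
    rewrite patchE; case: ifP => //; rewrite inE/= in_itv/= andbT => rt.
    by rewrite mule_ge0 ?lee_fin ?invr_ge0 ?powR_ge0// E0// (lt_trans r0).
  have [[k Ik]|none] := pselect (exists k : 'I_N, I k t); last first.
    rewrite big1// => k _; rewrite indicE memNset ?mule0// => Ikt.
    by apply: none; exists k.
  rewrite (bigD1 k)//= big1 ?adde0; last first.
    move=> l lk; rewrite indicE memNset ?mule0//; move: Ik; rewrite /I/= !in_itv/=.
    move=> /andP[k1 k2] /andP[l1 l2].
    have := lk; rewrite neq_ltn => /orP[lt|lt].
      by have := lt_le_trans k1 (le_trans l2 (radM _ _ lt)); rewrite ltxx.
    by have := lt_le_trans l1 (le_trans k2 (radM _ _ lt)); rewrite ltxx.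
  rewrite indicE mem_set// mule1; move: Ik; rewrite /I/= in_itv/= => /andP[k1 k2].
  have rt : r < t.
    apply: le_lt_trans k1; apply: le_trans (radius_ge k r0); lra.
  rewrite patchE mem_set; last by rewrite /= in_itv/= rt.
  have t0 : 0 < t by exact: lt_trans rt.
  apply: lee_pmul; rewrite ?E0 ?lee_fin ?invr_ge0 ?powR_ge0//.
    by apply: ess_inf_above_mono; exact: ltW.
  rewrite lef_pV2 ?posrE ?powR_gt0// ge0_ler_powR ?nnegrE ?addr_ge0//; exact: ltW.
have termE k : (E (radius r k) * ((radius r k) `^ (- al))%:E =
    (2 `^ (al + 1))%:E * (e k * (radius r k)%:E))%E.
  rewrite /e radiusS -muleA -EFinM [RHS]muleCA -EFinM; congr (_ * _%:E)%E.
  rewrite powRM ?(ltW (rad0 k))// invfM powRN.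
  have -> : (radius r k `^ (al + 1))^-1 = (radius r k `^ al)^-1 * (radius r k)^-1.
    rewrite powRD; last by rewrite (gt_eqF (rad0 k)) implybT.
    by rewrite powRr1 ?(ltW (rad0 k))// invfM.
  have n1 : (2 : R) `^ (al + 1) != 0 by rewrite gt_eqF// powR_gt0.
  have n2 : radius r k != 0 by rewrite gt_eqF.
  have cancel_ac (a b c : R) : a != 0 -> c != 0 -> b = a * (a^-1 * (b / c) * c).
    by move=> a0 c0; field; rewrite a0 c0.
  exact: cancel_ac.
under eq_eseriesr do rewrite termE.
rewrite nneseriesZl; last by move=> k _; rewrite mule_ge0 ?lee_fin ?(ltW (rad0 k)).
apply: lee_wpmul2l; first by rewrite lee_fin powR_ge0.
apply: lime_le.
  by apply: is_cvg_nneseries => k _ _; rewrite mule_ge0 ?lee_fin ?(ltW (rad0 k)).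
by apply: nearW => N; rewrite big_mkord.
Qed.

End dyadic_sum.

(** * Local and far parts in terms of the Morrey norms *)

Section morrey_estimates.
Context (R : realType) (n m : nat).
Local Notation Rn := 'rV[R]_n.
Local Notation fam := ('I_m -> Rn -> R[i]).
Variables (x0 : Rn) (p : R) (q : 'I_m -> R).
Hypotheses (hp : 1 < p) (hq : forall i, 1 < q i).
Hypothesis hpq : p^-1 = \sum_(i < m) (q i)^-1.
Variable phi : 'I_m -> Rn -> R -> R.
Hypothesis phi0 : forall i x r, 0 < r -> 0 < phi i x r.

Let p0 : 0 < p. Proof. exact: lt_trans hp. Qed.
Let q0 i : 0 < q i. Proof. exact: lt_trans (hq i). Qed.

Lemma leb_eball_gt0 s : 0 < s -> 0 < fine (leb R n (eball x0 s)).
Proof.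
move=> s0; have [c1 [c2 [c10 _ H]]] := leb_eball_bounds x0.
have /andP[h _] := H s s0; rewrite fine_gt0// leb_eball_lty andbT.
by apply: lt_le_trans h; rewrite lte_fin mulr_gt0// exprn_gt0.
Qed.

Definition ball_norm (F : fam) (t : R) : \bar R :=
  (\prod_(i < m) Lpnorm (leb R n) (q i) (cut (eball x0 t) (F i)))%E.

Lemma ball_norm_ge0 F t : (0 <= ball_norm F t)%E.
Proof. by apply: prode_ge0 => i _; exact: Lpnorm_ge0. Qed.

Definition morrey_weight (s : R) : R := (\prod_(i < m) phi i x0 s) * s `^ (n%:R / p).

Lemma LMnorm_ge0 r0 (w : Rn -> R -> R) f : 0 < r0 -> (forall x r, 0 < r -> 0 < w x r) ->
  (0 <= LMnorm r0 w x0 f)%E.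
Proof.
move=> r00 w0; apply: le_trans (ereal_sup_ubound _); last by exists 1 => /=.
by rewrite mule_ge0 ?Lpnorm_ge0// lee_fin mulr_ge0 ?powR_ge0// invr_ge0 ltW// w0.
Qed.

Lemma Lpnorm_ball_le i f s : 0 < s ->
  (Lpnorm (leb R n) (q i) (cut (eball x0 s) f) <=
   (phi i x0 s * (fine (leb R n (eball x0 s))) `^ (q i)^-1)%:E *
     LMnorm (q i) (phi i) x0 f)%E.
Proof.
move=> s0; have := leb_eball_gt0 s0; set b := fine _ => b0; set N := Lpnorm _ _ _.
have H : (((phi i x0 s)^-1 * b `^ (- (q i)^-1))%:E * N <= LMnorm (q i) (phi i) x0 f)%E.
  by apply: ereal_sup_ubound; exists s.
have c0 : 0 < phi i x0 s * b `^ (q i)^-1 by rewrite mulr_gt0 ?powR_gt0 ?phi0.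
have cE : (phi i x0 s)^-1 * b `^ (- (q i)^-1) = (phi i x0 s * b `^ (q i)^-1)^-1.
  by rewrite powRN invfM.
have cn : phi i x0 s * b `^ (q i)^-1 != 0 by rewrite gt_eqF.
rewrite cE in H; rewrite -[N]mul1e -(divff cn) EFinM -muleA.
by apply: lee_wpmul2l => //; rewrite lee_fin ltW.
Qed.

Lemma morrey_weight_ge0 s : 0 < s -> 0 <= morrey_weight s.
Proof.
by move=> s0; rewrite mulr_ge0 ?powR_ge0// prodr_ge0// => i _; rewrite ltW// phi0.
Qed.

Lemma LM_Lp i f t : 0 < t -> LM (q i) (phi i) x0 f ->
  Lp (leb R n) (q i) (cut (eball x0 t) f).
Proof.
move=> t0 [[mf _] foo]; split; first by apply: cmeasurable_cut => //; exact: measurable_eball.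
apply: le_lt_trans (Lpnorm_ball_le i f t0) _.
rewrite lte_mul_pinfty// lee_fin mulr_ge0 ?powR_ge0//; exact/ltW/phi0.
Qed.

Definition morrey_prod (F : fam) : \bar R := (\prod_(i < m) LMnorm (q i) (phi i) x0 (F i))%E.

Lemma morrey_prod_ge0 F : (0 <= morrey_prod F)%E.
Proof. by apply: prode_ge0 => i _; exact: (LMnorm_ge0 (F i) (q0 i) (phi0 i)). Qed.

Lemma morrey_prod_lty F : (forall i, LM (q i) (phi i) x0 (F i)) -> (morrey_prod F < +oo)%E.
Proof.
by move=> LF; apply: prode_lty => i; [exact: (LMnorm_ge0 (F i) (q0 i) (phi0 i))|case: (LF i)].
Qed.

(** The radius s > t occurs only on the right of the inequality [main], which permits the infimum.
    By [hpq] the volumes to the powers 1/q_i multiply to |B(x0, s)|^(1/p) <= (c2 s^n)^(1/p), whence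
    D = c2^(1/p). *)
Lemma ball_norm_weight : exists2 D : R, 0 < D & forall F t, 0 < t ->
  (morrey_prod F < +oo)%E ->
  (ball_norm F t <= D%:E * morrey_prod F * ess_inf_above t morrey_weight)%E.
Proof.
have [c1 [c2 [c10 c20 Hb]]] := leb_eball_bounds x0.
exists (c2 `^ p^-1); first by rewrite powR_gt0.
set D := c2 `^ p^-1; have D0 : 0 < D by rewrite powR_gt0.
move=> F t t0 Foo.
have main s : t < s -> (ball_norm F t <= (D * morrey_weight s)%:E * morrey_prod F)%E.
  move=> ts; have s0 : 0 < s by exact: lt_trans ts.
  apply: (@le_trans _ _ (ball_norm F s)).
    apply: lee_prod => i; first exact: Lpnorm_ge0.
    by apply: le_Lpnorm => // x; apply: cabs_cut_subset; apply: eball_subset; exact: ltW.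
  apply: (@le_trans _ _ (\prod_(i < m) ((phi i x0 s * (fine (leb R n (eball x0 s))) `^ (q i)^-1)%:E *
     LMnorm (q i) (phi i) x0 (F i)))%E).
    by apply: lee_prod => i; [exact: Lpnorm_ge0|exact: Lpnorm_ball_le].
  rewrite big_split/= prod_EFin; apply: lee_wpmul2r; first exact: morrey_prod_ge0.
  rewrite lee_fin big_split/= prod_powR ?leb_eball_gt0// -hpq /morrey_weight mulrCA.
  apply: ler_wpM2l; first by apply: prodr_ge0 => i _; rewrite ltW// phi0.
  have /andP[_ h2] := Hb s s0.
  rewrite (_ : D * _ = (c2 * s ^+ n) `^ p^-1); last first.
    by rewrite powRM ?(ltW c20) ?exprn_ge0 ?(ltW s0)// powRrM powR_mulrn ?(ltW s0).
  apply: ge0_ler_powR.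
  - by rewrite invr_ge0 ltW.
  - by rewrite nnegrE ltW// leb_eball_gt0.
  - by rewrite nnegrE mulr_ge0 ?(ltW c20)// exprn_ge0// ltW.
  - by rewrite -lee_fin fineK// ge0_fin_numE// leb_eball_lty.
have Ffin : morrey_prod F \is a fin_num by rewrite ge0_fin_numE ?morrey_prod_ge0.
have E0 : (0 <= ess_inf_above t morrey_weight)%E.
  by apply: ess_inf_above_ge0 => //; [exact: morrey_weight_ge0|exact: ltW].
(* The bound is divided by the product of the Morrey norms before the infimum is taken. If this
   product is 0, the bound at radius t + 1 already gives a zero norm. *)
have [N0|N0] := eqVneq (morrey_prod F) 0%E.
  have := main (t + 1); rewrite N0 mule0 ltrDl => /(_ ltr01) h.
  by apply: le_trans h _; rewrite mule0 mul0e.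
have Np : 0 < fine (morrey_prod F).
  by rewrite lt_neqAle fine_ge0 ?morrey_prod_ge0// eq_sym andbT fine_eq0.
have Afin : ball_norm F t \is a fin_num.
  rewrite ge0_fin_numE ?ball_norm_ge0//; apply: le_lt_trans (main (t + 1) _) _.
    by rewrite ltrDl.
  rewrite lte_mul_pinfty// lee_fin mulr_ge0 ?(ltW D0)// morrey_weight_ge0//.
  by rewrite addr_gt0.
have DN0 : 0 < D * fine (morrey_prod F) by rewrite mulr_gt0.
rewrite -(fineK Ffin) -EFinM.
have -> : ball_norm F t = ((D * fine (morrey_prod F))%:E *
    (fine (ball_norm F t) / (D * fine (morrey_prod F)))%:E)%E.
  by rewrite -EFinM mulrCA divff ?mulr1 ?fineK// gt_eqF.
apply: lee_wpmul2l; first by rewrite lee_fin ltW.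
apply: ess_inf_above_ge => s ts; rewrite ler_pdivrMr// mulrC mulrAC -lee_fin fineK//.
by rewrite EFinM fineK//; exact: main.
Qed.

(** Hoelder's inequality in each factor: the exponents 1 - 1/q_i of the volumes add up to m - 1/p.
    The resulting s^(mn) will cancel the decay of the kernel and leave s^(-n/p). *)
Lemma tensor_ball_bound : exists2 D : R, 0 < D & forall F s, 0 < s ->
  (forall i, cmeasurable (F i)) ->
  (\prod_(i < m) \int[leb R n]_u (cabs (cut (eball x0 s) (F i) u))%:E <=
   (D * s ^+ (m * n) * s `^ (- (n%:R / p)))%:E * ball_norm F s)%E.
Proof.
have [c1 [c2 [c10 c20 Hb]]] := leb_eball_bounds x0.
have e0 i : 0 < 1 - (q i)^-1 by rewrite subr_gt0 invf_lt1.
have sumE : \sum_(i < m) (1 - (q i)^-1) = m%:R - p^-1.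
  by rewrite sumrB -hpq sumr_const card_ord.
exists (c2 `^ (m%:R - p^-1)); first by rewrite powR_gt0.
move=> F s s0 mF.
have sn0 : 0 < s ^+ n by rewrite exprn_gt0.
have cs0 : 0 < c2 * s ^+ n by rewrite mulr_gt0.
apply: (@le_trans _ _ (\prod_(i < m) (((c2 * s ^+ n) `^ (1 - (q i)^-1))%:E *
   Lpnorm (leb R n) (q i) (cut (eball x0 s) (F i))))%E).
  apply: lee_prod => i.
    by apply: integral_ge0 => u _; rewrite lee_fin cabs_ge0.
  have mc : cmeasurable (cut (eball x0 s) (F i)).
    by apply: cmeasurable_cut => //; exact: measurable_eball.
  apply: le_trans (int_cabs_le_Lpnorm (leb R n) (hq i) (measurable_eball x0 s) mc _) _.
    by move=> u; exact: cut_out.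
  rewrite muleC; apply: lee_wpmul2r; first exact: Lpnorm_ge0.
  have /andP[_ h2] := Hb s s0.
  rewrite -poweR_EFin; apply: gt0_ler_poweR => //; first exact: ltW.
  - by rewrite in_itv/= leey measure_ge0.
  - by rewrite in_itv/= leey lee_fin ltW.
rewrite big_split/= prod_EFin prod_powR// sumE; apply: lee_wpmul2r; first exact: ball_norm_ge0.
rewrite lee_fin powRM ?(ltW c20) ?(ltW sn0)// -mulrA; apply: ler_wpM2l; first exact: powR_ge0.
rewrite -!powR_mulrn ?(ltW s0)// -powRrM -powRD; last by rewrite (gt_eqF s0) implybT.
by rewrite natrM mulrBr [n%:R * m%:R]mulrC.
Qed.

Variables (psi : R -> R) (Cpsi : R).
Hypothesis Cpsi0 : 0 < Cpsi.
Hypothesis hcond : forall r, 0 < r ->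
  (\int[lebesgue_measure]_(t in `]r, +oo[)
     (ess_inf_above t morrey_weight * ((t `^ (n%:R / p + 1))^-1)%:E)
   <= (Cpsi * psi r)%:E)%E.

Let al0 : 0 <= n%:R / p. Proof. by rewrite divr_ge0// ltW. Qed.

Let V r : \bar R := (\sum_(k <oo) ess_inf_above (radius r k) morrey_weight *
  ((radius r k) `^ (- (n%:R / p)))%:E)%E.

Let term_ge0 r k : 0 < r -> (0 <= ess_inf_above (radius r k) morrey_weight *
  ((radius r k) `^ (- (n%:R / p)))%:E)%E.
Proof.
move=> r0; rewrite mule_ge0 ?lee_fin ?powR_ge0//; apply: ess_inf_above_ge0.
  exact: morrey_weight_ge0.
exact/ltW/radius_gt0.
Qed.

Let V_le r : 0 < r -> (V r <= (2 `^ (n%:R / p + 1) * Cpsi * psi r)%:E)%E.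
Proof.
move=> r0; apply: le_trans (dyadic_sum_le morrey_weight_ge0 al0 r0) _.
by rewrite -mulrA EFinM lee_wpmul2l ?lee_fin ?powR_ge0//; exact: hcond.
Qed.

(** The infimum at 2r, times (2r)^(-n/p), is the term of index 0 of the dyadic sum [V r]; so the
    hypothesis controls the local part through the same sum as the far part. *)
Lemma near_norm_bound : exists2 C : R, 0 < C & forall F r, 0 < r ->
  (morrey_prod F < +oo)%E ->
  (ball_norm F (2 * r) <= (C * psi r * r `^ (n%:R / p))%:E * morrey_prod F)%E.
Proof.
have [D D0 HD] := ball_norm_weight.
exists (D * (2 `^ (n%:R / p + 1) * Cpsi) * 2 `^ (n%:R / p)).
  by rewrite !mulr_gt0// powR_gt0.
move=> F r r0 Foo; have r20 : 0 < 2 * r by rewrite mulr_gt0.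
apply: le_trans (HD F (2 * r) r20 Foo) _.
have E0 : (0 <= ess_inf_above (2 * r) morrey_weight)%E.
  by apply: ess_inf_above_ge0; [exact: morrey_weight_ge0|exact: ltW].
have first_term : (ess_inf_above (2 * r) morrey_weight *
    ((2 * r) `^ (- (n%:R / p)))%:E <= V r)%E.
  rewrite /V (nneseriesD1 (n := 0%N))//.
    by rewrite {1 2}/radius expr0 mul1r leeDl// nneseries_ge0// => k _ _; exact: term_ge0.
  by move=> k _; exact: term_ge0.
have P0 : 0 < (2 * r) `^ (n%:R / p) by rewrite powR_gt0.
have -> : ess_inf_above (2 * r) morrey_weight = (((2 * r) `^ (n%:R / p))%:E *
    (ess_inf_above (2 * r) morrey_weight * ((2 * r) `^ (- (n%:R / p)))%:E))%E.
  by rewrite muleCA -EFinM powRN divff ?gt_eqF// mule1.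
apply: (@le_trans _ _ (D%:E * morrey_prod F * (((2 * r) `^ (n%:R / p))%:E *
   (2 `^ (n%:R / p + 1) * Cpsi * psi r)%:E))%E).
  apply: lee_wpmul2l; first by rewrite mule_ge0 ?lee_fin ?(ltW D0)// morrey_prod_ge0.
  apply: lee_wpmul2l; first by rewrite lee_fin ltW.
  exact: le_trans first_term (V_le r0).
rewrite -EFinM muleAC -EFinM; apply: lee_wpmul2r; first exact: morrey_prod_ge0.
rewrite lee_fin powRM ?(ltW r0)// le_eqVlt; apply/orP; left; apply/eqP; ring.
Qed.

Lemma far_norm_bound (K : 'rV[Rn]_m.+1 -> R[i]) : cz_kernel K ->
  exists2 C : R, 0 < C & forall F r x, 0 < r ->
  (forall i, cmeasurable (F i)) -> (morrey_prod F < +oo)%E -> eball x0 r x ->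
  (\int[lebm R n m]_y (cabs (far_diff K x0 F r x y))%:E <=
   (C * psi r)%:E * morrey_prod F)%E.
Proof.
move=> hK.
have [D D0 HD] := ball_norm_weight; have [D1 D10 HD1] := tensor_ball_bound.
have [C C0 HC] := offdiag_size hK.
pose C2 := C * 2 ^+ (m * n).
have C20 : 0 < C2 by rewrite mulr_gt0// exprn_gt0.
(* The power of 2 in [C2] comes from halving the distance in the kernel bound, the other from the
   ratio of consecutive radii; [D1] is the Hoelder constant and [D] that of the weight. *)
pose B := C2 * 2 ^+ (m * n) * D1 * D.
have B0 : 0 < B by rewrite !mulr_gt0// exprn_gt0.
exists (B * (2 `^ (n%:R / p + 1) * Cpsi)); first by rewrite !mulr_gt0// powR_gt0.
move=> F r x r0 mF Foo xr; apply: le_trans (far_diff_bound mF C0 HC r0 xr) _.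
rewrite -/C2.
have M0 := morrey_prod_ge0 F.
have Mfin : morrey_prod F \is a fin_num by rewrite ge0_fin_numE.
pose u k := (ess_inf_above (radius r k) morrey_weight *
  ((radius r k) `^ (- (n%:R / p)))%:E)%E.
have u0 k : (0 <= u k)%E by exact: term_ge0.
pose BM := B * fine (morrey_prod F).
have BM0 : 0 <= BM by rewrite mulr_ge0 ?(ltW B0)// fine_ge0.
(* The k-th shell carries norms over the ball of radius [radius r k.+1], hence the shift: the series
   is compared with the tail of [V r] from index 1, and the non-negative term of index 0 is added
   afterwards. *)
apply: (@le_trans _ _ (\sum_(k <oo) BM%:E * u (k + 1)%N)%E).
  apply: lee_nneseries => [k _ _|k _].
    apply: mule_ge0.
      by rewrite lee_fin divr_ge0 ?(ltW C20)// exprn_ge0// ltW// radius_gt0.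
    by apply: prode_ge0 => i _; apply: integral_ge0 => v _; rewrite lee_fin cabs_ge0.
  have rk0 := radius_gt0 k r0; have rk10 := radius_gt0 k.+1 r0.
  rewrite addn1.
  apply: (@le_trans _ _ ((C2 / radius r k ^+ (m * n))%:E *
    ((D1 * radius r k.+1 ^+ (m * n) * radius r k.+1 `^ (- (n%:R / p)))%:E *
     (D%:E * morrey_prod F * ess_inf_above (radius r k.+1) morrey_weight)))%E).
    apply: lee_wpmul2l; first by rewrite lee_fin divr_ge0 ?(ltW C20)// exprn_ge0// ltW.
    apply: le_trans (HD1 F _ rk10 mF) _.
    apply: lee_wpmul2l; last exact: HD.
    by rewrite lee_fin !mulr_ge0 ?(ltW D10) ?powR_ge0// exprn_ge0// ltW.
  have -> : (BM%:E * u k.+1 = (BM * radius r k.+1 `^ (- (n%:R / p)))%:E *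
      ess_inf_above (radius r k.+1) morrey_weight)%E.
    by rewrite /u muleA muleAC -EFinM.
  rewrite -(fineK Mfin) !muleA -!EFinM.
  apply: lee_wpmul2r.
    by apply: ess_inf_above_ge0; [exact: morrey_weight_ge0|exact: ltW].
  rewrite lee_fin /BM /B le_eqVlt; apply/orP; left; apply/eqP.
  have rn : radius r k ^+ (m * n) != 0 by rewrite expf_neq0// gt_eqF.
  move: (radius r k.+1 `^ _) => w; rewrite radiusS [(2 * radius r k) ^+ _]exprMn.
  move: (radius r k ^+ (m * n)) rn (2 ^+ (m * n)) (fine _) => a a0 b c.
  by field.
rewrite nneseriesZl; last by move=> k _; exact: u0.
rewrite (@nneseries_addn R u 1)//.
apply: (@le_trans _ _ (BM%:E * V r)%E).
  apply: lee_wpmul2l; first by rewrite lee_fin.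
  have -> : V r = (u 0%N + \sum_(1 <= k <oo) u k)%E.
    by exact: (nneseries_recl (P := xpredT) (fun k _ => u0 k) isT).
  exact: leeDr.
apply: (@le_trans _ _ (BM%:E * (2 `^ (n%:R / p + 1) * Cpsi * psi r)%:E)%E).
  by apply: lee_wpmul2l; [rewrite lee_fin|exact: V_le].
rewrite -(fineK Mfin) -!EFinM lee_fin /BM le_eqVlt; apply/orP; left; apply/eqP; ring.
Qed.

End morrey_estimates.

(** * The global function *)

Lemma compact_eball (R : realType) (n : nat) (x0 : 'rV[R]_n) (A : set 'rV[R]_n) :
  (0 < n)%N -> compact A -> exists2 r, 0 < r & A `<=` eball x0 r.
Proof.
case: n x0 A => // n x0 A _ /compact_bounded [M [_ HM]].
pose B := Num.max M 0 + 1.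
have BM : M < B by rewrite /B ltr_pwDr// le_max lexx.
have B0 : 0 < B by rewrite /B ltr_pwDr// le_max lexx orbT.
have e0 : 0 <= enorm x0 by exact: enorm_ge0.
exists (n.+1%:R * B + enorm x0 + 1); first by rewrite ltr_pwDr// addr_ge0// mulr_ge0// ltW.
move=> x Ax; rewrite /eball/=.
have xB := HM B BM x Ax.
have coordB i : `|x ord0 i| <= B.
  apply: le_trans xB; rewrite [`|x|]mx_normrE.
  exact: (le_bigmax _ (fun ij => `|x ij.1 ij.2|) (ord0, i)).
have xn : enorm x <= n.+1%:R * B.
  apply: le_trans (enorm_le_sum x) _.
  apply: le_trans (ler_sum _ (fun i _ => coordB i)) _.
  by rewrite sumr_const card_ord mulr_natl.
have := ler_enormB x 0 x0; rewrite subr0 sub0r.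
have -> : enorm (- x0) = enorm x0 by rewrite -sub0r enormB subr0.
by move=> h; lra.
Qed.

Lemma measurable_glue d d' (T : measurableType d) (U : measurableType d')
    (N : T -> nat) (f : nat -> T -> U) :
  (forall k, measurable (N @^-1` [set k])) ->
  (forall k, measurable_fun [set: T] (f k)) ->
  measurable_fun [set: T] (fun x => f (N x) x).
Proof.
move=> mN mf _ B mB; rewrite setTI.
rewrite (_ : _ @^-1` B = \bigcup_k (N @^-1` [set k] `&` f k @^-1` B)).
  apply: bigcupT_measurable => k; apply: measurableI => //.
  by rewrite -[X in measurable X]setTI; exact: mf.
apply/seteqP; split => [x Bx|x [k _ [/= Nx Bx]]]; first by exists (N x).
by rewrite /= Nx.
Qed.

Section global_operator.
Context (R : realType) (n m : nat).
Hypothesis hn : (0 < n)%N.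
Local Notation Rn := 'rV[R]_n.
Local Notation fam := ('I_m -> Rn -> R[i]).
Variables (K : 'rV[Rn]_m.+1 -> R[i]) (T : fam -> (Rn -> R[i]) -> R[i]).
Hypothesis hT : cz_operator K T.
Variables (p : R) (q : 'I_m -> R).
Hypotheses (hp : 1 < p) (hq : forall i, 1 < q i).
Variable S : fam -> Rn -> R[i].
Hypothesis hS : bounded_extension T q p S.
Variables (x0 : Rn) (F : fam).
Hypothesis mF : forall i, cmeasurable (F i).
Hypothesis LF : forall i t, 0 < t -> Lp (leb R n) (q i) (cut (eball x0 t) (F i)).
Hypothesis iF : forall r x, 0 < r -> eball x0 r x ->
  cintegrable (lebm R n m) (far_diff K x0 F r x).

Let hK : cz_kernel K. Proof. by case: hT. Qed.

Definition ball_operator (r : R) (x : Rn) : R[i] :=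
  S (near_fam x0 F r) x + far_int K x0 F r x.

Lemma local_operatorE r x : 0 < r -> eball x0 r x ->
  local_operator K S x0 r F x = ball_operator r x.
Proof.
move=> r0 xr; rewrite /local_operator /ball_operator.
have [_ ->] := far_sum hK mF r0 xr (iF r0 xr); congr (S _ x + _).
by apply/funext => i; rewrite /split_fam /near_fam ffunE.
Qed.

Lemma near_Lp r i : 0 < r -> Lp (leb R n) (q i) (near_fam x0 F r i).
Proof. by move=> r0; apply: LF; rewrite mulr_gt0. Qed.

Lemma S_near_Lp r : 0 < r -> Lp (leb R n) p (S (near_fam x0 F r)).
Proof. by move=> r0; have [h _ _ _] := hS; apply: h => i; exact: near_Lp. Qed.

Lemma cmeasurable_ball_operator r : 0 < r -> cmeasurable (ball_operator r).
Proof.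
move=> r0; apply: cmeasurableD; first by case: (S_near_Lp r0).
exact: (cmeasurable_far_int hK).
Qed.

(** In the difference of the two far integrands the full product cancels, leaving the difference of
    the near integrands; [near_fam_difference] identifies its integral with the difference of the
    values of S. *)
Lemma ball_operator_consistent r s : 0 < r -> r <= s ->
  {ae leb R n, forall x, eball x0 r x -> ball_operator r x = ball_operator s x}.
Proof.
move=> r0 rs; have s0 : 0 < s by exact: lt_le_trans rs.
apply: filterS (near_fam_difference hn hT hp hq hS r0 rs LF) => x H xr.
have [_ E] := H xr.
have xs : eball x0 s x by exact: eball_subset xr.
have E' : S (near_fam x0 F s) x - S (near_fam x0 F r) x =
    far_int K x0 F r x - far_int K x0 F s x.
  rewrite E /far_int -cintegralB; [|exact: iF|exact: iF].
  congr cintegral; apply/funext => y; rewrite /far_diff; ring.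
apply/esym/eqP; rewrite -subr_eq0 /ball_operator.
apply/eqP; transitivity (S (near_fam x0 F s) x - S (near_fam x0 F r) x -
  (far_int K x0 F r x - far_int K x0 F s x)); first by ring.
by rewrite E' subrr.
Qed.

(** An integer radius whose ball contains x. With countably many radii, the exceptional sets of the
    comparisons remain null together and the pieces glue to a measurable function. *)
Let N (x : Rn) : nat := (Num.truncn (enorm (x - x0))).+1.

Definition global_operator (x : Rn) : R[i] := ball_operator (N x)%:R x.

Let ballN x : eball x0 (N x)%:R x.
Proof. by rewrite /eball/= /N; have /andP[] := truncn_itv (enorm_ge0 (x - x0)). Qed.

Lemma global_operator_ae r : 0 < r ->
  {ae leb R n, forall x, eball x0 r x -> global_operator x = ball_operator r x}.
Proof.
move=> r0.
have H k : {ae leb R n, forall x, eball x0 r x -> eball x0 k.+1%:R x ->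
    ball_operator k.+1%:R x = ball_operator r x}.
  have k0 : 0 < k.+1%:R :> R by [].
  have [rk|kr] := leP r k.+1%:R.
    by apply: filterS (ball_operator_consistent r0 rk) => x h xr _; rewrite h.
  apply: filterS (ball_operator_consistent k0 (ltW kr)) => x h _ xk; exact: h.
by apply: filterS (ae_foralln H) => x h xr; exact: (h _ xr (ballN x)).
Qed.

Lemma cmeasurable_global_operator : cmeasurable global_operator.
Proof.
have mN k : measurable (N @^-1` [set k]).
  case: k => [|k].
    by rewrite (_ : _ @^-1` _ = set0)//; apply/seteqP; split.
  rewrite (_ : _ @^-1` _ = eball x0 k.+1%:R `\` eball x0 k%:R).
    by apply: measurableD; exact: measurable_eball.
  apply/seteqP; split => x; rewrite /N /eball/=.
    move=> [<-]; have /andP[h1 h2] := truncn_itv (enorm_ge0 (x - x0)).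
    by split => //; apply/negP; rewrite -leNgt.
  move=> [h1 /negP]; rewrite -leNgt => h2; congr _.+1; apply/eqP.
  by rewrite truncn_eq ?enorm_ge0// h2.
(* The gluing lemma quantifies over every k, and 0 is not a radius; [maxn k 1] changes nothing along
   N, which is at least 1. *)
have mB k : cmeasurable (ball_operator (maxn k 1)%:R).
  by apply: cmeasurable_ball_operator; rewrite ltr0n leq_max orbT.
have E x : (N x) = maxn (N x) 1 by rewrite /N; case: Num.truncn.
split.
- rewrite (_ : (fun x => _) = fun x => complex.Re (ball_operator (maxn (N x) 1)%:R x)).
    apply: (measurable_glue (f := fun k x => complex.Re (ball_operator (maxn k 1)%:R x))) => // k.
    by case: (mB k).
  by apply/funext => x; rewrite -E.
- rewrite (_ : (fun x => _) = fun x => complex.Im (ball_operator (maxn (N x) 1)%:R x)).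
    apply: (measurable_glue (f := fun k x => complex.Im (ball_operator (maxn k 1)%:R x))) => // k.
    by case: (mB k).
  by apply/funext => x; rewrite -E.
Qed.

Lemma global_operator_value : operator_value K S x0 F global_operator.
Proof.
move=> r r0; split => [x a xr fa|].
  by have [h _] := far_sum hK mF r0 xr (iF r0 xr); exact: h.
apply: filterS (global_operator_ae r0) => x h xr.
by rewrite local_operatorE// h.
Qed.

(** The far part is bounded on the ball by 2 A, with the 2 of [cabs_cintegral_le], so its L^p norm
    is at most this bound times |B(x0, r)|^(1/p). *)
Lemma global_operator_norm_le r (A : R) : 0 < r -> 0 <= A ->
  (forall x, eball x0 r x ->
    (\int[lebm R n m]_y (cabs (far_diff K x0 F r x y))%:E <= A%:E)%E) ->
  (Lpnorm (leb R n) p (cut (eball x0 r) global_operator) <=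
   Lpnorm (leb R n) p (S (near_fam x0 F r)) +
   (2 * A)%:E * leb R n (eball x0 r) `^ p^-1)%E.
Proof.
move=> r0 A0 HA; have p0 : 0 < p by exact: lt_trans hp.
have mb := measurable_eball x0 r.
have mS : cmeasurable (S (near_fam x0 F r)) by case: (S_near_Lp r0).
have mI := cmeasurable_far_int hK x0 mF r.
have mcI : cmeasurable (cut (eball x0 r) (far_int K x0 F r)) by exact: cmeasurable_cut.
have mcS : cmeasurable (cut (eball x0 r) (S (near_fam x0 F r))) by exact: cmeasurable_cut.
apply: (@le_trans _ _ (Lpnorm (leb R n) p (fun x => cut (eball x0 r) (S (near_fam x0 F r)) x +
    cut (eball x0 r) (far_int K x0 F r) x))).
  apply: ae_le_Lpnorm => //.
  - exact: cmeasurable_cut cmeasurable_global_operator.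
  - exact: cmeasurableD.
  apply: filterS (global_operator_ae r0) => x h.
  have [xr|xr] := pselect (eball x0 r x); first by rewrite !cut_in// h.
  by rewrite !cut_out// addr0.
apply: le_trans (LpnormD _ (ltW hp) mcS mcI) _; apply: leeD.
  by apply: le_Lpnorm => // x; exact: cabs_cut_le.
apply: Lpnorm_bounded_le => //; [by rewrite mulr_ge0| |by move=> x; exact: cut_out].
move=> x; have [xr|xr] := pselect (eball x0 r x); last first.
  by rewrite cut_out// cabs0 mulr_ge0.
rewrite cut_in// -lee_fin; apply: le_trans (cabs_cintegral_le (iF r0 xr)) _.
by rewrite EFinM; apply: lee_wpmul2l; [rewrite lee_fin|exact: HA].
Qed.

End global_operator.

(** The value of the operator at F is a function g subject to [operator_value], which determines it
    up to a null set on every ball; C' is chosen before F. *)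
Theorem theorem3p2 (R : realType) (m n : nat) (hm : (0 < m)%N) (hn : (0 < n)%N)
    (K : 'rV['rV[R]_n]_m.+1 -> R[i])
    (T : ('I_m -> 'rV[R]_n -> R[i]) -> ('rV[R]_n -> R[i]) -> R[i])
    (hT : cz_operator K T)
    (x0 : 'rV[R]_n) (p : R) (q : 'I_m -> R)
    (hp : 1 < p) (hq : forall i, 1 < q i)
    (hpq : p^-1 = \sum_(i < m) (q i)^-1)
    (S : ('I_m -> 'rV[R]_n -> R[i]) -> 'rV[R]_n -> R[i])
    (hS : bounded_extension T q p S)
    (psi : 'rV[R]_n -> R -> R) (phi : 'I_m -> 'rV[R]_n -> R -> R)
    (hpsi : positive_measurable psi)
    (hphi : forall i, positive_measurable (phi i))
    (hcond : exists C : R, 0 < C /\ forall r : R, 0 < r ->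
       (\int[lebesgue_measure]_(t in `]r, +oo[)
          (ess_inf_above t
             (fun s : R => (\prod_(i < m) phi i x0 s) * s `^ (n%:R / p))%R *
           ((t `^ (n%:R / p + 1))^-1)%R%:E)
        <= (C * psi x0 r)%R%:E)%E) :
  exists C' : R, 0 < C' /\
    forall F : 'I_m -> 'rV[R]_n -> R[i],
      (forall i, LM (q i) (phi i) x0 (F i)) ->
      exists g : 'rV[R]_n -> R[i],
        [/\ operator_value K S x0 F g,
            LM p psi x0 g &
            (LMnorm p psi x0 g <=
             C'%:E * \prod_(i < m) LMnorm (q i) (phi i) x0 (F i))%E].
Proof.
have p0 : 0 < p by exact: lt_trans hp.
have psi0 r : 0 < r -> 0 < psi x0 r by case: hpsi => h _; exact: h.
have phi0 i x r : 0 < r -> 0 < phi i x r by case: (hphi i) => h _; exact: h.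
have hK : cz_kernel K by case: hT.
have [Cpsi [Cpsi0 hC]] := hcond.
have [Cn Cn0 Hn] := near_norm_bound hp hq hpq phi0 Cpsi0 hC.
have [Cf Cf0 Hf] := far_norm_bound hp hq hpq phi0 Cpsi0 hC hK.
have [_ _ [CS [CS0 HS]] _] := hS.
have [c1 [c2 [c10 c20 Hb]]] := leb_eball_bounds x0.
(* The local part carries r^(n/p), and r^(n/p) |B(x0, r)|^(-1/p) is at most c1^(-1/p) by the lower
   volume bound. The far part carries |B(x0, r)|^(1/p), which the Morrey norm cancels exactly. *)
pose C' := CS * Cn * c1 `^ (- p^-1) + 2 * Cf.
have C'0 : 0 < C' by rewrite addr_gt0 ?mulr_gt0 ?powR_gt0.
exists C'; split => // F LF.
pose MP := morrey_prod x0 q phi F.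
have MP0 : (0 <= MP)%E by exact: morrey_prod_ge0.
have MPoo : (MP < +oo)%E by exact: morrey_prod_lty.
have MPfin : MP \is a fin_num by rewrite ge0_fin_numE.
have mF i : cmeasurable (F i) by case: (LF i) => -[].
have LpF i t : 0 < t -> Lp (leb R n) (q i) (cut (eball x0 t) (F i)).
  by move=> t0; exact: (LM_Lp phi0 t0 (LF i)).
have iF r x : 0 < r -> eball x0 r x -> cintegrable (lebm R n m) (far_diff K x0 F r x).
  move=> r0 xr; apply/cintegrableP; split; first exact: cmeasurable_far_diff.
  apply: le_lt_trans (Hf F r x r0 mF MPoo xr) _.
  by rewrite -/MP -(fineK MPfin) -EFinM ltry.
pose g := global_operator K S x0 F.
have mg : cmeasurable g by exact: (cmeasurable_global_operator hT hS mF LpF).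
have ball_bound r : 0 < r -> (Lpnorm (leb R n) p (cut (eball x0 r) g) <=
    (psi x0 r * (CS * Cn * r `^ (n%:R / p) +
      2 * Cf * (fine (leb R n (eball x0 r))) `^ p^-1))%:E * MP)%E.
  move=> r0; pose A := Cf * psi x0 r * fine MP.
  have A0 : 0 <= A by rewrite !mulr_ge0 ?fine_ge0// ltW// psi0.
  have HA x : eball x0 r x ->
      (\int[lebm R n m]_y (cabs (far_diff K x0 F r x y))%:E <= A%:E)%E.
    by move=> xr; rewrite /A EFinM fineK//; exact: Hf.
  apply: le_trans (global_operator_norm_le hn hT hp hq hS mF LpF iF r0 A0 HA) _.
  have bE : (leb R n (eball x0 r) `^ p^-1)%E = ((fine (leb R n (eball x0 r))) `^ p^-1)%:E.
    by rewrite -poweR_EFin fineK// ge0_fin_numE// leb_eball_lty.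
  have near_bound : (Lpnorm (leb R n) p (S (near_fam x0 F r)) <=
      CS%:E * ((Cn * psi x0 r * r `^ (n%:R / p))%:E * MP))%E.
    apply: le_trans (HS _ _) _; first by move=> i; exact: near_Lp.
    by apply: lee_wpmul2l; [rewrite lee_fin ltW|exact: Hn].
  apply: le_trans (leeD near_bound (lexx _)) _.
  rewrite bE -(fineK MPfin) -!EFinM -EFinD lee_fin le_eqVlt; apply/orP; left.
  by apply/eqP; rewrite /A; ring.
have Mbound : (LMnorm p psi x0 g <= C'%:E * MP)%E.
  apply: ge_ereal_sup => _ [r r0 <-].
  have b0 := leb_eball_gt0 x0 r0; move: (ball_bound r r0).
  set b := fine _ in b0 * => h.
  have ps0 := psi0 r r0.
  apply: le_trans (lee_wpmul2l _ h) _.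
    by rewrite lee_fin mulr_ge0 ?powR_ge0// invr_ge0 ltW.
  rewrite muleA -EFinM; apply: lee_wpmul2r => //; rewrite lee_fin.
  have -> : (psi x0 r)^-1 * b `^ (- p^-1) *
      (psi x0 r * (CS * Cn * r `^ (n%:R / p) + 2 * Cf * b `^ p^-1)) =
      CS * Cn * (r `^ (n%:R / p) * b `^ (- p^-1)) + 2 * Cf.
    rewrite powRN; have := powR_gt0 p^-1 b0; move: (b `^ p^-1) => w w0.
    by field; rewrite !gt_eqF.
  rewrite /C' lerD2r; apply: ler_wpM2l; first by rewrite mulr_ge0// ltW.
  have rn0 : 0 < r ^+ n by rewrite exprn_gt0.
  rewrite !powRN ler_pdivrMr ?powR_gt0// [leRHS]mulrC ler_pdivlMr ?powR_gt0//.
  rewrite (_ : r `^ _ = (r ^+ n) `^ p^-1); last first.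
    by rewrite -powR_mulrn ?(ltW r0)// -powRrM.
  rewrite -powRM ?(ltW rn0) ?(ltW c10)//; apply: ge0_ler_powR.
  - by rewrite invr_ge0 ltW.
  - by rewrite nnegrE mulr_ge0 ?(ltW c10) ?(ltW rn0).
  - by rewrite nnegrE ltW.
  - have /andP[h1 _] := Hb r r0.
    by rewrite mulrC -lee_fin fineK// ge0_fin_numE// leb_eball_lty.
exists g; split => //; first exact: (global_operator_value hn hT hp hq hS mF LpF iF).
split; last by apply: le_lt_trans Mbound _; rewrite -(fineK MPfin) -EFinM ltry.
(* A compact set lies in a ball around x0, where the norm of g is finite by [ball_bound]. *)
split => // A cA; have [r r0 Ar] := compact_eball x0 hn cA.
apply: (@le_lt_trans _ _ (Lpnorm (leb R n) p (cut (eball x0 r) g))).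
  by apply: le_Lpnorm => // x; exact: cabs_cut_subset.
by apply: le_lt_trans (ball_bound r r0) _; rewrite -(fineK MPfin) -EFinM ltry.
Qed.
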